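(* Let $H$ be a separable infinite-dimensional Hilbert space with a fixed orthonormal basis $(e_n)_{n\in\mathbb{N}}$, and identify $\ell^\infty=C(\beta\mathbb{N})$ with the algebra of diagonal operators in $B(H)$. For each $t\in\beta\mathbb{N}$, let $[\delta_t]\subseteq B(H)^*$ be the set of all states of $B(H)$ that extend the Dirac measure $\delta_t$. Then, for each $t\in\beta\mathbb{N}$, either the set $[\delta_t]$ lies in a finite-dimensional subspace of $B(H)^*$, or it contains a homeomorphic copy of $\beta\mathbb{N}$.
   Context: $\beta\mathbb{N}$ is the Stone-Čech compactification of the discrete space $\mathbb{N}$. A bounded sequence $\lambda=(\lambda_n)$ is identified with the diagonal operator $T_\lambda$ given by $T_\lambda e_n=\lambda_n e_n$, and $\ell^\infty$ is identified with $C(\beta\mathbb{N})$ in the usual way; thus $\delta_t$ ($t\in\beta\mathbb{N}$) is the pure state $\lambda\mapsto\lim_t\lambda_n$ of $\ell^\infty$ (limit along the ultrafilter $t$). The set $[\delta_t]$ is a convex weak-star compact subset of $B(H)^*$; ''contains a homeomorphic copy of $\beta\mathbb{N}$'' refers to the weak-star topology of $B(H)^*$ restricted to $[\delta_t]$. *)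

(* Defs.v *)
From HB Require Import structures.
From mathcomp Require Import all_boot all_order all_algebra.
From mathcomp.real_closed Require Import complex.
From mathcomp Require Import all_classical all_reals all_analysis.

Set Implicit Arguments.
Unset Strict Implicit.
Unset Printing Implicit Defensive.
Import Order.TTheory GRing.Theory Num.Theory.
Import numFieldNormedType.Exports.
Local Open Scope classical_set_scope.
Local Open Scope complex_scope.
Local Open Scope ring_scope.

Section BoundedOperators.
Context {R : realType} {V W : normedModType R[i]}.

Definition bop_pred : {pred V -> W} :=
  mem [set f : V -> W | linear f /\ continuous f].

(* Linear continuous maps; on normed modules this is the same as bounded
   ([linear_bounded_continuous]). *)
Record bop := Bop { bop_fun :> V -> W ; _ : bop_fun \in bop_pred }.

HB.instance Definition _ := [isSub for bop_fun].
HB.instance Definition _ := [Choice of bop by <:].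

Lemma bopP (f : bop) : linear f /\ continuous f.
Proof. by case: f => f /=; rewrite inE. Qed.

HB.instance Definition _ (f : bop) :=
  GRing.isLinear.Build R[i] V W *:%R f (proj1 (bopP f)).

Lemma bop_submod_closed : submod_closed bop_pred.
Proof.
split.
  rewrite inE; split.
    by move=> a x y /=; rewrite scaler0 addr0.
  by move=> x; exact: cvg_cst.
move=> a f g; rewrite !inE => -[lf cf] [lg cg]; split.
  move=> b x y /=; rewrite !fctE /= lf lg !scalerDr !scalerA (mulrC a b).
  by rewrite addrACA.
by move=> x; apply: cvgD; [apply: cvgZr; exact: cf|exact: cg].
Qed.

HB.instance Definition _ :=
  GRing.isSubmodClosed.Build R[i] (V -> W) bop_pred bop_submod_closed.
HB.instance Definition _ := [SubChoice_isSubLmodule of bop by <:].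

Definition opnorm (f : bop) : R :=
  sup [set complex.Re `|f x| | x in [set x : V | `|x| <= 1]].

Let normRe (U : normedModType R[i]) (x : U) : (complex.Re `|x|)%:C = `|x|.
Proof. exact: RRe_real (normr_real x). Qed.

Let S (f : bop) := [set complex.Re `|f x| | x in [set x : V | `|x| <= 1]].

Let has_supS f : has_sup (S f).
Proof.
split; first by exists (complex.Re `|f 0|), 0 => //=; rewrite normr0.
have /linear_bounded_continuous/bounded_funP/(_ 1)[M fM] := (bopP f).2.
by exists (complex.Re M) => _ [x /= /fM + <-]; rewrite lecE => /andP[].
Qed.

Lemma opnorm_ub (f : bop) x : `|x| <= 1 -> `|f x| <= (opnorm f)%:C.
Proof.
by move=> x1; rewrite -normRe lecR; apply: (sup_upper_bound (has_supS f)); exists x.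
Qed.

Lemma opnorm_le (f : bop) (M : R) :
  (forall x, `|x| <= 1 -> `|f x| <= M%:C) -> opnorm f <= M.
Proof.
move=> fM; apply: ge_sup; first exact: (has_supS f).1.
by move=> _ [x /= /fM + <-]; rewrite -normRe lecR.
Qed.

Let opnorm0 : opnorm 0 = 0.
Proof.
apply/eqP; rewrite eq_le; apply/andP; split.
  by apply: opnorm_le => x _; rewrite /= normr0.
by rewrite -lecR; apply: le_trans (opnorm_ub 0 (x := 0) _); rewrite normr0.
Qed.

Let opnormZ_le (a : R[i]) (f : bop) :
  ((opnorm (a *: f))%:C : R[i]) <= `|a| * (opnorm f)%:C.
Proof.
rewrite -(RRe_real (normr_real a)) -rmorphM lecR; apply: opnorm_le => x x1.
by rewrite rmorphM /= (RRe_real (normr_real a)) normrZ ler_wpM2l// opnorm_ub.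
Qed.

Let normD (f g : bop) :
  ((opnorm (f + g))%:C : R[i]) <= (opnorm f)%:C + (opnorm g)%:C.
Proof.
rewrite -rmorphD lecR; apply: opnorm_le => x x1.
by rewrite rmorphD /= (le_trans (ler_normD _ _))// lerD// opnorm_ub.
Qed.

Let normZ (a : R[i]) (f : bop) :
  ((opnorm (a *: f))%:C : R[i]) = `|a| * (opnorm f)%:C.
Proof.
have [->|a0] := eqVneq a 0; first by rewrite scale0r opnorm0 normr0 mul0r.
apply/eqP; rewrite eq_le opnormZ_le /=.
have := opnormZ_le a^-1 (a *: f); rewrite scalerA mulVf// scale1r.
by rewrite normfV ler_pdivlMl// normr_gt0.
Qed.

Let norm_eq0 (f : bop) : ((opnorm f)%:C : R[i]) = 0 -> f = 0.
Proof.
move=> f0; apply/val_inj/funext => x /=.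
have [->|x0] := eqVneq x 0; first by rewrite linear0.
have : `|f (`|x|^-1 *: x)| <= 0.
  by rewrite -f0 opnorm_ub// normrZ normfV normr_id mulVf// normr_eq0.
by rewrite normr_le0 linearZ /= scaler_eq0 invr_eq0 normr_eq0 (negPf x0) => /eqP.
Qed.

HB.instance Definition _ :=
  Lmodule_isNormed.Build R[i] bop normD normZ norm_eq0.

End BoundedOperators.
Arguments bop {R} V W.

Notation "''B' ( H )" := (bop H H) (format "''B' ( H )") : type_scope.

Section Dual.
Context {R : realType} (V : normedModType R[i]).

Definition dual := bop V R[i]^o.
HB.instance Definition _ := NormedModule.on dual.

(* The dual with the weak-star topology: that of pointwise convergence on V. *)
Definition weak_star : topologicalType :=
  initial_topology (fun phi : dual => (phi : V -> R[i]^o) : {ptws V -> R[i]^o}).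

End Dual.

Section IdentityOperator.
Context {R : realType} {H : normedModType R[i]}.

Lemma idop_subproof : idfun \in @bop_pred R H H.
Proof. by rewrite inE; split=> // x; exact: cvg_id. Qed.

Definition idop : 'B(H) := Bop idop_subproof.

End IdentityOperator.

(* The Stone-Cech compactification of the discrete space nat, as the space of
   ultrafilters with the basic open sets {t | A \in t}. *)
Record betaN := BetaN {
  ultra : set_system nat ;
  ultraP : UltraFilter ultra }.
#[global] Existing Instance ultraP.

HB.instance Definition _ := gen_eqMixin betaN.
HB.instance Definition _ := gen_choiceMixin betaN.

Section BetaNTopology.
Let b (A : set nat) := [set t : betaN | ultra t A].

Let b_cover : \bigcup_(A in setT) b A = setT.
Proof. by apply/seteqP; split=> // t _; exists setT => //; exact: filterT. Qed.

Let b_join (A B : set nat) (t : betaN) : setT A -> setT B -> b A t -> b B t ->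
  exists C, [/\ setT C, b C t & b C `<=` b A `&` b B].
Proof.
move=> _ _ tA tB; exists (A `&` B); split=> //; first exact: filterI.
by move=> u uAB; split; apply: filterS (uAB : ultra u _) => x [].
Qed.

HB.instance Definition _ := isBaseTopological.Build betaN b_cover b_join.
End BetaNTopology.

Definition contains_homeomorphic_copy (X Y : topologicalType) (A : set Y) :=
  exists (B : set Y) (f : X -> B) (g : B -> X),
    [/\ B `<=` A, cancel f g, cancel g f, continuous f & continuous g].
Arguments contains_homeomorphic_copy X {Y} A.

Definition lin_span {R : realType} {V : lmodType R[i]} {n : nat}
    (v : 'I_n -> V) : set V :=
  [set x | exists c : 'I_n -> R[i], x = \sum_(i < n) c i *: v i].

Definition in_finite_dim_subspace {R : realType} {V : lmodType R[i]}
    (A : set V) :=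
  exists (n : nat) (v : 'I_n -> V), A `<=` lin_span v.

Section DiagonalStates.
Context {R : realType} {H : normedModType R[i]} (dot : {dot H for Num.conj}).

Definition orthonormal_basis (e : nat -> H) :=
  (forall i j, dot (e i) (e j) = (i == j)%:R) /\
  closure (\bigcup_n lin_span (fun i : 'I_n => e i)) = setT.

Definition positive_op (T : 'B(H)) := forall x, 0 <= dot (T x) x.

Definition is_state (phi : dual 'B(H)) :=
  (forall T, positive_op T -> 0 <= phi T) /\ phi idop = 1.

(* T is the diagonal operator T_lambda; it is determined by lambda when e is an
   orthonormal basis. *)
Definition is_diagonal_op (e : nat -> H) (lambda : nat -> R[i]) (T : 'B(H)) :=
  forall n, T (e n) = lambda n *: e n.

Definition extends_delta (e : nat -> H) (t : betaN) (phi : dual 'B(H)) :=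
  forall (lambda : nat -> R[i]^o) (T : 'B(H)), bounded_fun lambda ->
    is_diagonal_op e lambda T -> lambda n @[n --> ultra t] --> phi T.

Definition delta_states (e : nat -> H) (t : betaN) : set (dual 'B(H)) :=
  [set phi | is_state phi /\ extends_delta e t phi].

End DiagonalStates.

(* Main.v *)
(* Write s_phi(a) = phi(a^* a)^(1/2). The states extending delta_t are those with
   s_phi(a) = 0 for every a = T_lambda - lim_t lambda; let F be the set of them.
   The alternative is decided by whether, for every sequence of contractions k_n
   with products c_0 = 1, c_(n+1) = k_n c_n, the decrease
   s_phi(c_n)^2 - s_phi(c_(n+1))^2 is small for some n, uniformly over phi in F.

   If not, there are psi_n in F and positive b_n = c_n^* c_n - c_(n+1)^* c_(n+1)
   with sums at most 1 and psi_n(b_n) >= eps. Put T_M for the strong sum of the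
   b_n, n in M. A disjointification argument in the style of Rosenthal's lemma
   yields an injective sequence m with psi_(m k)(T_(M \ {m k})) < eps / 2 for
   M = range m, so that s |-> lim_s psi_(m k) embeds betaN into F, the operators
   T_(m A) separating A \in s from A \notin s.

   If so, pure states in F cannot be mutually almost orthogonal infinitely often:
   excising the pure states one after the other would produce contractions
   k_n = 1 - g_n violating the uniform decrease. Two pure states that are not
   almost orthogonal are equivalent, psi = phi(v^* . v), and for fixed phi the
   same bound applied to the vector states phi(u^* . u) in F makes these span a
   finite-dimensional space. By Krein-Milman F lies in the span of its pure
   states. *)

From HB Require Import structures.
Require Import Defs.
From mathcomp Require Import all_boot all_order all_algebra.
From mathcomp.real_closed Require Import complex.
From mathcomp Require Import all_classical all_reals all_analysis.
From mathcomp Require Import lra ring.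
Import Order.TTheory GRing.Theory Num.Theory.
Import numFieldNormedType.Exports.
Local Open Scope classical_set_scope.
Local Open Scope complex_scope.
Local Open Scope ring_scope.

Set Implicit Arguments.
Unset Strict Implicit.
Unset Printing Implicit Defensive.

(** * Hilbert space preliminaries *)

(** The support projection of a pure state need not lie in ['B(H)], so the argument is approximate
    throughout: an excising operator [g], a high power of a positive contraction, replaces that
    projection relative to a finite list of operators. The main obstacle in the uniform case is that
    almost orthogonality of phi and psi gives an operator depending on psi, whereas the products c_n
    must stay near 1 on infinitely many later states at once. The uniform decrease is therefore
    spent twice: first to find one operator separating phi from all states of F almost orthogonal to
    it, then to exclude an infinite sequence. About F only its defining equations s_phi(a) = 0
    matter. They survive weak-star limits and domination by states of F, so F is a closed face whose
    extreme points are pure on all of B(H). For vector functionals phi(u^* . u) they are linear in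
    u, which permits a Gram-Schmidt argument. The diagonal algebra only serves to bring [delta_t]
    into this form. *)

Section RealPart.
Context {R : realType}.
Implicit Types z w : R[i].

Lemma ReD z w : complex.Re (z + w) = complex.Re z + complex.Re w.
Proof. by case: z w => [a b] [c d]. Qed.

Lemma ReN z : complex.Re (- z) = - complex.Re z.
Proof. by case: z. Qed.

Lemma ReB z w : complex.Re (z - w) = complex.Re z - complex.Re w.
Proof. by rewrite ReD ReN. Qed.

Lemma ReZ (r : R) z : complex.Re (r%:C * z) = r * complex.Re z.
Proof. by case: z => a b /=; rewrite mul0r subr0. Qed.

Lemma Re_conj z : complex.Re z^* = complex.Re z.
Proof. by case: z. Qed.

Lemma Re_iM z : complex.Re ('i * z) = - complex.Im z.
Proof. by case: z => a b /=; rewrite mul0r mul1r sub0r. Qed.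

Lemma Im_iM z : complex.Im ('i * z) = complex.Re z.
Proof. by case: z => a b /=; rewrite mul0r mul1r add0r. Qed.

Lemma Re_sum I (s : seq I) (P : pred I) (F : I -> R[i]) :
  complex.Re (\sum_(i <- s | P i) F i) = \sum_(i <- s | P i) complex.Re (F i).
Proof. exact: (big_morph _ ReD erefl). Qed.

Lemma ge0_ReE z : 0 <= z -> z = (complex.Re z)%:C.
Proof. by move=> z0; rewrite RRe_real// ger0_real. Qed.

Lemma ge0_Re z : 0 <= z -> 0 <= complex.Re z.
Proof. by rewrite lecE => /andP[]. Qed.

Lemma normC_sum z : `|z| <= (`|complex.Re z| + `|complex.Im z|)%:C.
Proof.
rewrite [X in `|X|]complexE; apply: le_trans (ler_normD _ _) _.
rewrite normrM rmorphD /= lerD//; first by rewrite normc_def /= expr0n addr0 sqrtr_sqr.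
by rewrite !normc_def /= !expr0n /= add0r addr0 expr1n sqrtr1 sqrtr_sqr mul1r.
Qed.

Lemma abs_Re_le z : `|complex.Re z| <= complex.Re `|z|.
Proof.
rewrite normc_def /=.
by rewrite -sqrtr_sqr ler_wsqrtr// lerDl sqr_ge0.
Qed.

Lemma abs_Im_le z : `|complex.Im z| <= complex.Re `|z|.
Proof.
rewrite normc_def /=.
by rewrite -sqrtr_sqr ler_wsqrtr// lerDr sqr_ge0.
Qed.

End RealPart.

Section SemiInner.
Context {R : realType} {V : lmodType R[i]} (q : V -> V -> R).
Hypothesis qD : forall x y z, q (x + y) z = q x z + q y z.
Hypothesis qZ : forall (r : R) x y, q (r%:C *: x) y = r * q x y.
Hypothesis qC : forall x y, q x y = q y x.
Hypothesis q0 : forall x, 0 <= q x x.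

Let qDr x y z : q x (y + z) = q x y + q x z.
Proof. by rewrite qC qD (qC y) (qC z). Qed.

Let qZr (r : R) x y : q x (r%:C *: y) = r * q x y.
Proof. by rewrite qC qZ qC. Qed.

Lemma semi_inner_CS x y : (q x y) ^+ 2 <= q x x * q y y.
Proof.
have aux u v : 0 <= q u u * (q u u * q v v - q u v ^+ 2).
  have := q0 ((q u u)%:C *: v + (- q u v)%:C *: u).
  rewrite qD !qDr !qZ !qZr (qC v u); set a := q u u; set b := q u v; set c := q v v.
  by move=> h; rewrite (le_trans h)// le_eqVlt; apply/orP; left; apply/eqP; ring.
have [a0|a0] := eqVneq (q x x) 0; last first.
  have := aux x y; rewrite pmulr_rge0 ?subr_ge0//.
  by rewrite lt_neqAle eq_sym a0 q0.
have [c0|c0] := eqVneq (q y y) 0; last first.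
  have := aux y x; rewrite pmulr_rge0 ?subr_ge0; first by rewrite (qC y x) mulrC.
  by rewrite lt_neqAle eq_sym c0 q0.
have h1 := q0 (x + (1 : R)%:C *: y); have h2 := q0 (x + (-1 : R)%:C *: y).
move: h1 h2; rewrite !qD !qDr !qZ !qZr (qC y x) a0 c0; set b := q x y => h1 h2.
suff -> : b = 0 by rewrite expr0n mul0r.
by lra.
Qed.

Lemma semi_inner_le x y : q x y <= Num.sqrt (q x x) * Num.sqrt (q y y).
Proof.
rewrite -sqrtrM// (le_trans (ler_norm _))// -sqrtr_sqr ler_wsqrtr//.
exact: semi_inner_CS.
Qed.

Lemma semi_norm_triangle x y :
  Num.sqrt (q (x + y) (x + y)) <= Num.sqrt (q x x) + Num.sqrt (q y y).
Proof.
rewrite -(@ler_pXn2r _ 2)// ?nnegrE ?addr_ge0 ?sqrtr_ge0//.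
rewrite sqrrD !sqr_sqrtr// qD !qDr (qC y x).
have := semi_inner_le x y; move: (Num.sqrt _ * _) => s; lra.
Qed.

End SemiInner.

Section Hilbert.
Context {R : realType} {H : completeNormedModType R[i]}.
Variable dot : {dot H for Num.conj}.
Hypothesis normE : forall x : H, `|x| ^+ 2 = dot x x.

Definition hnorm (x : H) : R := complex.Re `|x|.
Definition rdot (x y : H) : R := complex.Re (dot x y).

Lemma hnormE x : (hnorm x)%:C = `|x|.
Proof. by rewrite /hnorm -ge0_ReE. Qed.

Lemma hnorm_ge0 x : 0 <= hnorm x.
Proof. exact: ge0_Re. Qed.

Lemma hnormD x y : hnorm (x + y) <= hnorm x + hnorm y.
Proof. by rewrite -lecR rmorphD /= !hnormE ler_normD. Qed.

Lemma hnormN x : hnorm (- x) = hnorm x.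
Proof. by rewrite /hnorm normrN. Qed.

Lemma hnormZ a x : hnorm (a *: x) = complex.Re `|a| * hnorm x.
Proof.
by apply: complexI; rewrite rmorphM /= !hnormE normrZ.
Qed.

Lemma hnorm_eq0 x : hnorm x = 0 -> x = 0.
Proof. by move=> h; apply/eqP; rewrite -normr_eq0 -hnormE h. Qed.

Lemma hnorm0 : hnorm 0 = 0.
Proof. by rewrite /hnorm normr0. Qed.

Lemma dotDl x y z : dot (x + y) z = dot x z + dot y z.
Proof. by rewrite linearDl. Qed.
Lemma dotDr x y z : dot x (y + z) = dot x y + dot x z.
Proof. by rewrite linearDr. Qed.
Lemma dotZl a x y : dot (a *: x) y = a * dot x y.
Proof. by rewrite linearZl_LR. Qed.
Lemma dotZr a x y : dot x (a *: y) = a^* * dot x y.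
Proof. by rewrite linearZr_LR. Qed.
Lemma dotC x y : dot x y = (dot y x)^*.
Proof. by rewrite (hermC dot) expr0 mul1r. Qed.
Lemma dotNl x y : dot (- x) y = - dot x y.
Proof. by rewrite linearNl. Qed.
Lemma dotNr x y : dot x (- y) = - dot x y.
Proof. by rewrite linearNr. Qed.
Lemma dotBl x y z : dot (x - y) z = dot x z - dot y z.
Proof. by rewrite dotDl dotNl. Qed.
Lemma dotBr x y z : dot x (y - z) = dot x y - dot x z.
Proof. by rewrite dotDr dotNr. Qed.
Lemma dot0l x : dot 0 x = 0.
Proof. by rewrite linear0l. Qed.

Lemma dot0r x : dot x 0 = 0.
Proof. by rewrite linear0r. Qed.

Lemma dotxx x : dot x x = (hnorm x ^+ 2)%:C.
Proof. by rewrite -normE -hnormE rmorphXn. Qed.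

Lemma rdotxx x : rdot x x = hnorm x ^+ 2.
Proof. by rewrite /rdot dotxx. Qed.

Lemma rdotDl x y z : rdot (x + y) z = rdot x z + rdot y z.
Proof. by rewrite /rdot dotDl ReD. Qed.
Lemma rdotC x y : rdot x y = rdot y x.
Proof. by rewrite /rdot dotC Re_conj. Qed.
Lemma rdotDr x y z : rdot x (y + z) = rdot x y + rdot x z.
Proof. by rewrite rdotC rdotDl !(rdotC x). Qed.
Lemma rdotZl (r : R) x y : rdot (r%:C *: x) y = r * rdot x y.
Proof. by rewrite /rdot dotZl ReZ. Qed.
Lemma rdotZr (r : R) x y : rdot x (r%:C *: y) = r * rdot x y.
Proof. by rewrite rdotC rdotZl rdotC. Qed.
Lemma rdotNl x y : rdot (- x) y = - rdot x y.
Proof. by rewrite /rdot dotNl ReN. Qed.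
Lemma rdotNr x y : rdot x (- y) = - rdot x y.
Proof. by rewrite rdotC rdotNl rdotC. Qed.
Lemma rdotBl x y z : rdot (x - y) z = rdot x z - rdot y z.
Proof. by rewrite rdotDl rdotNl. Qed.
Lemma rdotBr x y z : rdot x (y - z) = rdot x y - rdot x z.
Proof. by rewrite rdotDr rdotNr. Qed.

Lemma dot_eq_rdot x y x' y' : rdot x y = rdot x' y' ->
  rdot ('i *: x) y = rdot ('i *: x') y' -> dot x y = dot x' y'.
Proof.
rewrite /rdot !dotZl !Re_iM => h /oppr_inj; move: h.
by case: (dot x y) (dot x' y') => a b [c d] /= -> ->.
Qed.

Lemma rdot_le x y : rdot x y <= hnorm x * hnorm y.
Proof.
have h u : Num.sqrt (rdot u u) = hnorm u.
  by rewrite rdotxx sqrtr_sqr ger0_norm// hnorm_ge0.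
rewrite -!h; apply: (semi_inner_le rdotDl rdotZl rdotC) => z.
by rewrite rdotxx sqr_ge0.
Qed.

Lemma hnormB_sqr x y :
  hnorm (x - y) ^+ 2 = hnorm x ^+ 2 + hnorm y ^+ 2 - 2 * rdot x y.
Proof.
by rewrite -!rdotxx rdotBl !rdotBr (rdotC y x); lra.
Qed.

Lemma cvg_hnormP (u : nat -> H) (l : H) : (u @ \oo --> l) <->
  (forall eps, 0 < eps -> exists N, forall n, (N <= n)%N -> hnorm (u n - l) < eps).
Proof.
split.
  move=> ul eps e0; have e0C : (0 : R[i]) < eps%:C by rewrite ltcR.
  move/cvgrPdist_lt : ul => /(_ _ e0C)[N _ hN]; exists N => n /hN.
  by rewrite -hnormE ltcR -hnormN opprB.
move=> h; apply/cvgrPdist_lt => e e0.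
have eR : e = (complex.Re e)%:C by apply: ge0_ReE; exact: ltW.
have e0R : 0 < complex.Re e by rewrite -ltcR -eR.
have [N hN] := h _ e0R; exists N => // n /= /hN.
by rewrite eR -hnormE ltcR -hnormN opprB.
Qed.

Lemma hnorm_cauchy (u : nat -> H) :
  (forall eps, 0 < eps -> exists N, forall m n, (N <= m)%N -> (m <= n)%N ->
     hnorm (u n - u m) < eps) ->
  exists l : H, u @ \oo --> l.
Proof.
move=> h; have cu : cvgn u.
  apply: cauchy_cvg; apply/cauchyP => e e0; rewrite /cauchy_ex.
  have eR : e = (complex.Re e)%:C by apply: ge0_ReE; exact: ltW.
  have e0R : 0 < complex.Re e by rewrite -ltcR -eR.
  have [N hN] := h _ e0R.
  exists (u N); exists N => // n /= /(hN _ _ (leqnn N)).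
  by rewrite -ball_normE /= eR -hnormN opprB -hnormE ltcR.
by exists (lim (u @ \oo)).
Qed.

(** The sequence [r] is nondecreasing and bounded, hence Cauchy, and it controls [u]. It is applied
    to partial Fourier sums and to increasing sequences of positive operators. *)
Lemma cvg_of_increments (u : nat -> H) (r : nat -> R) (M : R) :
  (forall n, r n <= M) ->
  (forall m n, (m <= n)%N -> hnorm (u n - u m) ^+ 2 <= r n - r m) ->
  exists l : H, u @ \oo --> l.
Proof.
move=> rM hr; apply: hnorm_cauchy => eps e0.
have rinc m n : (m <= n)%N -> r m <= r n.
  by move=> /hr h; rewrite -subr_ge0 (le_trans _ h)// sqr_ge0.
have hs : has_sup (range r).
  by split; [exists (r 0%N), 0%N|exists M => _ [n _ <-]].
have e2 : 0 < eps ^+ 2 by rewrite exprn_gt0.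
have [_ [N _ <-] hN] := sup_adherent e2 hs.
exists N => m n Nm mn.
rewrite -(@ltr_pXn2r _ 2)// ?nnegrE ?hnorm_ge0 ?ltW//.
apply: le_lt_trans (hr _ _ mn) _.
have : r n <= sup (range r) by apply: sup_upper_bound => //; exists n.
have := rinc _ _ Nm; lra.
Qed.

Lemma hnorm_lim_le (u : nat -> H) l (M : R) : u @ \oo --> l ->
  (exists N, forall n, (N <= n)%N -> hnorm (u n) <= M) -> hnorm l <= M.
Proof.
move=> /cvg_hnormP ul [N hN]; apply/ler_addgt0Pr => e e0.
have [K hK] := ul _ e0.
have {hK} := hK _ (leq_maxl K N); have {hN} := hN _ (leq_maxr K N).
move: (u _) => v h1 h2.
have -> : l = v + - (v - l) by rewrite opprB addrC subrK.
by apply: le_trans (hnormD _ _) _; rewrite hnormN; lra.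
Qed.

End Hilbert.

(** * The algebra of bounded operators *)

Section OperatorRing.
Context {R : realType} {H : normedModType R[i]}.
Implicit Types S T U : 'B(H).

Lemma bop_comp_subproof S T : (S \o T) \in @bop_pred R H H.
Proof.
rewrite inE; split; first by move=> a x y; rewrite /= !linearP.
move=> x; apply: continuous_comp; [exact: (bopP T).2|exact: (bopP S).2].
Qed.

Definition bop_comp S T : 'B(H) := Bop (bop_comp_subproof S T).

Lemma bop_ext S T : (forall x, S x = T x) -> S = T.
Proof. by move=> h; apply/val_inj/funext. Qed.

Let compA : associative bop_comp.
Proof. by move=> S T U; apply: bop_ext. Qed.
Let comp1b : left_id idop bop_comp.
Proof. by move=> S; apply: bop_ext. Qed.
Let compb1 : right_id idop bop_comp.
Proof. by move=> S; apply: bop_ext. Qed.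
Let compDl : left_distributive bop_comp +%R.
Proof. by move=> S T U; apply: bop_ext. Qed.
Let compDr : right_distributive bop_comp +%R.
Proof. by move=> S T U; apply: bop_ext => x /=; rewrite !fctE /= linearD. Qed.

HB.instance Definition _ := GRing.Zmodule_isPzRing.Build (bop H H)
  compA comp1b compb1 compDl compDr.

Lemma bop_mulE S T x : (S * T) x = S (T x). Proof. by []. Qed.
Lemma bop_addE S T x : (S + T) x = S x + T x. Proof. by []. Qed.
Lemma bop_oppE T x : (- T) x = - T x. Proof. by []. Qed.
Lemma bop_subE S T x : (S - T) x = S x - T x. Proof. by []. Qed.
Lemma bop_scaleE a T x : (a *: T) x = a *: T x. Proof. by []. Qed.
Lemma bop_oneE x : (1 : 'B(H)) x = x. Proof. by []. Qed.
Lemma bop_zeroE x : (0 : 'B(H)) x = 0. Proof. by []. Qed.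
Lemma bopD T x y : T (x + y) = T x + T y. Proof. exact: linearD. Qed.
Lemma bopB T x y : T (x - y) = T x - T y. Proof. exact: linearB. Qed.
Lemma bopZ T a x : T (a *: x) = a *: T x. Proof. exact: linearZ. Qed.
Lemma bop_scaleAl a S T : a *: (S * T) = (a *: S) * T.
Proof. by apply: bop_ext. Qed.
Lemma bop_scaleAr a S T : a *: (S * T) = S * (a *: T).
Proof. by apply: bop_ext => x; rewrite bop_scaleE !bop_mulE bop_scaleE linearZ. Qed.

End OperatorRing.

Lemma bop_of_bounded {R : realType} {V W : normedModType R[i]} (f : V -> W) (M : R) :
  linear f -> 0 <= M -> (forall x, `|f x| <= M%:C * `|x|) ->
  exists T : bop V W, T =1 f.
Proof.
move=> lf M0 fM.
pose lin := GRing.isLinear.Build R[i] V W *:%R f lf.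
pose F : {linear V -> W} := HB.pack f lin.
have fP : f \in @bop_pred R V W.
  rewrite inE; split=> //; apply: (@bounded_linear_continuous _ _ _ F).
  apply: (proj1 (bounded_funP F)) => r; exists (M%:C * r) => x xr.
  by apply: le_trans (fM x) _; rewrite ler_wpM2l ?ler0c.
by exists (Bop fP).
Qed.

Section OperatorNorm.
Context {R : realType} {H : completeNormedModType R[i]}.
Implicit Types S T U : 'B(H).

Lemma opnorm_ge0 T : 0 <= opnorm T.
Proof. by rewrite -ler0c; have := normr_ge0 (T : 'B(H)). Qed.

Lemma opnormD S T : opnorm (S + T) <= opnorm S + opnorm T.
Proof. by rewrite -lecR rmorphD; exact: (ler_normD S T). Qed.

Lemma opnormN T : opnorm (- T) = opnorm T.
Proof. by apply: complexI; exact: (normrN T). Qed.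

Lemma opnormZ a T : opnorm (a *: T) = complex.Re `|a| * opnorm T.
Proof.
by apply: complexI; rewrite rmorphM; exact: (normrZ a T).
Qed.

Lemma opnorm0 : opnorm (0 : 'B(H)) = 0.
Proof. by apply: complexI; exact: (normr0 'B(H)). Qed.

Lemma opnorm_bound T x : hnorm (T x) <= opnorm T * hnorm x.
Proof.
have [->|x0] := eqVneq x 0; first by rewrite linear0 hnorm0 mulr0.
have h0 : 0 < hnorm x.
  by rewrite lt_neqAle hnorm_ge0 andbT eq_sym; apply: contra_neq x0; exact: hnorm_eq0.
have hx : `| ((hnorm x)^-1)%:C *: x| <= 1.
  rewrite normrZ -hnormE ger0_norm ?ler0c ?invr_ge0 ?hnorm_ge0//.
  by rewrite -rmorphM mulVf// gt_eqF.
have := opnorm_ub T hx; rewrite linearZ -hnormE lecR hnormZ.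
rewrite ger0_norm ?ler0c ?invr_ge0 ?hnorm_ge0// ler_pdivrMl//.
by rewrite mulrC.
Qed.

Lemma opnorm_le_of T (M : R) : 0 <= M -> (forall x, hnorm (T x) <= M * hnorm x) ->
  opnorm T <= M.
Proof.
move=> M0 h; apply: opnorm_le => x x1; rewrite -hnormE lecR.
apply: le_trans (h x) _; rewrite ler_piMr//.
by rewrite -lecR hnormE.
Qed.

Lemma opnormM S T : opnorm (S * T) <= opnorm S * opnorm T.
Proof.
apply: opnorm_le_of => [|x]; first by rewrite mulr_ge0// opnorm_ge0.
rewrite bop_mulE -mulrA; apply: le_trans (opnorm_bound _ _) _.
by rewrite ler_wpM2l// ?opnorm_ge0// opnorm_bound.
Qed.

Lemma opnorm1_le : opnorm (1 : 'B(H)) <= 1.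
Proof. by apply: opnorm_le_of => // x; rewrite mul1r. Qed.

Lemma bop_strong_lim (S : nat -> 'B(H)) (M : R) :
  (forall n, opnorm (S n) <= M) -> (forall x, exists l : H, S n x @[n --> \oo] --> l) ->
  exists T : 'B(H), forall x, S n x @[n --> \oo] --> T x.
Proof.
move=> SM hl; have [f hf] := choice hl.
have lf : linear f.
  move=> a x y.
  have fl : S n (a *: x + y) @[n --> \oo] --> a *: f x + f y.
    have -> : (fun n => S n (a *: x + y)) = (fun n => a *: S n x + S n y).
      by apply/funext => n; rewrite linearP.
    exact: (cvgD (cvgZl_tmp (hf x)) (hf y)).
  exact: cvg_unique (hf _) fl.
have M0 : 0 <= M by apply: le_trans (SM 0%N); exact: opnorm_ge0.
have fM x : hnorm (f x) <= M * hnorm x.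
  apply: (hnorm_lim_le (hf x)); exists 0%N => n _.
  by apply: le_trans (opnorm_bound _ _) _; rewrite ler_wpM2r ?hnorm_ge0.
have [T Tf] : exists T : 'B(H), T =1 f.
  by apply: (bop_of_bounded lf M0) => x; rewrite -!hnormE -rmorphM lecR.
by exists T => x; rewrite Tf.
Qed.

Lemma bop_norm_complete (S : nat -> 'B(H)) (M : R) : 0 <= M ->
  (forall n, opnorm (S n.+1 - S n) <= M / 2 ^+ n) ->
  exists T : 'B(H), forall n, opnorm (T - S n) <= 2 * M / 2 ^+ n.
Proof.
move=> M0 hS.
(* Keeping the subtracted term [2 * M / 2 ^+ n] lets the induction close; [tail'] then drops it. *)
have tail m n : (m <= n)%N -> opnorm (S n - S m) <= 2 * M / 2 ^+ m - 2 * M / 2 ^+ n.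
  move=> /subnK <-; elim: (n - m)%N => [|k IH]; first by rewrite add0n !subrr opnorm0.
  rewrite addSn; have -> : S (k + m).+1 - S m = (S (k + m).+1 - S (k + m)%N) + (S (k + m)%N - S m).
    by rewrite addrA subrK.
  apply: le_trans (opnormD _ _) _; have := hS (k + m)%N; move: IH.
  rewrite exprS invfM; move: (opnorm _) (opnorm _) (_ ^-1) (_ ^-1) => a b c d; lra.
have tail' m n : (m <= n)%N -> opnorm (S n - S m) <= 2 * M / 2 ^+ m.
  move=> /tail; have : 0 <= 2 * M / 2 ^+ n by rewrite !mulr_ge0// invr_ge0 exprn_ge0.
  lra.
have [T hT] : exists T : 'B(H), forall x, S n x @[n --> \oo] --> T x.
  apply: (@bop_strong_lim _ (opnorm (S 0%N) + 2 * M)) => [n|x].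
    rewrite -[S n](subrK (S 0%N)) (le_trans (opnormD _ _))// addrC lerD2l.
    by have := tail' _ _ (leq0n n); rewrite expr0 divr1.
  apply: hnorm_cauchy => eps e0.
  pose K := 2 * M * hnorm x.
  have K0 : 0 <= K by rewrite !mulr_ge0// hnorm_ge0.
  have [N hN] : exists N, K / eps < 2 ^+ N.
    exists (Num.truncn (K / eps)).+1.
    apply: lt_le_trans (truncnS_gt _) _.
    by rewrite -natrX ler_nat ltnW// ltn_expl.
  exists N => m n Nm mn; rewrite -bop_subE.
  apply: le_lt_trans (opnorm_bound _ _) _.
  apply: le_lt_trans (_ : 2 * M / 2 ^+ m * hnorm x < _).
    by rewrite ler_wpM2r ?hnorm_ge0// tail'.
  rewrite mulrAC -/K ltr_pdivrMr ?exprn_gt0// mulrC -ltr_pdivrMr//.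
  by apply: lt_le_trans hN _; rewrite ler_eXn2l// ltr1n.
exists T => m; apply: opnorm_le_of => [|x].
  by rewrite !mulr_ge0// invr_ge0 exprn_ge0.
have hl : S n x - S m x @[n --> \oo] --> T x - S m x.
  exact: (cvgB (hT x) (cvg_cst _)).
apply: (hnorm_lim_le hl); exists m => n mn; rewrite -bop_subE.
by apply: le_trans (opnorm_bound _ _) _; rewrite ler_wpM2r ?hnorm_ge0// tail'.
Qed.

End OperatorNorm.

(** * Adjoints, built from the orthonormal basis *)

Section Adjoint.
Context {R : realType} {H : completeNormedModType R[i]}.
Variable dot : {dot H for Num.conj}.
Hypothesis normE : forall x : H, `|x| ^+ 2 = dot x x.
Variable e : nat -> H.
Hypothesis he : orthonormal_basis dot e.
Implicit Types S T U : 'B(H).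

Local Notation rd := (rdot dot).

Lemma dot_sumr I (s : seq I) (P : pred I) (F : I -> H) x :
  dot x (\sum_(i <- s | P i) F i) = \sum_(i <- s | P i) dot x (F i).
Proof. by rewrite linear_sumr. Qed.

Lemma dot_suml I (s : seq I) (P : pred I) (F : I -> H) x :
  dot (\sum_(i <- s | P i) F i) x = \sum_(i <- s | P i) dot (F i) x.
Proof. exact: (big_morph (dot^~ x) (fun y z => dotDl dot y z x) (dot0l dot x)). Qed.

(** Additivity gives [f = 0] on finite combinations of the basis, and the bound carries this to the
    closure. A one-sided bound is enough because it is applied to [x] and to [- x]. *)
Lemma dense_eq0 (f : H -> R) (K : R) : 0 <= K ->
  (forall x y, f (x + y) = f x + f y) -> (forall x, f x <= K * hnorm x) ->
  (forall a n, f (a *: e n) = 0) -> forall x, f x = 0.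
Proof.
move=> K0 fD fK fe.
have f0 : f 0 = 0 by have := fD 0 0; rewrite addr0; lra.
have fN x : f (- x) = - f x by have := fD x (- x); rewrite subrr f0; lra.
have le0 x : f x <= 0.
  apply/ler_addgt0Pr => eps e0; rewrite add0r.
  have d0 : 0 < eps / (K + 1) by rewrite divr_gt0// ltr_wpDl.
  have : closure (\bigcup_n lin_span (fun i : 'I_n => e i)) x by rewrite he.2.
  have nb : nbhs x (ball x (eps / (K + 1))%:C).
    by apply: nbhsx_ballx; rewrite ltcR.
  move=> /(_ _ nb)[y [[n _ [c ->]]]].
  rewrite -ball_normE /= -hnormE ltcR => hy.
  have fy : f (\sum_(i < n) c i *: e i) = 0.
    by rewrite (big_morph f fD f0) big1.
  rewrite -[x](subrK (\sum_(i < n) c i *: e i)) fD fy addr0.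
  apply: le_trans (fK _) _.
  apply: le_trans (_ : K * (eps / (K + 1)) <= _); first by rewrite ler_wpM2l// ltW.
  by rewrite mulrCA -ler_pdivlMl// mulVf ?gt_eqF// ler_pdivrMr ?ltr_wpDl// mul1r lerDl.
move=> x; apply/eqP; rewrite eq_le le0 -oppr_le0 -fN; exact: le0.
Qed.

(** The vector is the Fourier series with coefficients [dot y (T (e n))]. Its partial sums satisfy
    [|z N|^2 = Re <y, T (z N)>], so their norms are at most [opnorm T * hnorm y], and Pythagoras
    makes them Cauchy. *)
Lemma adjoint_exists T y : exists z, forall x, dot (T x) y = dot x z.
Proof.
pose c n := dot y (T (e n)).
pose z N := \sum_(n < N) c n *: e n.
have ze N m : dot (e m) (z N) = if (m < N)%N then (c m)^* else 0.
  rewrite /z dot_sumr (eq_bigr (fun i : 'I_N => (c i)^* * (m == i)%:R)); last first.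
    by move=> i _; rewrite dotZr he.1.
  case: ifPn => mN; last first.
    rewrite big1// => i _; case: eqP => [mi|_]; last by rewrite mulr0.
    by move: mN; rewrite mi ltn_ord.
  rewrite (bigD1 (Ordinal mN))//= eqxx mulr1 big1 ?addr0// => i im.
  case: eqP => [mi|_]; last by rewrite mulr0.
  by case/eqP: im; apply: val_inj.
have zz N : hnorm (z N) ^+ 2 = \sum_(n < N) complex.Re (`|c n| ^+ 2).
  rewrite -(rdotxx normE) /rdot /z dot_sumr Re_sum; apply: eq_bigr => i _.
  by rewrite dotZr dotC ze ltn_ord conjCK normCK mulrC.
have zT N : hnorm (z N) ^+ 2 = rd y (T (z N)).
  rewrite zz /z linear_sum /rdot dot_sumr Re_sum; apply: eq_bigr => i _.
  by rewrite linearZ dotZr normCK mulrC.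
have zM N : hnorm (z N) <= opnorm T * hnorm y.
  have [->|/eqP z0] := eqVneq (hnorm (z N)) 0.
    by rewrite mulr_ge0 ?opnorm_ge0 ?hnorm_ge0.
  have zp : 0 < hnorm (z N) by rewrite lt_neqAle hnorm_ge0 eq_sym andbT; apply/eqP.
  rewrite -(ler_pM2r zp) -expr2 zT; apply: le_trans (rdot_le normE _ _) _.
  rewrite [leRHS]mulrAC mulrC ler_wpM2r ?hnorm_ge0//; exact: opnorm_bound.
have zB m n : (m <= n)%N -> hnorm (z n - z m) ^+ 2 = hnorm (z n) ^+ 2 - hnorm (z m) ^+ 2.
  move=> mn; rewrite (hnormB_sqr normE).
  suff -> : rd (z n) (z m) = hnorm (z m) ^+ 2 by lra.
  rewrite rdotC /rdot {1}/z dot_suml Re_sum zz; apply: eq_bigr => i _.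
  by rewrite dotZl ze (leq_trans (ltn_ord i) mn) normCK.
have [l hl] : exists l : H, z @ \oo --> l.
  apply: (@cvg_of_increments _ _ z (fun n => hnorm (z n) ^+ 2) ((opnorm T * hnorm y) ^+ 2)).
    by move=> n; rewrite lerXn2r ?nnegrE ?hnorm_ge0 ?mulr_ge0 ?opnorm_ge0 ?hnorm_ge0.
  by move=> m n /zB ->.
exists l.
have le_ m : dot (e m) l = (c m)^*.
  (* The errors [hnorm (l - z n)] tend to 0, so [Re (a * w) <= 0] for every [a]; the choice of the
     conjugate of [w] for [a] gives [|w|^2 <= 0]. *)
  have small (w : R[i]) : (forall n, (m < n)%N -> forall a : R[i],
      complex.Re (a * w) <= complex.Re `|a| * hnorm (l - z n)) -> w = 0.
    move=> h; have h0 a : complex.Re (a * w) <= 0.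
      apply/ler_addgt0Pr => eps e0; rewrite add0r.
      have [N hN] := (cvg_hnormP _ _).1 hl (eps / (complex.Re `|a| + 1))
        (divr_gt0 e0 (ltr_wpDl (ge0_Re (normr_ge0 a)) ltr01)).
      have {hN} := hN _ (leq_maxl N m.+1); have := h _ (leq_maxr N m.+1) a.
      rewrite -hnormN opprB; set d := hnorm _ => h1 h2; apply: le_trans h1 _.
      have a0 : 0 <= complex.Re `|a| := ge0_Re (normr_ge0 a).
      apply: le_trans (_ : complex.Re `|a| * (eps / (complex.Re `|a| + 1)) <= _).
        by rewrite ler_wpM2l// ltW.
      rewrite mulrCA -ler_pdivlMl// mulVf ?gt_eqF// ler_pdivrMr ?ltr_wpDl//.
      by rewrite mul1r lerDl.
    have := h0 w^*; rewrite mulrC -normCK; case: w {h h0} => a b.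
    rewrite -add_Re2_Im2 /= => ab.
    have a0 : a ^+ 2 = 0 by have := sqr_ge0 a; have := sqr_ge0 b; lra.
    have b0 : b ^+ 2 = 0 by have := sqr_ge0 a; have := sqr_ge0 b; lra.
    by move/eqP: a0; move/eqP: b0; rewrite !sqrf_eq0 => /eqP -> /eqP ->.
  apply/eqP; rewrite -subr_eq0; apply/eqP; apply: small => n mn a.
  have -> : (c m)^* = dot (e m) (z n) by rewrite ze mn.
  rewrite -dotBr -dotZl; apply: le_trans (rdot_le normE _ _) _.
  rewrite hnormZ; suff -> : hnorm (e m) = 1 by rewrite mulr1.
  apply/eqP; rewrite -(@eqrXn2 _ 2)// ?hnorm_ge0// expr1n -(rdotxx normE).
  by rewrite /rdot he.1 eqxx.
suff H0 x : rd (T x) y - rd x l = 0.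
  move=> x; apply: dot_eq_rdot; apply/eqP; rewrite -subr_eq0; apply/eqP; first exact: H0.
  by rewrite -linearZ H0.
move: x; apply: (@dense_eq0 _ (opnorm T * hnorm y + hnorm l)).
- by rewrite addr_ge0 ?mulr_ge0 ?opnorm_ge0 ?hnorm_ge0.
- by move=> x x'; rewrite linearD !rdotDl; lra.
- move=> x; rewrite mulrDl lerD//.
    apply: le_trans (rdot_le normE _ _) _.
    by rewrite mulrAC ler_wpM2r ?hnorm_ge0// opnorm_bound.
  rewrite -rdotNl; apply: le_trans (rdot_le normE _ _) _.
  by rewrite hnormN mulrC.
- move=> a n; rewrite linearZ /rdot !dotZl le_ /c -dotC subrr//.
Qed.

End Adjoint.

(** * Positive operators and norm estimates for them *)

Section Positivity.
Context {R : realType} {H : completeNormedModType R[i]}.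
Variable dot : {dot H for Num.conj}.
Hypothesis normE : forall x : H, `|x| ^+ 2 = dot x x.
Variable e : nat -> H.
Hypothesis he : orthonormal_basis dot e.
Implicit Types S T U a b : 'B(H).

Local Notation rd := (rdot dot).
Local Notation pos := (positive_op dot).

(** The choice by [xget] makes [adj] total without an existence proof; [adjE] shows that, given an
    orthonormal basis, the default 0 is never a mere placeholder. *)
Definition adj T : 'B(H) :=
  xget 0 [set S : 'B(H) | forall x y, dot (T x) y = dot x (S y)].

Lemma dot_injr y z : (forall x, dot x y = dot x z) -> y = z.
Proof.
move=> h; apply/eqP; rewrite -subr_eq0; apply/eqP/hnorm_eq0/eqP.
by rewrite -sqrf_eq0 -(rdotxx normE) /rdot dotBr h subrr.
Qed.

Lemma adjE T x y : dot (T x) y = dot x (adj T y).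
Proof.
rewrite /adj; case: xgetP => [S _ ->//|nS]; exfalso.
have [f hf] := choice (adjoint_exists normE he T).
have lf : linear f.
  move=> c u v; apply: dot_injr => z.
  by rewrite dotDr dotZr -!hf dotDr dotZr.
have bf u : `|f u| <= (opnorm T)%:C * `|u|.
  rewrite -!hnormE -rmorphM lecR.
  have [->|/eqP z0] := eqVneq (hnorm (f u)) 0.
    by rewrite mulr_ge0 ?opnorm_ge0 ?hnorm_ge0.
  have zp : 0 < hnorm (f u) by rewrite lt_neqAle hnorm_ge0 eq_sym andbT; apply/eqP.
  rewrite -(ler_pM2r zp) -expr2 -(rdotxx normE) /rdot -hf.
  apply: le_trans (rdot_le normE _ _) _.
  by rewrite [leRHS]mulrAC ler_wpM2r ?hnorm_ge0// opnorm_bound.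
have [S Sf] := bop_of_bounded lf (opnorm_ge0 T) bf.
by apply: (nS S) => u v; rewrite Sf hf.
Qed.

Lemma adjEr T x y : dot x (T y) = dot (adj T x) y.
Proof. by rewrite dotC adjE -dotC. Qed.

Lemma adj_unique T S : (forall x y, dot (T x) y = dot x (S y)) -> adj T = S.
Proof. by move=> h; apply: bop_ext => y; apply: dot_injr => x; rewrite -adjE h. Qed.

Lemma adjK T : adj (adj T) = T.
Proof. by apply: adj_unique => x y; rewrite -adjEr. Qed.

Lemma adjD S T : adj (S + T) = adj S + adj T.
Proof. by apply: adj_unique => x y; rewrite bop_addE dotDl !adjE -dotDr. Qed.

Lemma adjZ c T : adj (c *: T) = c^* *: adj T.
Proof.
apply: adj_unique => x y; rewrite !bop_scaleE dotZl dotZr adjE.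
by rewrite conjCK.
Qed.

Lemma adjZr (r : R) T : adj (r%:C *: T) = r%:C *: adj T.
Proof. by rewrite adjZ; congr (_ *: _); exact: conjc_real. Qed.

Lemma adjN T : adj (- T) = - adj T.
Proof. by apply: adj_unique => x y; rewrite !bop_oppE dotNl dotNr adjE. Qed.

Lemma adjB S T : adj (S - T) = adj S - adj T.
Proof. by rewrite adjD adjN. Qed.

Lemma adjM S T : adj (S * T) = adj T * adj S.
Proof. by apply: adj_unique => x y; rewrite !bop_mulE !adjE. Qed.

Lemma adj1 : adj 1 = 1.
Proof. by apply: adj_unique. Qed.

Lemma adj0 : adj 0 = 0.
Proof. by apply: adj_unique => x y; rewrite !bop_zeroE dot0l linear0. Qed.

Lemma rd_adj T x y : rd (T x) y = rd x (adj T y).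
Proof. by rewrite /rdot adjE. Qed.

(** Complex polarization: expanding the form at [x + y] and at ['i *: x + y] kills the two parts of
    [dot (T x) y] separately. *)
Lemma dot_eq0_bop T : (forall x, dot (T x) x = 0) -> T = 0.
Proof.
move=> h; apply: bop_ext => x; rewrite bop_zeroE; apply: dot_injr => y.
have A u v : dot (T u) v + dot (T v) u = 0.
  by have := h (u + v); rewrite bopD !dotDl !dotDr !h add0r addr0.
rewrite dot0r dotC; have h1 := A x y; have h2 := A ('i *: x) y.
move: h2; rewrite bopZ dotZl dotZr.
have -> : ('i^* : R[i]) = - 'i by simpc.
rewrite mulNr -mulrBr => /eqP; rewrite mulf_eq0 => /orP[|].
  by rewrite eq_complex /= oner_eq0 andbF.
rewrite subr_eq0 => /eqP h2; move: h1; rewrite -h2 -mulr2n => /eqP.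
by rewrite mulrn_eq0 /= => /eqP ->; rewrite conjC0.
Qed.

Lemma pos_adj T : pos T -> adj T = T.
Proof.
move=> pT; apply/eqP; rewrite -subr_eq0; apply/eqP; apply: dot_eq0_bop => x.
rewrite bop_subE dotBl -adjEr dotC (ge0_ReE (pT x)).
apply/eqP; rewrite subr_eq0; apply/eqP; exact: conjc_real.
Qed.

Lemma pos_of_rd T : adj T = T -> (forall x, 0 <= rd (T x) x) -> pos T.
Proof.
move=> sT h x; have r : (dot (T x) x)^* = dot (T x) x by rewrite -dotC adjEr sT.
have := h x; rewrite /rdot lecE => ->; rewrite andbT.
move: r; case: (dot (T x) x) => u v [] /eqP.
by rewrite -subr_eq0 -opprD oppr_eq0 -mulr2n mulrn_eq0.
Qed.

Lemma pos_rd T x : pos T -> 0 <= rd (T x) x.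
Proof. by move=> /(_ x)/ge0_Re. Qed.

Lemma pos0 : pos 0.
Proof. by move=> x; rewrite bop_zeroE dot0l. Qed.

Lemma posD S T : pos S -> pos T -> pos (S + T).
Proof. by move=> pS pT x; rewrite bop_addE dotDl addr_ge0. Qed.

Lemma pos_sum I (s : seq I) (P : pred I) (F : I -> 'B(H)) :
  (forall i, P i -> pos (F i)) -> pos (\sum_(i <- s | P i) F i).
Proof. by move=> h; apply: big_ind => //; [exact: pos0|exact: posD]. Qed.

Lemma posZ (r : R) T : 0 <= r -> pos T -> pos (r%:C *: T).
Proof. by move=> r0 pT x; rewrite bop_scaleE dotZl mulr_ge0// ler0c. Qed.

Lemma pos_conj b T : pos T -> pos (adj b * T * b).
Proof. by move=> pT x; rewrite !bop_mulE adjE adjK. Qed.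

Lemma pos_conj_sa b T : adj b = b -> pos T -> pos (b * T * b).
Proof. by move=> sb /(pos_conj b); rewrite sb. Qed.

Lemma pos1 : pos 1.
Proof. by move=> x; rewrite bop_oneE (dotxx normE) ler0c sqr_ge0. Qed.

Lemma pos_sqr a : pos (adj a * a).
Proof. by rewrite -[adj a]mulr1; apply: pos_conj; exact: pos1. Qed.

Lemma rd_sqr a x : rd ((adj a * a) x) x = hnorm (a x) ^+ 2.
Proof. by rewrite bop_mulE rd_adj adjK (rdotxx normE). Qed.

Lemma pos_opnorm_sqr a : pos ((opnorm a ^+ 2)%:C *: (1 : 'B(H)) - adj a * a).
Proof.
apply: pos_of_rd => [|x].
  by rewrite adjB adjZr adj1 adjM adjK.
rewrite bop_subE rdotBl bop_scaleE rdotZl bop_oneE rd_sqr (rdotxx normE) -exprMn.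
rewrite subr_ge0 lerXn2r ?nnegrE ?mulr_ge0 ?opnorm_ge0 ?hnorm_ge0//.
exact: opnorm_bound.
Qed.

Lemma opnorm_le_sqr a (M : R) : 0 <= M -> pos ((M ^+ 2)%:C *: (1 : 'B(H)) - adj a * a) ->
  opnorm a <= M.
Proof.
move=> M0 h; apply: opnorm_le_of => // x; have := pos_rd x h.
rewrite bop_subE rdotBl bop_scaleE rdotZl bop_oneE rd_sqr (rdotxx normE) -exprMn.
by rewrite subr_ge0 ler_pXn2r// nnegrE ?mulr_ge0 ?hnorm_ge0.
Qed.

(** Polarization writes [4 * Re <b x, y>] as a difference of two values of the quadratic form; for
    [hnorm x = hnorm y] the parallelogram law bounds it by [4 * eps * hnorm x ^+ 2]. Then [y] is
    taken to be [b x] rescaled to the norm of [x]. *)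
Lemma opnorm_sa_le b (eps : R) : adj b = b ->
  (forall x, `|rd (b x) x| <= eps * hnorm x ^+ 2) -> 0 <= eps -> opnorm b <= eps.
Proof.
move=> sb hb e0.
have aux x y : hnorm x = hnorm y -> rd (b x) y <= eps * hnorm x ^+ 2.
  move=> xy; have h1 := hb (x + y); have h2 := hb (x - y).
  have C : rd (b y) x = rd (b x) y by rewrite rdotC -{1}sb -rd_adj.
  have : 4 * rd (b x) y = rd (b (x + y)) (x + y) - rd (b (x - y)) (x - y).
    by rewrite bopD bopB !(rdotBl, rdotBr, rdotDl, rdotDr) C; lra.
  have n1 : hnorm (x + y) ^+ 2 = hnorm x ^+ 2 + hnorm y ^+ 2 + 2 * rd x y.
    by have := hnormB_sqr normE x (- y); rewrite opprK hnormN rdotNr; lra.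
  have n2 := hnormB_sqr normE x y; rewrite n1 in h1; rewrite n2 in h2.
  rewrite -xy in h1 h2; move: (ler_norm (rd (b (x + y)) (x + y))) h1 h2.
  rewrite -[`|rd (b (x - y)) _|]normrN.
  move: (ler_norm (- rd (b (x - y)) (x - y))).
  move: (hnorm x ^+ 2) (rd x y) (rd (b _) _) (rd (b (x + y)) _) (rd (b (x - y)) _).
  move=> p q r s t; move: (`|_|) (`|_|) => u v h1 h2 h3 h4 h5.
  have : 4 * r <= eps * (p + p + 2 * q) + eps * (p + p - 2 * q) by lra.
  lra.
apply: opnorm_le_of => // x.
have [->|bx0] := eqVneq (hnorm (b x)) 0; first by rewrite mulr_ge0 ?hnorm_ge0.
have bxp : 0 < hnorm (b x) by rewrite lt_neqAle hnorm_ge0 eq_sym bx0.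
have x0 : hnorm x != 0.
  by apply: contra_neq bx0 => /hnorm_eq0 ->; rewrite linear0 hnorm0.
have xp : 0 < hnorm x by rewrite lt_neqAle hnorm_ge0 eq_sym x0.
have := aux x ((hnorm x / hnorm (b x))%:C *: b x).
rewrite hnormZ ger0_norm ?ler0c ?divr_ge0 ?hnorm_ge0//= divfK//.
move=> /(_ erefl); rewrite rdotZr (rdotxx normE).
have -> : hnorm x / hnorm (b x) * hnorm (b x) ^+ 2 = hnorm x * hnorm (b x).
  by rewrite expr2 mulrA divfK.
by rewrite expr2 mulrCA ler_pM2l.
Qed.

Lemma pos_opnorm_sub b : adj b = b -> pos ((opnorm b)%:C *: (1 : 'B(H)) - b).
Proof.
move=> sb; apply: pos_of_rd => [|x]; first by rewrite adjB adjZr adj1 sb.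
rewrite bop_subE rdotBl bop_scaleE rdotZl bop_oneE (rdotxx normE) subr_ge0.
apply: le_trans (rdot_le normE _ _) _.
by rewrite expr2 mulrA ler_wpM2r ?hnorm_ge0// opnorm_bound.
Qed.

Lemma opnorm_adj a : opnorm (adj a) <= opnorm a.
Proof.
apply: opnorm_le_of => [|x]; first exact: opnorm_ge0.
have [->|z0] := eqVneq (hnorm (adj a x)) 0.
  by rewrite mulr_ge0 ?opnorm_ge0 ?hnorm_ge0.
have zp : 0 < hnorm (adj a x) by rewrite lt_neqAle hnorm_ge0 eq_sym z0.
rewrite -(ler_pM2r zp) -expr2 -(rdotxx normE) -rd_adj.
apply: le_trans (rdot_le normE _ _) _.
by rewrite [leRHS]mulrAC ler_wpM2r ?hnorm_ge0// opnorm_bound.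
Qed.

(** The nontrivial half of the C*-identity; it turns norm bounds on [adj a * a], which excision
    provides, into bounds on [a]. *)
Lemma opnorm_sqr_le a (M : R) : opnorm (adj a * a) <= M -> opnorm a ^+ 2 <= M.
Proof.
move=> h; have M0 : 0 <= M := le_trans (opnorm_ge0 _) h.
rewrite -[M]sqr_sqrtr// lerXn2r ?nnegrE ?opnorm_ge0 ?sqrtr_ge0//.
apply: opnorm_le_sqr; first exact: sqrtr_ge0.
have sa : adj (adj a * a) = adj a * a by rewrite adjM adjK.
rewrite sqr_sqrtr//.
have -> : M%:C *: (1 : 'B(H)) - adj a * a =
   (M - opnorm (adj a * a))%:C *: (1 : 'B(H)) +
   ((opnorm (adj a * a))%:C *: (1 : 'B(H)) - adj a * a).
  by rewrite rmorphB scalerBl addrA subrK.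
by apply: posD; [apply: posZ; [rewrite subr_ge0|exact: pos1]|exact: pos_opnorm_sub].
Qed.

End Positivity.

(** * States *)

Section States.
Context {R : realType} {H : completeNormedModType R[i]}.
Variable dot : {dot H for Num.conj}.
Hypothesis normE : forall x : H, `|x| ^+ 2 = dot x x.
Variable e : nat -> H.
Hypothesis he : orthonormal_basis dot e.
Implicit Types S T U a b c : 'B(H).

Local Notation pos := (positive_op dot).
Local Notation adj := (adj dot).

(** Real parts keep the estimates in [R]; by [state_fun_eq] they determine the functional. *)
Definition re_fun (phi : dual 'B(H)) T : R := complex.Re (phi T).
Definition positive_fun (phi : dual 'B(H)) := forall T, pos T -> 0 <= phi T.
(** The seminorm of the GNS construction: for positive [phi], the length of the vector that [a]
    defines in the GNS space. *)
Definition state_norm (phi : dual 'B(H)) a : R := Num.sqrt (re_fun phi (adj a * a)).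

Lemma funD (phi : dual 'B(H)) S T : phi (S + T) = phi S + phi T.
Proof. exact: (linearD (phi : {linear 'B(H) -> R[i]^o})). Qed.
Lemma funZ (phi : dual 'B(H)) (z : R[i]) T : phi (z *: T) = z * phi T.
Proof. exact: (linearZ_LR (phi : {linear 'B(H) -> R[i]^o})). Qed.
Lemma funN (phi : dual 'B(H)) T : phi (- T) = - phi T.
Proof. exact: (linearN (phi : {linear 'B(H) -> R[i]^o})). Qed.
Lemma funB (phi : dual 'B(H)) S T : phi (S - T) = phi S - phi T.
Proof. by rewrite funD funN. Qed.

Section OneFunctional.
Variable phi : dual 'B(H).

Local Notation rs := (re_fun phi).
Local Notation s := (state_norm phi).

Lemma re_funD S T : rs (S + T) = rs S + rs T.
Proof. by rewrite /re_fun funD ReD. Qed.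
Lemma re_funN T : rs (- T) = - rs T.
Proof. by rewrite /re_fun funN ReN. Qed.
Lemma re_funB S T : rs (S - T) = rs S - rs T.
Proof. by rewrite re_funD re_funN. Qed.
Lemma re_funZ (r : R) T : rs (r%:C *: T) = r * rs T.
Proof. by rewrite /re_fun funZ ReZ. Qed.
Lemma re_fun0 : rs 0 = 0.
Proof. by have := re_funB 0 0; rewrite !subrr. Qed.

Hypothesis pphi : positive_fun phi.

Lemma re_fun_ge0 T : pos T -> 0 <= rs T.
Proof. by move=> /pphi/ge0_Re. Qed.

Lemma re_fun_le S T : pos (T - S) -> rs S <= rs T.
Proof. by move=> /re_fun_ge0; rewrite re_funB subr_ge0. Qed.

(** A self-adjoint [T] is a difference of the positive operators [opnorm T] times 1 and [opnorm T]
    times 1 minus [T], on which [phi] is real. *)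
Lemma Im_fun_sa T : adj T = T -> complex.Im (phi T) = 0.
Proof.
move=> sT; have h1 := pphi (pos_opnorm_sub normE he sT).
have h2 := pphi (posZ (opnorm_ge0 T) (pos1 normE)).
move: h1 h2; rewrite funB; case: (phi T) (phi _) => x y [u v].
rewrite !lecE /= => /andP[/eqP + _] /andP[/eqP + _]; lra.
Qed.

Lemma re_fun_adj T : rs (adj T) = rs T.
Proof.
have sT : adj ('i *: (T - adj T)) = 'i *: (T - adj T).
  rewrite (adjZ normE he) (adjB normE he) (adjK normE he) -opprB scalerN -scaleNr.
  by congr (_ *: _); simpc.
have /eqP := Im_fun_sa sT; rewrite funZ Im_iM funB ReB subr_eq0 => /eqP h.
by rewrite /re_fun h.
Qed.

Let q a b : R := rs (adj b * a).

Let qD a b c : q (a + b) c = q a c + q b c.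
Proof. by rewrite /q mulrDr re_funD. Qed.
Let qZ (r : R) a b : q (r%:C *: a) b = r * q a b.
Proof. by rewrite /q -bop_scaleAr re_funZ. Qed.
Let qC a b : q a b = q b a.
Proof. by rewrite /q -re_fun_adj (adjM normE he) (adjK normE he). Qed.
Let q0 a : 0 <= q a a.
Proof. by apply: re_fun_ge0; exact: (pos_sqr normE he). Qed.

Lemma state_norm_ge0 a : 0 <= s a.
Proof. exact: sqrtr_ge0. Qed.

Lemma state_norm_sqr a : s a ^+ 2 = rs (adj a * a).
Proof. by rewrite sqr_sqrtr// q0. Qed.

Lemma state_CS a b : rs (adj b * a) <= s b * s a.
Proof. by rewrite mulrC; exact: (semi_inner_le qD qZ qC q0 a b). Qed.

Lemma state_normD a b : s (a + b) <= s a + s b.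
Proof. exact: (semi_norm_triangle qD qZ qC q0 a b). Qed.

Lemma state_normZ z a : s (z *: a) = complex.Re `|z| * s a.
Proof.
rewrite /state_norm (adjZ normE he) -bop_scaleAr -bop_scaleAl scalerA -normCK.
have -> : `|z| ^+ 2 = ((complex.Re `|z|) ^+ 2)%:C.
  by rewrite rmorphXn; congr (_ ^+ 2); apply: ge0_ReE.
rewrite re_funZ sqrtrM ?sqr_ge0// sqrtr_sqr ger0_norm//; exact: ge0_Re.
Qed.

Lemma state_normN a : s (- a) = s a.
Proof. by rewrite -scaleN1r state_normZ normrN1 mul1r. Qed.

Lemma state_normB a b : s (a - b) <= s a + s b.
Proof. by rewrite -[s b]state_normN; exact: state_normD. Qed.

Lemma state_normC a b : s (a - b) = s (b - a).
Proof. by rewrite -state_normN opprB. Qed.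

Lemma state_norm_triangle b a c : s (a - c) <= s (a - b) + s (b - c).
Proof. by rewrite -[a - c](subrKA b); exact: state_normD. Qed.

(** Left multiplication is bounded on the GNS space since [adj b * b] is at most [opnorm b ^+ 2].
    Right multiplication has no such bound, so later products keep the factor of small seminorm on
    the right. *)
Lemma state_normM b a : s (b * a) <= opnorm b * s a.
Proof.
rewrite -(@ler_pXn2r _ 2)// ?nnegrE ?mulr_ge0 ?state_norm_ge0 ?opnorm_ge0//.
rewrite exprMn !state_norm_sqr -re_funZ; apply: re_fun_le.
have := pos_conj normE he a (pos_opnorm_sqr normE he b).
rewrite mulrBr mulrBl -bop_scaleAr -bop_scaleAl mulr1.
by rewrite (adjM normE he) !mulrA.
Qed.

Lemma state_norm0 : s 0 = 0.
Proof. by rewrite /state_norm mulr0 re_fun0 sqrtr0. Qed.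

End OneFunctional.

Section OneState.
Variable phi : dual 'B(H).
Hypothesis sphi : is_state dot phi.

Local Notation rs := (re_fun phi).
Local Notation s := (state_norm phi).

Lemma state_pos : positive_fun phi.
Proof. exact: sphi.1. Qed.
Let pphi := state_pos.

Lemma re_fun1 : rs 1 = 1.
Proof. by rewrite /re_fun sphi.2. Qed.

Lemma state_norm1 : s 1 = 1.
Proof. by rewrite /state_norm mulr1 (adj1 normE he) re_fun1 sqrtr1. Qed.

Lemma state_norm_le_opnorm a : s a <= opnorm a.
Proof. by rewrite -[a]mulr1 (le_trans (state_normM pphi _ _))// state_norm1 !mulr1. Qed.

Lemma re_fun_le_norm T : rs T <= s T.
Proof.
have := state_CS pphi T 1; rewrite (adj1 normE he) mul1r state_norm1 mul1r.
by [].
Qed.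

Lemma re_fun_le_opnorm T : rs T <= opnorm T.
Proof. exact: le_trans (re_fun_le_norm T) (state_norm_le_opnorm T). Qed.

Lemma abs_re_fun T : `|rs T| <= s T.
Proof.
rewrite ler_norml re_fun_le_norm andbT lerNl -state_normN -re_funN.
exact: re_fun_le_norm.
Qed.

End OneState.

Lemma state_fun_eq (phi psi : dual 'B(H)) : (forall T, re_fun phi T = re_fun psi T) ->
  phi = psi.
Proof.
move=> h; apply/val_inj/funext => T /=.
have h1 := h T; have := h ('i *: T); rewrite /re_fun !funZ !Re_iM => /oppr_inj.
by move: h1; rewrite /re_fun; case: (phi T) (psi T) => a b [c d] /= -> ->.
Qed.

End States.

(** * Pure states and excision *)

Section HahnBanach.
Context {R : realType} {V : lmodType R[i]}.

(** The scaling inequality yields equality when applied to [r^-1] as well ([sublinearZ]); the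
    inequality is the form that infima inherit directly. *)
Definition sublinear (p : V -> R) := (forall x y, p (x + y) <= p x + p y) /\
  (forall (r : R) x, 0 < r -> p (r%:C *: x) <= r * p x).

Lemma sublinear0 p : sublinear p -> p 0 = 0.
Proof.
move=> [pD pZ]; have h1 := pD 0 0; have h2 := pZ (2^-1) 0 (ltac:(by rewrite invr_gt0)).
by move: h1 h2; rewrite addr0 scaler0; lra.
Qed.

Lemma sublinear_ge p x : sublinear p -> - p (- x) <= p x.
Proof.
by move=> sp; have := sp.1 x (- x); rewrite subrr sublinear0// => h; lra.
Qed.

Lemma sublinearZ p (r : R) x : sublinear p -> 0 <= r -> p (r%:C *: x) = r * p x.
Proof.
move=> sp; rewrite le_eqVlt => /orP[/eqP <-|r0].
  by rewrite scale0r sublinear0// mul0r.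
apply/eqP; rewrite eq_le sp.2//= -ler_pdivlMl//.
have := sp.2 r^-1 (r%:C *: x); rewrite invr_gt0 scalerA -rmorphM mulVf ?gt_eqF//.
by rewrite scale1r => ->.
Qed.

(* Lowering p in the direction of y; a minimal sublinear functional is unchanged
   by this, which forces it to be additive. *)
Let dirs (p : V -> R) (y x : V) :=
  [set p (x + t%:C *: y) - t * p y | t in [set t : R | 0 <= t]].
Let push p y x := inf (dirs p y x).

Let dirs_lb p y x : sublinear p -> lbound (dirs p y x) (- p (- x)).
Proof.
move=> sp _ [t t0 <-]; rewrite -sublinearZ//.
have := sp.1 (x + t%:C *: y) (- x); rewrite addrAC subrr add0r; lra.
Qed.

Let dirs_inf p y x : sublinear p -> has_inf (dirs p y x).
Proof.
move=> sp; split; last by exists (- p (- x)); exact: dirs_lb.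
by exists (p (x + (0 : R)%:C *: y) - 0 * p y), 0 => /=.
Qed.

Let push_le p y x t : sublinear p -> 0 <= t -> push p y x <= p (x + t%:C *: y) - t * p y.
Proof. by move=> sp t0; apply: (ge_inf (dirs_inf _ _ sp).2); exists t. Qed.

Let le_push p y x c : sublinear p ->
  (forall t, 0 <= t -> c <= p (x + t%:C *: y) - t * p y) -> c <= push p y x.
Proof.
move=> sp h; apply: lb_le_inf; first exact: (dirs_inf _ _ sp).1.
by move=> _ [t t0 <-]; exact: h.
Qed.

Let push_sublinear p y : sublinear p -> sublinear (push p y).
Proof.
move=> sp; split=> [x1 x2|r x r0].
  rewrite -lerBlDr; apply: le_push => // t1 t10; rewrite lerBlDr -lerBlDl.
  apply: le_push => // t2 t20; rewrite lerBlDl.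
  apply: le_trans (push_le y (x1 + x2) sp (addr_ge0 t10 t20)) _.
  have := sp.1 (x1 + t1%:C *: y) (x2 + t2%:C *: y).
  by rewrite addrACA -scalerDl -rmorphD; lra.
rewrite -ler_pdivrMl//; apply: le_push => // t t0; rewrite ler_pdivrMl//.
apply: le_trans (push_le y _ sp (mulr_ge0 (ltW r0) t0)) _.
by rewrite rmorphM -scalerA -scalerDr sublinearZ ?(ltW r0)//; lra.
Qed.

Let push_le_self p y x : sublinear p -> push p y x <= p x.
Proof.
move=> sp; apply: le_trans (push_le y x sp (lexx 0)) _.
by rewrite scale0r addr0 mul0r subr0.
Qed.

Lemma minimal_sublinear p : sublinear p -> exists q, [/\ sublinear q,
  forall x, q x <= p x & forall q', sublinear q' -> (forall x, q' x <= q x) ->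
    forall x, q x <= q' x].
Proof.
move=> sp; pose T := {q : V -> R | sublinear q /\ forall x, q x <= p x}.
pose t0 : T := exist _ p (conj sp (fun=> lexx _)).
(* The order is reversed, so a maximal element for Zorn's lemma is a minimal functional. *)
pose Rl (a b : T) : bool := `[< forall x, sval b x <= sval a x >].
have [||A totA|[q [sq qp]] hq] := @ZL_preorder T t0 Rl.
- by move=> t; apply/asboolP.
- by move=> r s t /asboolP rs /asboolP st; apply/asboolP => x; apply: le_trans (st _) (rs _).
- have [A0|/set0P[a Aa]] := eqVneq A set0; first by exists t0 => s; rewrite A0.
  pose vals x := [set sval q x | q in A].
  have vals_lb x : lbound (vals x) (- p (- x)).
    move=> _ [[q [sq qp]] _ <-] /=; apply: le_trans (sublinear_ge x sq).
    by rewrite lerN2.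
  have vals_inf x : has_inf (vals x).
    by split; [exists (sval a x), a|exists (- p (- x))].
  pose m x := inf (vals x).
  have mq q x : A q -> m x <= sval q x.
    by move=> Aq; apply: (ge_inf (vals_inf x).2); exists q.
  have sm : sublinear m.
    split=> [x y|r x r0].
      rewrite -lerBlDr; apply: lb_le_inf; first exact: (vals_inf x).1.
      move=> _ [q1 Aq1 <-]; rewrite lerBlDr -lerBlDl.
      apply: lb_le_inf; first exact: (vals_inf y).1.
      move=> _ [q2 Aq2 <-]; rewrite lerBlDl.
      (* In a chain the smaller of [q1] and [q2] is below both, so its own subadditivity passes to
         the pointwise infimum. *)
      have [q [Aq h1 h2]] : exists q, [/\ A q, sval q x <= sval q1 x & sval q y <= sval q2 y].
        have [/asboolP h|/asboolP h] := totA _ _ Aq1 Aq2; first by exists q2; split.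
        by exists q1; split.
      apply: le_trans (mq _ (x + y) Aq) _; have := (svalP q).1.1 x y; lra.
    rewrite -ler_pdivrMl//; apply: lb_le_inf; first exact: (vals_inf x).1.
    move=> _ [q1 Aq1 <-]; rewrite ler_pdivrMl//.
    by apply: le_trans (mq _ _ Aq1) _; exact: (svalP q1).1.2.
  have mp x : m x <= p x by apply: le_trans (mq _ x Aa) _; exact: (svalP a).2.
  exists (exist _ m (conj sm mp)) => q Aq; apply/asboolP => x; exact: mq.
- exists q; split=> // q' sq' q'q x.
  have qp' x' : q' x' <= p x' := le_trans (q'q x') (qp x').
  have := hq (exist _ q' (conj sq' qp')).
  by move=> /(_ (asboolT q'q))/asboolP/(_ x).
Qed.

(** A minimal sublinear functional equals its push in every direction, hence is additive. Minimizing
    below [push p x0] instead of [p] fixes the value at [x0]: taking [t = 1] shows that [push p x0]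
    is at most [- p x0] at [- x0]. *)
Theorem hahn_banach p x0 : sublinear p -> exists f : V -> R,
  [/\ forall x y, f (x + y) = f x + f y, forall (r : R) x, f (r%:C *: x) = r * f x,
      forall x, f x <= p x & f x0 = p x0].
Proof.
move=> sp; have [f [sf fp fmin]] := minimal_sublinear (push_sublinear x0 sp).
have fD x y : f (x + y) = f x + f y.
  apply/eqP; rewrite eq_le sf.1 /=.
  have := fmin _ (push_sublinear y sf) (fun z => push_le_self y z sf) x.
  move=> /le_trans/(_ (push_le y x sf ler01)); rewrite scale1r mul1r; lra.
have fN x : f (- x) = - f x.
  by have := fD x (- x); rewrite subrr (sublinear0 sf); lra.
exists f; split=> //.
- move=> r x; have [r0|r0] := lerP 0 r; first exact: sublinearZ.
  have -> : r%:C *: x = - ((- r)%:C *: x) by rewrite rmorphN scaleNr opprK.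
  by rewrite fN (sublinearZ _ sf) ?oppr_ge0 ?ltW// mulNr opprK.
- by move=> x; apply: le_trans (fp x) _; exact: push_le_self.
apply/eqP; rewrite eq_le; apply/andP; split.
  by apply: le_trans (fp x0) _; exact: push_le_self.
rewrite -lerN2 -fN; apply: le_trans (fp _) _.
have := push_le x0 (- x0) sp ler01.
by rewrite scale1r addNr mul1r sublinear0// sub0r.
Qed.

End HahnBanach.

(** * Domination by positive operators that are small in a pure state *)

Section PureStates.
Context {R : realType} {H : completeNormedModType R[i]}.
Variable dot : {dot H for Num.conj}.
Hypothesis normE : forall x : H, `|x| ^+ 2 = dot x x.
Variable e : nat -> H.
Hypothesis he : orthonormal_basis dot e.
Implicit Types S T U a b c g h : 'B(H).

Local Notation rd := (rdot dot).
Local Notation pos := (positive_op dot).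
Local Notation adj := (adj dot).

(* Extremality in the order form: any positive functional below phi is a
   multiple of phi. *)
Definition pure_state (phi : dual 'B(H)) := is_state dot phi /\
  forall rho : dual 'B(H), positive_fun dot rho ->
    (forall T, pos T -> re_fun rho T <= re_fun phi T) ->
    forall T, re_fun rho T = re_fun rho 1 * re_fun phi T.

(* A functional is recovered from its real part by phi T = f T - i f(iT). *)
Lemma dual_of_real_functional (f : 'B(H) -> R) (M : R) : 0 <= M ->
  (forall S T, f (S + T) = f S + f T) ->
  (forall (r : R) T, f (r%:C *: T) = r * f T) ->
  (forall T, `|f T| <= M * opnorm T) ->
  exists rho : dual 'B(H), forall T, rho T = f T +i* - f ('i *: T).
Proof.
move=> M0 fD fZ fM.
have fN T : f (- T) = - f T.
  by have := fZ (-1) T; rewrite rmorphN scaleN1r mulN1r.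
have fii T : f ('i *: ('i *: T)) = - f T.
  by rewrite scalerA -expr2 sqr_i scaleN1r fN.
have fC (z : R[i]) T : f (z *: T) = complex.Re z * f T + complex.Im z * f ('i *: T).
  by rewrite {1}[z]complexE scalerDl fD fZ ['i * _]mulrC -scalerA fZ.
pose F (T : 'B(H)) : R[i] := f T +i* - f ('i *: T).
have FD S T : F (S + T) = F S + F T.
  by rewrite /F [X in f X +i* _]/(S + T) fD (scalerDr 'i S T) fD opprD.
have FZ z T : F (z *: T) = z * F T.
  have iz : 'i *: (z *: T) = z *: ('i *: T) by rewrite !scalerA mulrC.
  rewrite /F iz fC (fC z ('i *: T)) fii; case: z {iz} => u v /=.
  by apply/eqP; rewrite eq_complex /=; apply/andP; split; apply/eqP; ring.
have lF : linear (F : 'B(H) -> R[i]^o).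
  by move=> z S T; rewrite FD FZ.
suff bF T : `|F T| <= (M + M)%:C * `|T|.
  by have [rho hrho] := bop_of_bounded lF (addr_ge0 M0 M0) bF; exists rho.
apply: le_trans (normC_sum _) _.
have -> : `|T| = (opnorm T)%:C by [].
rewrite -rmorphM lecR /= mulrDl lerD// normrN.
apply: le_trans (fM _) _; rewrite opnormZ normc_def /= !expr0n expr1n add0r sqrtr1.
by rewrite mul1r.
Qed.

Lemma rd_bop_one (r : R) x : rd ((r%:C *: (1 : 'B(H))) x) x = r * hnorm x ^+ 2.
Proof. by rewrite bop_scaleE bop_oneE rdotZl (rdotxx normE). Qed.

(** Let [q c] be the infimum of [phi T] over positive [T] above [c]. Hahn-Banach gives a functional
    below [q] that agrees with it at [b]; it is positive and dominated by [phi], so by purity a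
    multiple of [phi], and [phi b = 0] forces [q b = 0]. *)
Lemma pure_dominate phi b (delta : R) : pure_state phi -> adj b = b ->
  re_fun phi b = 0 -> 0 < delta ->
  exists T, [/\ pos T, pos (T - b) & re_fun phi T < delta].
Proof.
move=> [sphi pphi] sb b0 d0; have p := state_pos sphi.
(* Hahn-Banach needs [q] on all operators, so [c] is compared with [T] through the real part of its
   quadratic form, which makes sense without self-adjointness. *)
pose D c := [set re_fun phi T | T in [set T | pos T /\ forall x, rd (c x) x <= rd (T x) x]].
have D_inf c : has_inf (D c).
  split; last by exists 0 => _ [T [pT _] <-]; exact: (re_fun_ge0 p).
  exists (re_fun phi ((opnorm c)%:C *: (1 : 'B(H)))), ((opnorm c)%:C *: (1 : 'B(H))) => //=; split.
    by apply: posZ; [exact: opnorm_ge0|exact: (pos1 normE)].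
  move=> x; rewrite rd_bop_one; apply: le_trans (rdot_le normE _ _) _.
  by rewrite expr2 mulrA ler_wpM2r ?hnorm_ge0// opnorm_bound.
pose q c := inf (D c).
have q_le c T : pos T -> (forall x, rd (c x) x <= rd (T x) x) -> q c <= re_fun phi T.
  by move=> pT cT; apply: (ge_inf (D_inf c).2); exists T.
have le_q c r : (forall T, pos T -> (forall x, rd (c x) x <= rd (T x) x) ->
    r <= re_fun phi T) -> r <= q c.
  by move=> h; apply: lb_le_inf; [exact: (D_inf c).1|move=> _ [T [? ?] <-]; exact: h].
have sq : sublinear q.
  split=> [c1 c2|r c r0].
    rewrite -lerBlDr; apply: (le_q _ _) => T1 pT1 h1; rewrite lerBlDr -lerBlDl.
    apply: (le_q _ _) => T2 pT2 h2; rewrite lerBlDl -re_funD; apply: (q_le _ _); first exact: posD.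
    by move=> x; rewrite !bop_addE !rdotDl lerD.
  rewrite -ler_pdivrMl//; apply: (le_q _ _) => T pT hT; rewrite ler_pdivrMl// -re_funZ.
  apply: (q_le _ _); first by apply: posZ => //; exact: ltW.
  by move=> x; rewrite !bop_scaleE !rdotZl ler_wpM2l// ltW.
have [f [fD fZ fq fb]] := hahn_banach b sq.
have fN T : f (- T) = - f T.
  by have := fZ (-1) T; rewrite rmorphN scaleN1r mulN1r.
have q_norm c : q c <= opnorm c.
  rewrite -[opnorm c]mulr1 -(re_fun1 sphi) -re_funZ; apply: (q_le _ _).
    by apply: posZ; [exact: opnorm_ge0|exact: (pos1 normE)].
  move=> x; rewrite rd_bop_one; apply: le_trans (rdot_le normE _ _) _.
  by rewrite expr2 mulrA ler_wpM2r ?hnorm_ge0// opnorm_bound.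
have fM T : `|f T| <= 1 * opnorm T.
  rewrite mul1r ler_norml (le_trans (fq T) (q_norm T)) andbT lerNl -fN.
  by rewrite -opnormN (le_trans (fq _) (q_norm _)).
have f_le0 c : (forall x, rd (c x) x <= 0) -> f c <= 0.
  move=> h; apply: le_trans (fq c) _; rewrite -(re_fun0 phi); apply: (q_le _ _); first exact: pos0.
  by move=> x; rewrite bop_zeroE {2}/rdot dot0l.
have [rho hrho] := dual_of_real_functional ler01 fD fZ fM.
have rhoE T : re_fun rho T = f T by rewrite /re_fun hrho.
have prho : positive_fun dot rho.
  move=> T pT; rewrite hrho lecE /=.
  have fT : 0 <= f T.
    rewrite -oppr_le0 -fN; apply: f_le0 => x.
    by rewrite bop_oppE rdotNl oppr_le0 pos_rd.
  (* For positive [T] the real quadratic form of ['i *: T] vanishes, hence [f ('i *: T) = 0] and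
     [rho T] is real. *)
  have im x : rd (('i *: T) x) x = 0.
    rewrite bop_scaleE /rdot dotZl Re_iM (ge0_ReE (pT x)) /=; exact: oppr0.
  have h1 : f ('i *: T) <= 0 by apply: f_le0 => x; rewrite im.
  have h2 : f (- ('i *: T)) <= 0 by apply: f_le0 => x; rewrite bop_oppE rdotNl im oppr0.
  rewrite fT andbT; apply/eqP; move: h2; rewrite fN; lra.
have rho_phi T : pos T -> re_fun rho T <= re_fun phi T.
  by move=> pT; rewrite rhoE (le_trans (fq T))// q_le.
have := pphi rho prho rho_phi b; rewrite !rhoE b0 mulr0 fb => qb.
have : inf (D b) < delta by rewrite -/(q b) qb.
move=> /(inf_lt (D_inf b).1)[_ [T [pT hT] <-] Td]; exists T; split=> //.
apply: (pos_of_rd normE he) => [|x]; first by rewrite (adjB normE he) sb (pos_adj normE he pT).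
by rewrite bop_subE rdotBl subr_ge0.
Qed.

End PureStates.

(** * Excision of pure states by powers of contractions *)

Section Excision.
Context {R : realType} {H : completeNormedModType R[i]}.
Variable dot : {dot H for Num.conj}.
Hypothesis normE : forall x : H, `|x| ^+ 2 = dot x x.
Variable e : nat -> H.
Hypothesis he : orthonormal_basis dot e.
Implicit Types S T U X a b c g h : 'B(H).

Local Notation rd := (rdot dot).
Local Notation pos := (positive_op dot).
Local Notation adj := (adj dot).

Definition unit_interval g := pos g /\ pos (1 - g).

Lemma unit_interval_adj g : unit_interval g -> adj g = g.
Proof. by move=> [pg _]; exact: (pos_adj normE he pg). Qed.

Lemma unit_intervalC g : unit_interval g -> unit_interval (1 - g).
Proof. by move=> [pg pg1]; split=> //; rewrite opprB addrC subrK. Qed.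

(** No square root is needed: [g * (1 - g)] is the sum of the conjugates of [1 - g] by [g] and of
    [g] by [1 - g]. *)
Lemma pos_mul_compl g : unit_interval g -> pos (g * (1 - g)).
Proof.
move=> ig; have [pg pg1] := ig.
have -> : g * (1 - g) = g * (1 - g) * g + (1 - g) * g * (1 - g).
  have -> : (1 - g) * g = g * (1 - g) by rewrite mulrBl mulrBr mul1r mulr1.
  by rewrite -mulrDr [g + _]addrC subrK mulr1.
apply: posD; first exact: (pos_conj_sa normE he (unit_interval_adj ig)).
exact: (pos_conj_sa normE he (unit_interval_adj (unit_intervalC ig))).
Qed.

(** Conjugation by [h] raises the exponent by two, so the induction has the two base cases [X] and
    [h * X]. *)
Lemma pos_expM h X m : adj h = h -> h * X = X * h -> pos X -> pos (h * X) ->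
  pos (h ^+ m * X).
Proof.
move=> sh hX pX phX; have [k] := ubnP m; elim: k m => // k IH [|[|m]] mk.
- by rewrite expr0 mul1r.
- by rewrite expr1.
have -> : h ^+ m.+2 * X = h * (h ^+ m * X) * h by rewrite exprS exprSr -!mulrA hX.
by apply: (pos_conj_sa normE he sh); apply: IH; rewrite ltnS in mk; apply: leq_trans mk.
Qed.

Section Powers.
Variable h : 'B(H).
Hypothesis ih : unit_interval h.
Let sh := unit_interval_adj ih.

Let comm_compl : h * (1 - h) = (1 - h) * h.
Proof. by rewrite mulrBl mulrBr mulr1 mul1r. Qed.

Let commX n : h ^+ n * (1 - h) = (1 - h) * h ^+ n.
Proof.
elim: n => [|n IH]; first by rewrite expr0 mulr1 mul1r.
by rewrite exprSr -mulrA comm_compl mulrA IH mulrA.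
Qed.

Lemma pos_exp n : pos (h ^+ n).
Proof.
have h1 : h * 1 = 1 * h by rewrite mulr1 mul1r.
have ph1 : pos (h * 1) by rewrite mulr1; exact: ih.1.
by have := pos_expM n sh h1 (pos1 normE) ph1; rewrite mulr1.
Qed.

Lemma pos_exp_compl n : pos (h ^+ n * (1 - h)).
Proof. exact: (pos_expM n sh comm_compl ih.2 (pos_mul_compl ih)). Qed.

Lemma pos_exp_compl2 n : pos (h ^+ n * (1 - h) * (1 - h)).
Proof.
rewrite commX; apply: (pos_conj_sa normE he); last exact: pos_exp.
exact: (unit_interval_adj (unit_intervalC ih)).
Qed.

Let expS_compl n : 1 - h ^+ n.+1 = (1 - h ^+ n) + h ^+ n * (1 - h).
Proof. by rewrite mulrBr mulr1 -exprSr subrKA. Qed.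

Lemma unit_interval_exp n : unit_interval (h ^+ n).
Proof.
split; first exact: pos_exp.
elim: n => [|n IH]; first by rewrite expr0 subrr; exact: pos0.
by rewrite expS_compl; apply: posD => //; exact: pos_exp_compl.
Qed.

(** The operator form of [n t^n (1 - t) <= 1] on the unit interval. The induction proves the sharper
    bound by [1 - h ^+ n], a sum of [n] terms [h ^+ i * (1 - h)] each at least
    [h ^+ n * (1 - h)]. *)
Lemma exp_compl_bound n : pos (1 - (n%:R : R)%:C *: (h ^+ n * (1 - h))).
Proof.
suff H0 : pos ((1 - h ^+ n) - (n%:R : R)%:C *: (h ^+ n * (1 - h))).
  have := posD H0 (pos_exp n); rewrite addrAC subrK; exact.
elim: n => [|n IH]; first by rewrite expr0 subrr scale0r subrr; exact: pos0.
have -> : 1 - h ^+ n.+1 - (n.+1%:R : R)%:C *: (h ^+ n.+1 * (1 - h)) =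
  (1 - h ^+ n - (n%:R : R)%:C *: (h ^+ n * (1 - h))) +
    (n.+1%:R : R)%:C *: (h ^+ n * (1 - h) * (1 - h)).
  have -> : h ^+ n * (1 - h) * (1 - h) = h ^+ n * (1 - h) - h ^+ n.+1 * (1 - h).
    by rewrite [in LHS]mulrBr mulr1 -[X in _ - X]mulrA -comm_compl mulrA -exprSr.
  rewrite expS_compl scalerBr -natr1 rmorphD /= !scalerDl !scale1r.
  set A := h ^+ n * _; set B := h ^+ n.+1 * _; set C := 1 - _.
  by rewrite opprD [in RHS]addrA [in RHS](addrA (C - _)) subrK !addrA.
by apply: posD => //; apply: posZ => //; exact: pos_exp_compl2.
Qed.

(** Bernoulli's inequality for operators: each summand [h ^+ i * (1 - h)] of [1 - h ^+ n] is at most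
    [1 - h]. *)
Lemma compl_exp_bound n : pos ((n%:R : R)%:C *: (1 - h) - (1 - h ^+ n)).
Proof.
have step m : pos ((1 - h) - h ^+ m * (1 - h)).
  elim: m => [|m IH]; first by rewrite expr0 mul1r subrr; exact: pos0.
  have := posD IH (pos_exp_compl2 m).
  have -> : h ^+ m * (1 - h) * (1 - h) = h ^+ m * (1 - h) - h ^+ m.+1 * (1 - h).
    by rewrite [in LHS]mulrBr mulr1 -[X in _ - X]mulrA -comm_compl mulrA -exprSr.
  by rewrite subrKA.
elim: n => [|n IH]; first by rewrite expr0 subrr scale0r subrr; exact: pos0.
have := posD IH (step n).
rewrite -natr1 rmorphD /= scalerDl scale1r expS_compl.
set A := _ *: _; set B := 1 - h ^+ n; set D := h ^+ n * _; set E := 1 - h.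
by rewrite (opprD B D) (addrACA A).
Qed.

End Powers.

Lemma unit_interval_opnorm g : unit_interval g -> opnorm g <= 1.
Proof.
move=> ig; apply: (opnorm_le_sqr normE he) => //.
rewrite (unit_interval_adj ig) expr1n scale1r.
have -> : 1 - g * g = (1 - g) + g * (1 - g) by rewrite mulrBr mulr1 subrKA.
by apply: posD; [exact: ig.2|exact: (pos_mul_compl ig)].
Qed.

Lemma state_norm_compl phi g : is_state dot phi -> unit_interval g ->
  state_norm dot phi (1 - g) ^+ 2 <= re_fun phi (1 - g).
Proof.
move=> sphi ig; have p := state_pos sphi; rewrite (state_norm_sqr normE he p).
rewrite (unit_interval_adj (unit_intervalC ig)); apply: (re_fun_le p).
have -> : 1 - g - (1 - g) * (1 - g) = g * (1 - g).
  by rewrite [in X in _ - X]mulrBl mul1r opprB addrC subrK.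
exact: (pos_mul_compl ig).
Qed.

(** Excision in the sense of Akemann, Anderson and Pedersen. For small [eps] the condition on
    [1 - g] excludes trivial choices such as [g = 0]. *)
Definition excises (phi : dual 'B(H)) (bs : seq 'B(H)) (eps : R) g :=
  [/\ unit_interval g, re_fun phi (1 - g) <= eps &
    forall b, b \in bs -> opnorm (g * b * g - (re_fun phi b)%:C *: (g * g)) <= eps].

Lemma pure_dominate_seq phi (bs : seq 'B(H)) (delta : R) : pure_state dot phi ->
  (forall b, b \in bs -> adj b = b) -> 0 < delta ->
  exists T, [/\ pos T, re_fun phi T < delta & forall b, b \in bs ->
    pos (T - (b - (re_fun phi b)%:C *: (1 : 'B(H)))) /\
    pos (T + (b - (re_fun phi b)%:C *: (1 : 'B(H))))].
Proof.
move=> pphi; have [sphi _] := pphi.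
elim: bs delta => [|b bs IH] delta hbs d0.
  by exists 0; split=> //; [exact: pos0|rewrite re_fun0].
(* One third each for the inductive [T] and for the operators that dominate [b0] and [- b0]. *)
have d3 : 0 < delta / 3 by rewrite divr_gt0.
have hbs' b' : b' \in bs -> adj b' = b' by move=> b'bs; apply: hbs; rewrite inE b'bs orbT.
have [T [pT Td hT]] := IH _ hbs' d3.
pose b0 : 'B(H) := b - (re_fun phi b)%:C *: (1 : 'B(H)).
have sb0 : adj b0 = b0.
  by rewrite /b0 (adjB normE he) (adjZr normE he) (adj1 normE he) hbs ?mem_head.
have b00 : re_fun phi b0 = 0 by rewrite /b0 re_funB re_funZ (re_fun1 sphi) mulr1 subrr.
have [T1 [pT1 hT1 T1d]] := pure_dominate normE he pphi sb0 b00 d3.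
have sb1 : adj (- b0) = - b0 by rewrite (adjN normE he) sb0.
have b01 : re_fun phi (- b0) = 0 by rewrite re_funN b00 oppr0.
have [T2 [pT2 hT2 T2d]] := pure_dominate normE he pphi sb1 b01 d3.
exists (T + (T1 + T2)); split; first by do 2!apply: posD => //.
  by rewrite !re_funD; lra.
move=> b'; rewrite inE => /orP[/eqP ->|/hT[h1 h2]].
  rewrite -/b0; split.
    have -> : T + (T1 + T2) - b0 = T + T2 + (T1 - b0).
      by rewrite -!addrA; congr (_ + _); rewrite addrCA.
    by do 2!apply: posD => //.
  have -> : T + (T1 + T2) + b0 = T + T1 + (T2 - - b0) by rewrite opprK !addrA.
  by do 2!apply: posD => //.
split.
  by rewrite addrAC; do 2!apply: posD => //.
by rewrite addrAC; do 2!apply: posD => //.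
Qed.

(** Take one positive [T] of tiny [phi]-value above all differences between [b] and [phi b], up to
    sign, and put [g = (1 - T / C) ^+ k]. A large [k] makes [g * T * g] small by [exp_compl_bound],
    while [phi (1 - g)] is at most [k * phi T / C] by [compl_exp_bound]. *)
Theorem pure_excision phi (bs : seq 'B(H)) (eps : R) : pure_state dot phi ->
  (forall b, b \in bs -> adj b = b) -> 0 < eps -> exists g, excises phi bs eps g.
Proof.
move=> pphi hbs e0; have [sphi _] := pphi; have p := state_pos sphi.
(* [delta] must be fixed before [T], hence before [C]. With [k <= C / eps + 1] and [1 <= C], the
   quantity [k * delta / C] is at most [(eps^-1 + 1) * delta = eps]. *)
pose delta := eps / (eps^-1 + 1).
have d0 : 0 < delta by rewrite divr_gt0// addr_gt0// invr_gt0.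
have [T [pT Td hT]] := pure_dominate_seq pphi hbs d0.
pose C := opnorm T + 1.
have C1 : 1 <= C by rewrite lerDr opnorm_ge0.
have C0 : 0 < C by apply: lt_le_trans C1.
pose h : 'B(H) := 1 - (C^-1)%:C *: T.
have hT1 : 1 - h = (C^-1)%:C *: T by rewrite /h opprB addrC subrK.
have ih : unit_interval h.
  split; last by rewrite hT1; apply: posZ => //; rewrite invr_ge0 ltW.
  have -> : h = (C^-1)%:C *: (1 + ((opnorm T)%:C *: (1 : 'B(H)) - T)).
    have CC : C%:C *: (1 : 'B(H)) = 1 + (opnorm T)%:C *: (1 : 'B(H)).
      by rewrite /C rmorphD scalerDl scale1r addrC.
    by rewrite addrA -CC scalerBr scalerA -rmorphM mulVf ?gt_eqF// scale1r.
  apply: posZ; first by rewrite invr_ge0 ltW.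
  apply: posD; first exact: (pos1 normE).
  exact: (pos_opnorm_sub normE he (pos_adj normE he pT)).
clearbody h.
pose n := Num.truncn (C / eps); pose k := n.+1.
have kC : C / eps < k%:R by exact: truncnS_gt.
have kC' : k%:R <= C / eps + 1.
  rewrite /k -natr1 lerD2r truncn_le// divr_ge0 ?ltW//.
have k0 : (0 : R) < k%:R by rewrite ltr0n.
pose g := h ^+ k; have ig : unit_interval g := unit_interval_exp ih k.
have sg := unit_interval_adj ig.
exists g; split=> //.
  apply: le_trans (re_fun_le p (compl_exp_bound ih k)) _.
  rewrite re_funZ hT1 re_funZ.
  apply: le_trans (_ : (C / eps + 1) * (C^-1 * delta) <= _).
    apply: ler_pM; [exact: ltW| |exact: kC'|].
      by rewrite mulr_ge0 ?(re_fun_ge0 p)// invr_ge0 ltW.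
    by rewrite ler_pM2l ?invr_gt0// ltW.
  have e1 : eps = (eps^-1 + 1) * delta.
    by rewrite /delta mulrC divfK// gt_eqF// addr_gt0// invr_gt0.
  have -> : (C / eps + 1) * (C^-1 * delta) = (eps^-1 + C^-1) * delta.
    by field; rewrite !gt_eqF.
  by rewrite [leRHS]e1 ler_pM2r// lerD2l invf_le1.
move=> b bbs; have [h1 h2] := hT b bbs.
set beta := re_fun phi b.
have -> : g * b * g - beta%:C *: (g * g) = g * (b - beta%:C *: (1 : 'B(H))) * g.
  by rewrite mulrBr mulrBl -bop_scaleAr mulr1 -bop_scaleAl.
have sb0 : adj (b - beta%:C *: (1 : 'B(H))) = b - beta%:C *: (1 : 'B(H)).
  by rewrite (adjB normE he) (adjZr normE he) (adj1 normE he) hbs.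
have gTg : g * T * g = C%:C *: (h ^+ (k + k) * (1 - h)).
  have TE : T = C%:C *: (1 - h) by rewrite hT1 scalerA -rmorphM divff ?gt_eqF// scale1r.
  have hc m : (1 - h) * h ^+ m = h ^+ m * (1 - h).
    elim: m => [|m IH]; first by rewrite expr0 mul1r mulr1.
    by rewrite exprSr mulrA IH -!mulrA; congr (_ * _); rewrite mulrBl mulrBr mul1r mulr1.
  by rewrite [in LHS]TE -bop_scaleAr -bop_scaleAl exprD -!mulrA hc.
have gTg_le x : rd ((g * T * g) x) x <= eps * hnorm x ^+ 2.
  have := pos_rd x (exp_compl_bound ih (k + k)).
  rewrite gTg bop_subE rdotBl !bop_scaleE !rdotZl bop_oneE (rdotxx normE) natrD.
  set r := rd _ _; set N := hnorm x ^+ 2 => hr.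
  have N0 : 0 <= N by exact: sqr_ge0.
  have [r0|r0] := lerP r 0.
    apply: (@le_trans _ _ 0); first by rewrite pmulr_rle0.
    exact: mulr_ge0 (ltW e0) N0.
  have : C * r <= eps * (k%:R * r).
    rewrite mulrA ler_wpM2r ?ltW//.
    by move: kC; rewrite ltr_pdivrMr// mulrC.
  have : eps * (k%:R * r) <= eps * N.
    rewrite ler_pM2l//; have : 0 < k%:R * r by rewrite mulr_gt0.
    lra.
  lra.
apply: (opnorm_sa_le normE he); last exact: ltW.
  by rewrite !(adjM normE he) sb0 sg mulrA.
move=> x; rewrite ler_norml; apply/andP; split.
  have := pos_rd x (pos_conj_sa normE he sg h2).
  rewrite mulrDr mulrDl bop_addE rdotDl; have := gTg_le x; lra.
have := pos_rd x (pos_conj_sa normE he sg h1).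
rewrite mulrBr mulrBl bop_subE rdotBl; have := gTg_le x; lra.
Qed.

End Excision.

Lemma dependent_choice_nat (T : Type) (P : nat -> T -> Prop) (Q : nat -> T -> T -> Prop) (x0 : T) :
  P 0%N x0 -> (forall n x, P n x -> exists y, P n.+1 y /\ Q n x y) ->
  exists f : nat -> T, [/\ f 0%N = x0, forall n, P n (f n) & forall n, Q n (f n) (f n.+1)].
Proof.
move=> P0 h.
have /choice[F hF] : forall z : nat * T, exists y,
    P z.1 z.2 -> P z.1.+1 y /\ Q z.1 z.2 y.
  move=> [n x]; have [Pnx|nP] := pselect (P n x); last by exists x.
  by have [y hy] := h _ _ Pnx; exists y.
pose f := fix f n := if n is m.+1 then F (m, f m) else x0.
have Pf n : P n (f n) by elim: n => //= n IH; exact: (hF (n, f n) IH).1.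
by exists f; split=> // n; exact: (hF (n, f n) (Pf n)).2.
Qed.

Lemma small_pow2 (R : realType) (M eps : R) : 0 < eps -> exists n, M / 2 ^+ n <= eps.
Proof.
move=> e0; pose n := (Num.truncn `|M / eps|).+1; exists n.
have h : `|M / eps| < 2 ^+ n.
  apply: lt_le_trans (truncnS_gt _) _; rewrite -natrX ler_nat -/n.
  exact: ltnW (ltn_expl n (ltnSn 1)).
rewrite ler_pdivrMr ?exprn_gt0// mulrC -ler_pdivrMr//.
exact: le_trans (ler_norm _) (ltW h).
Qed.

(** * Vector states and transitivity *)

Section VectorStates.
Context {R : realType} {H : completeNormedModType R[i]}.
Variable dot : {dot H for Num.conj}.
Hypothesis normE : forall x : H, `|x| ^+ 2 = dot x x.
Variable e : nat -> H.
Hypothesis he : orthonormal_basis dot e.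
Implicit Types S T U X a b c g h u v w : 'B(H).

Local Notation adj := (adj dot).

Lemma sandwich_fun_exists (phi : dual 'B(H)) a b :
  exists rho : dual 'B(H), forall T, rho T = phi (a * T * b).
Proof.
pose f T := a * T * b.
have lf : linear f.
  by move=> z S T; rewrite /f mulrDr mulrDl -bop_scaleAr -bop_scaleAl.
have bf T : `|f T| <= (opnorm a * opnorm b)%:C * `|T|.
  change ((opnorm (f T))%:C <= (opnorm a * opnorm b)%:C * (opnorm T)%:C).
  rewrite -rmorphM lecR (le_trans (opnormM _ _))// mulrAC ler_wpM2r ?opnorm_ge0//.
  exact: opnormM.
have [F hF] := bop_of_bounded lf (mulr_ge0 (opnorm_ge0 _) (opnorm_ge0 _)) bf.
have cF : (phi \o F) \in @bop_pred R 'B(H) R[i]^o.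
  rewrite inE; split; last first.
    by move=> T; apply: continuous_comp; [exact: (bopP F).2|exact: (bopP phi).2].
  by move=> z S T /=; rewrite (bopP F).1 (bopP phi).1.
by exists (Bop cF) => T; rewrite /= hF.
Qed.

Definition sandwich_fun (phi : dual 'B(H)) a b : dual 'B(H) :=
  xget phi [set rho : dual 'B(H) | forall T, rho T = phi (a * T * b)].

Lemma sandwich_funE phi a b T : sandwich_fun phi a b T = phi (a * T * b).
Proof.
rewrite /sandwich_fun; case: xgetP => [rho _ ->//|nrho].
by have [rho hrho] := sandwich_fun_exists phi a b; case: (nrho rho).
Qed.

(** The functional of the GNS vector defined by [u]; by [vector_fun_eq] it depends only on the class
    of [u] modulo null vectors when [phi] is positive. *)
Definition vector_fun (phi : dual 'B(H)) u : dual 'B(H) := sandwich_fun phi (adj u) u.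

Lemma vector_funE phi u T : vector_fun phi u T = phi (adj u * T * u).
Proof. exact: sandwich_funE. Qed.

Lemma re_vector_fun phi u T : re_fun (vector_fun phi u) T = re_fun phi (adj u * T * u).
Proof. by rewrite /re_fun vector_funE. Qed.

Lemma positive_vector_fun phi u : positive_fun dot phi -> positive_fun dot (vector_fun phi u).
Proof. by move=> p T pT; rewrite vector_funE; apply: p; exact: (pos_conj normE he). Qed.

Lemma state_norm_vector_fun phi u a :
  state_norm dot (vector_fun phi u) a = state_norm dot phi (a * u).
Proof. by rewrite /state_norm re_vector_fun (adjM normE he) !mulrA. Qed.

Lemma vector_fun_state phi u : positive_fun dot phi -> state_norm dot phi u = 1 ->
  is_state dot (vector_fun phi u).
Proof.
move=> p su; split; first exact: positive_vector_fun.
rewrite vector_funE -[idop]/(1 : 'B(H)) mulr1.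
have -> := ge0_ReE (p _ (pos_sqr normE he u)).
by rewrite -/(re_fun phi _) -(state_norm_sqr normE he p) su expr1n.
Qed.

Lemma vector_fun_dist phi T a b : positive_fun dot phi ->
  re_fun phi (adj a * T * a) - re_fun phi (adj b * T * b) <=
  opnorm T * (state_norm dot phi a + state_norm dot phi b) * state_norm dot phi (a - b).
Proof.
move=> p; rewrite -re_funB.
have -> : adj a * T * a - adj b * T * b =
   adj a * (T * (a - b)) + adj (a - b) * (T * b).
  by rewrite (adjB normE he) mulrBr mulrBr mulrBl !mulrA subrKA.
rewrite re_funD [leRHS]mulrAC [leRHS]mulrDr lerD//.
  apply: le_trans (state_CS normE he p _ _) _; rewrite mulrC.
  by rewrite ler_wpM2r ?state_norm_ge0// (state_normM normE he p).
apply: le_trans (state_CS normE he p _ _) _; rewrite [leRHS]mulrAC mulrC.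
by rewrite ler_wpM2r ?state_norm_ge0// (state_normM normE he p).
Qed.

Lemma vector_fun_eq phi T a b : positive_fun dot phi -> state_norm dot phi (a - b) = 0 ->
  re_fun phi (adj a * T * a) = re_fun phi (adj b * T * b).
Proof.
move=> p h; have h' : state_norm dot phi (b - a) = 0 by rewrite (state_normC normE he).
have := vector_fun_dist T a b p; have := vector_fun_dist T b a p.
rewrite h h' !mulr0; lra.
Qed.

Section Excised.
Variables (phi : dual 'B(H)) (bs : seq 'B(H)) (eta : R) (g : 'B(H)).
Hypothesis sphi : is_state dot phi.
Hypothesis eta0 : 0 <= eta.
Hypothesis exc : excises dot phi bs (eta ^+ 2) g.

Local Notation s := (state_norm dot phi).

Lemma excises_compl : s (1 - g) <= eta.
Proof.
rewrite -(@ler_pXn2r _ 2)// ?nnegrE ?state_norm_ge0//.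
by case: exc => ig h _; apply: le_trans (state_norm_compl normE he sphi ig) h.
Qed.

(** Excision replaces [g * adj a * a * g] by [s a ^+ 2] times [g * g]. The tolerance [eta ^+ 2]
    becomes the additive error [eta] after the square root. *)
Lemma excises_opnorm a : adj a * a \in bs -> opnorm (a * g) <= s a + eta.
Proof.
move=> abs; have [ig _ /(_ _ abs) h] := exc.
have p := state_pos sphi.
have se : 0 <= s a + eta by rewrite addr_ge0 ?state_norm_ge0.
rewrite -(@ler_pXn2r _ 2)// ?nnegrE ?opnorm_ge0//.
apply: (opnorm_sqr_le normE he).
rewrite (adjM normE he) (unit_interval_adj normE he ig).
set X := _ - _ in h.
have -> : g * adj a * (a * g) = X + (re_fun phi (adj a * a))%:C *: (g * g).
  by rewrite /X subrK !mulrA.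
apply: le_trans (opnormD _ _) _; rewrite opnormZ -(state_norm_sqr normE he p).
rewrite ger0_norm ?ler0c ?sqr_ge0//=.
have gg : opnorm (g * g) <= 1.
  apply: le_trans (opnormM _ _) _; have := unit_interval_opnorm normE he ig.
  by have := opnorm_ge0 g => h1 h2; rewrite -[1]mulr1 ler_pM.
have : s a ^+ 2 * opnorm (g * g) <= s a ^+ 2 by rewrite ler_piMr ?sqr_ge0.
have : 0 <= s a * eta by rewrite mulr_ge0 ?state_norm_ge0.
by rewrite sqrrD; lra.
Qed.

End Excised.

Lemma opnorm_self_adj_sqr_sa a : adj (adj a * a) = adj a * a.
Proof. by rewrite (adjM normE he) (adjK normE he). Qed.

(* Excision makes (u^* u) close to s(u)^2 after sandwiching by g, so that
   v = s(u)^-2 r g u^* satisfies v u ~ r; iterating with geometric errors gives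
   an exact solution without Kadison's transitivity theorem. *)
Lemma irreducible_step phi u r (eps : R) : pure_state dot phi ->
  0 < state_norm dot phi u -> 0 < eps -> exists v,
  opnorm v <= opnorm u / state_norm dot phi u ^+ 2 * (state_norm dot phi r + eps) /\
  state_norm dot phi (v * u - r) <= eps.
Proof.
move=> pphi u0 e0; have [sphi _] := pphi; have p := state_pos sphi.
pose w := adj u * u; pose beta := state_norm dot phi u ^+ 2.
have betaE : re_fun phi w = beta by rewrite -(state_norm_sqr normE he p).
have b0 : 0 < beta by rewrite exprn_gt0.
(* The numerators 1, [opnorm w] and [2 * beta] come from the excision error of [w], from
   [g * w * (1 - g)], and from [beta] times [1 - g * g]. The final 1 gives [1 <= K], hence
   [eta <= eps]. *)
pose K := opnorm r * (1 + opnorm w + 2 * beta) / beta + 1.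
have K1 : 1 <= K.
  by rewrite lerDr divr_ge0 ?mulr_ge0 ?opnorm_ge0 ?addr_ge0 ?mulr_ge0 ?opnorm_ge0// ltW.
have K0 : 0 < K := lt_le_trans ltr01 K1.
pose eta := Num.min 1 (eps / K).
have eta0 : 0 < eta by rewrite lt_min ltr01 divr_gt0.
have eta1 : eta <= 1 by rewrite ge_min lexx.
have etaK : eta * K <= eps by rewrite -ler_pdivlMr// ge_min lexx orbT.
have eta_eps : eta <= eps by apply: le_trans etaK; rewrite ler_peMr// ltW.
have hbs b : b \in [:: w; adj r * r] -> adj b = b.
  by rewrite !inE => /orP[] /eqP ->; exact: opnorm_self_adj_sqr_sa.
have [g exc] := pure_excision normE he pphi hbs (exprn_gt0 2 eta0).
have s1g := excises_compl sphi (ltW eta0) exc.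
have rg : opnorm (r * g) <= state_norm dot phi r + eta.
  by apply: (excises_opnorm sphi (ltW eta0) exc); rewrite !inE eqxx orbT.
have [ig _ hb] := exc.
have g1 := unit_interval_opnorm normE he ig.
exists ((beta^-1)%:C *: (r * g * adj u)); split.
  rewrite -/beta opnormZ ger0_norm ?ler0c ?invr_ge0 ?(ltW b0)//=.
  rewrite [opnorm u / _]mulrC -[leRHS]mulrA ler_wpM2l ?invr_ge0 ?(ltW b0)//.
  rewrite [leRHS]mulrC; apply: le_trans (opnormM _ _) _.
  apply: ler_pM; rewrite ?opnorm_ge0//; first by apply: le_trans rg _; rewrite lerD2l.
  exact: (opnorm_adj normE he).
have -> : (beta^-1)%:C *: (r * g * adj u) * u - r =
    (beta^-1)%:C *: (r * (g * w - beta%:C *: (1 : 'B(H)))).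
  rewrite mulrBr scalerBr -bop_scaleAl -bop_scaleAr mulr1 scalerA -rmorphM mulVf ?gt_eqF//.
  by rewrite scale1r /w !mulrA.
rewrite (state_normZ normE he) ger0_norm ?ler0c ?invr_ge0 ?(ltW b0)//=.
have bound : state_norm dot phi (g * w - beta%:C *: (1 : 'B(H))) <= eta * (1 + opnorm w + 2 * beta).
  have -> : g * w - beta%:C *: (1 : 'B(H)) = (g * w * g - beta%:C *: (g * g)) +
     (g * w * (1 - g) - beta%:C *: ((1 - g) + g * (1 - g))).
    rewrite [g * w * (1 - g)]mulrBr mulr1 [g * (1 - g)]mulrBr mulr1 subrKA scalerBr opprB.
    by rewrite addrACA subrKC addKr.
  apply: le_trans (state_normD normE he p _ _) _.
  have h1 : state_norm dot phi (g * w * g - beta%:C *: (g * g)) <= eta.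
    apply: le_trans (state_norm_le_opnorm normE he sphi _) _.
    have := hb w; rewrite inE eqxx betaE => /(_ isT)/le_trans; apply.
    by rewrite expr2 ler_piMr// ltW.
  have h2 : state_norm dot phi (g * w * (1 - g)) <= opnorm w * eta.
    apply: le_trans (state_normM normE he p _ _) _.
    apply: ler_pM; rewrite ?opnorm_ge0 ?state_norm_ge0//.
    by apply: le_trans (opnormM _ _) _; rewrite ler_piMl ?opnorm_ge0.
  have h3 : state_norm dot phi ((1 - g) + g * (1 - g)) <= 2 * eta.
    apply: le_trans (state_normD normE he p _ _) _.
    have : state_norm dot phi (g * (1 - g)) <= state_norm dot phi (1 - g).
      apply: le_trans (state_normM normE he p _ _) _.
      by rewrite ler_piMl ?state_norm_ge0.
    lra.
  have h4 : state_norm dot phi (beta%:C *: ((1 - g) + g * (1 - g))) <= beta * (2 * eta).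
    by rewrite (state_normZ normE he) ger0_norm ?ler0c ?(ltW b0)//= ler_wpM2l// ltW.
  have := state_normB normE he p (g * w * (1 - g)) (beta%:C *: ((1 - g) + g * (1 - g))).
  move: h1 h2 h4; lra.
apply: le_trans etaK; rewrite mulrC ler_pdivrMr//.
apply: le_trans (state_normM normE he p _ _) _.
apply: le_trans (_ : opnorm r * (eta * (1 + opnorm w + 2 * beta)) <= _).
  by rewrite ler_wpM2l ?opnorm_ge0.
have -> : eta * K * beta = opnorm r * (eta * (1 + opnorm w + 2 * beta)) + eta * beta.
  by rewrite /K; field; rewrite gt_eqF.
by rewrite lerDl mulr_ge0// ltW.
Qed.

(** Each correction solves approximately for the remaining defect, and the corrections are summable
    in operator norm. A moving target [r] gives more than transitivity: with [u = 1], a sequence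
    that is Cauchy at this rate in the GNS seminorm has a limit represented by an operator. *)
Lemma irreducible_limit phi u (r : nat -> 'B(H)) : pure_state dot phi ->
  0 < state_norm dot phi u ->
  (forall n, state_norm dot phi (r n.+1 - r n) <= (2 ^+ n)^-1) ->
  exists v M, forall n, state_norm dot phi (r n - v * u) <= M / 2 ^+ n.
Proof.
move=> pphi u0 hr; have [sphi _] := pphi; have p := state_pos sphi.
pose K := opnorm u / state_norm dot phi u ^+ 2.
have K0 : 0 <= K by rewrite divr_ge0 ?opnorm_ge0 ?exprn_ge0 ?ltW.
have aux (x y : R) : 0 <= y -> x <= y + y -> x + 2^-1 * y <= 3 * y by lra.
have [v0 [_ hv0]] := irreducible_step (r 0%N) pphi u0 ltr01.
pose P n v := state_norm dot phi (v * u - r n) <= (2 ^+ n)^-1.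
(* The factor 3 covers twice [(2 ^+ n)^-1], the size of the defect [r n.+1 - v * u], plus the step
   tolerance [(2 ^+ n.+1)^-1]. *)
pose Q n v v' := opnorm (v' - v) <= 3 * K / 2 ^+ n.
have P0 : P 0%N v0 by rewrite /P expr0 invr1.
have [n v Pv|v [v0E hP hQ]] := @dependent_choice_nat _ P Q v0 P0.
  have e0 : 0 < (2 ^+ n.+1)^-1 :> R by rewrite invr_gt0 exprn_gt0.
  have [d [d1 d2]] := irreducible_step (r n.+1 - v * u) pphi u0 e0.
  exists (v + d); split.
    rewrite /P; have -> // : (v + d) * u - r n.+1 = d * u - (r n.+1 - v * u).
    by rewrite mulrDl opprB addrA [d * u + _]addrC.
  rewrite /Q addrC addKr; apply: le_trans d1 _.
  have -> : 3 * K / 2 ^+ n = K * (3 / 2 ^+ n) by rewrite mulrAC mulrC.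
  rewrite -/K; apply: ler_wpM2l => //.
  have h1 : state_norm dot phi (r n.+1 - v * u) <= (2 ^+ n)^-1 + (2 ^+ n)^-1.
    apply: le_trans (state_norm_triangle normE he p (r n) _ _) _.
    by apply: lerD; [exact: hr|rewrite (state_normC normE he); exact: Pv].
  move: h1; rewrite exprS invfM.
  by apply: aux; rewrite invr_ge0 exprn_ge0.
have K30 : 0 <= 3 * K by rewrite mulr_ge0.
have [V hV] := bop_norm_complete K30 hQ.
exists V, (1 + 2 * (3 * K) * state_norm dot phi u) => n.
apply: le_trans (state_norm_triangle normE he p (v n * u) _ _) _.
rewrite mulrDl mul1r lerD//; first by rewrite (state_normC normE he); exact: hP.
rewrite -mulrBl; apply: le_trans (state_normM normE he p _ _) _.
rewrite mulrAC ler_wpM2r ?state_norm_ge0// -opnormN opprB; exact: hV.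
Qed.

Lemma pure_irreducible phi u w : pure_state dot phi -> 0 < state_norm dot phi u ->
  exists v, state_norm dot phi (v * u - w) = 0.
Proof.
move=> pphi u0; have [n|v [M hv]] := @irreducible_limit phi u (fun=> w) pphi u0.
  by rewrite subrr (state_norm0 dot) invr_ge0 exprn_ge0.
exists v; apply/eqP; rewrite eq_le state_norm_ge0 andbT.
apply/ler_addgt0Pr => eps /(small_pow2 M)[n hn]; rewrite add0r.
by apply: le_trans hn; rewrite (state_normC normE he).
Qed.

(** With [v * u] equivalent to 1, a functional [rho] below the vector state is pulled back by [v] to
    one below [phi], where purity applies. It is recovered by conjugating with [u], because
    [1 - u * v] is null for the vector state of [u] and hence for [rho]. *)
Lemma pure_vector_fun phi u : pure_state dot phi -> state_norm dot phi u = 1 ->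
  pure_state dot (vector_fun phi u).
Proof.
move=> pphi u1; have [sphi hphi] := pphi; have p := state_pos sphi.
split=> [|rho prho hrho]; first exact: vector_fun_state.
have [v hv] : exists v, state_norm dot phi (v * u - 1) = 0.
  by apply: pure_irreducible pphi _; rewrite u1.
have hvT T : re_fun (vector_fun rho v) T = re_fun (vector_fun rho v) 1 * re_fun phi T.
  move: T; apply: hphi; first exact: positive_vector_fun.
  move=> T pT; rewrite re_vector_fun; apply: le_trans (hrho _ _) _.
    exact: (pos_conj normE he).
  rewrite re_vector_fun; have := vector_fun_eq T p hv.
  by rewrite (adj1 normE he) mul1r mulr1 (adjM normE he) !mulrA => ->.
have suv : state_norm dot rho (1 - u * v) = 0.
  apply/eqP; rewrite eq_le state_norm_ge0 andbT.
  have : state_norm dot (vector_fun phi u) (1 - u * v) = 0.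
    rewrite state_norm_vector_fun; apply/eqP; rewrite eq_le state_norm_ge0 andbT.
    have -> : (1 - u * v) * u = u * (1 - v * u) by rewrite mulrBl mulrBr mul1r mulr1 mulrA.
    apply: le_trans (state_normM normE he p _ _) _.
    by rewrite (state_normC normE he) hv mulr0.
  by move=> <-; rewrite ler_wsqrtr// hrho//; exact: (pos_sqr normE he).
have rhoE T : re_fun rho T = re_fun (vector_fun rho v) 1 * re_fun (vector_fun phi u) T.
  have := vector_fun_eq T prho suv.
  rewrite (adj1 normE he) mul1r mulr1 => ->.
  rewrite [in RHS](re_vector_fun phi) -hvT.
  by rewrite re_vector_fun (adjM normE he) !mulrA.
move=> T; rewrite (rhoE T) (rhoE 1); congr (_ * _).
have -> : re_fun (vector_fun phi u) 1 = 1 by apply: (re_fun1 (vector_fun_state p u1)).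
by rewrite mulr1.
Qed.

End VectorStates.

(** * Almost orthogonal pure states *)

Section Orthogonality.
Context {R : realType} {H : completeNormedModType R[i]}.
Variable dot : {dot H for Num.conj}.
Hypothesis normE : forall x : H, `|x| ^+ 2 = dot x x.
Variable e : nat -> H.
Hypothesis he : orthonormal_basis dot e.
Implicit Types S T U X Y a b c g h u v w : 'B(H).

Local Notation adj := (adj dot).
Local Notation snorm := (state_norm dot).

Definition real_part T : 'B(H) := (2^-1)%:C *: (T + adj T).

Lemma real_part_adj T : adj (real_part T) = real_part T.
Proof. by rewrite /real_part (adjZr normE he) (adjD normE he) (adjK normE he) addrC. Qed.

Lemma re_fun_real_part phi T : positive_fun dot phi ->
  re_fun phi (real_part T) = re_fun phi T.
Proof. by move=> p; rewrite re_funZ re_funD (re_fun_adj normE he p); lra. Qed.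

Lemma cartesian_decomposition T : T = real_part T + 'i *: real_part (- 'i *: T).
Proof.
rewrite /real_part (adjZ normE he); have -> : ((- 'i)^* : R[i]) = 'i by simpc.
have h : 'i *: (- 'i *: T + 'i *: adj T) = T - adj T.
  by rewrite scalerDr !scalerA mulrN -expr2 sqr_i opprK scale1r scaleN1r.
rewrite ['i *: (_ *: _)]scalerA mulrC -scalerA h -scalerDr addrACA subrr addr0.
have -> : T + T = (2%:R : R[i]) *: T by rewrite scaler_nat mulr2n.
rewrite scalerA.
have -> : (2^-1)%:C * 2%:R = 1 :> R[i].
  by rewrite -(rmorph_nat (real_complex R)) -rmorphM mulVf.
by rewrite scale1r.
Qed.

Lemma state_fun_eq_sa (phi psi : dual 'B(H)) : positive_fun dot phi -> positive_fun dot psi ->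
  (forall T, adj T = T -> re_fun phi T = re_fun psi T) -> phi = psi.
Proof.
move=> p1 p2 h; apply: (@state_fun_eq R H) => T.
by rewrite -(re_fun_real_part T p1) -(re_fun_real_part T p2) h// real_part_adj.
Qed.

Lemma excises_mono (phi : dual 'B(H)) (bs bs' : seq 'B(H)) (eps eps' : R) g :
  {subset bs <= bs'} -> 0 <= eps' -> eps' <= eps ->
  excises dot phi bs' (eps' ^+ 2) g -> excises dot phi bs (eps ^+ 2) g.
Proof.
move=> sb e0 ee [ig h1 h2].
have e2 : eps' ^+ 2 <= eps ^+ 2 by rewrite lerXn2r ?nnegrE// (le_trans e0).
by split=> //; [exact: le_trans e2|move=> b /sb/h2 h3; exact: le_trans e2].
Qed.

(* Almost orthogonality: psi nearly vanishes on operators excising phi. *)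
Definition orthogonal_states (phi psi : dual 'B(H)) := forall (bs : seq 'B(H)) (eps : R),
  (forall b, b \in bs -> adj b = b) -> 0 < eps ->
  exists g, excises dot phi bs (eps ^+ 2) g /\ snorm psi g <= eps.

(** Choose [Y] with [Y * u] equivalent to [v]. Orthogonality makes the vector state of [u] vanish on
    [Y], so excising the real and imaginary parts of [Y] too makes [g * Y * g] small; and [g * v] is
    close to [g * Y * g * u]. *)
Lemma orthogonal_vector_states phi u v : pure_state dot phi ->
  snorm phi u = 1 -> snorm phi v = 1 -> phi (adj v * u) = 0 ->
  orthogonal_states (vector_fun dot phi u) (vector_fun dot phi v).
Proof.
move=> pphi u1 v1 uv bs eps hbs e0; have [sphi _] := pphi; have p := state_pos sphi.
have [Y hY] : exists Y, snorm phi (Y * u - v) = 0.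
  by apply: (pure_irreducible normE he v pphi); rewrite u1.
have pu := pure_vector_fun normE he pphi u1; have [su _] := pu.
have ppu := state_pos su.
have zero (r : R[i]) : re_fun phi (adj u * (r *: (Y * u - v))) = 0.
  have h0 : snorm phi (r *: (Y * u - v)) = 0 by rewrite (state_normZ normE he) hY mulr0.
  have h0' : snorm phi (- (r *: (Y * u - v))) = 0 by rewrite (state_normN normE he).
  have := state_CS normE he p (r *: (Y * u - v)) u; rewrite h0 mulr0.
  by have := state_CS normE he p (- (r *: (Y * u - v))) u; rewrite h0' mulr0 mulrN re_funN; lra.
have uvr (r : R[i]) : re_fun phi (adj u * (r *: v)) = 0.
  rewrite -(re_fun_adj normE he p) (adjM normE he) (adjK normE he) (adjZ normE he).
  by rewrite -bop_scaleAl /re_fun funZ uv mulr0.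
have Yr (r : R[i]) : re_fun (vector_fun dot phi u) (real_part (r *: Y)) = 0.
  rewrite re_fun_real_part// re_vector_fun.
  have := zero r; rewrite scalerBr mulrBr re_funB uvr subr0 => <-.
  by rewrite bop_scaleAl mulrA.
have [Y1 [Y2 [sY1 sY2 Y10 Y20 YE]]] : exists Y1 Y2, [/\ adj Y1 = Y1, adj Y2 = Y2,
    re_fun (vector_fun dot phi u) Y1 = 0, re_fun (vector_fun dot phi u) Y2 = 0 &
    Y = Y1 + 'i *: Y2].
  exists (real_part (1 *: Y)), (real_part (- 'i *: Y)).
  split; [exact: real_part_adj|exact: real_part_adj|exact: Yr|exact: Yr|].
  by rewrite scale1r -cartesian_decomposition.
(* The 2 pays for [g * Y * g * u], with [Y] split into two self-adjoint parts, and [opnorm Y] for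
   [g * Y * ((1 - g) * u)]. *)
pose K := 2 + opnorm Y.
have K0 : 2 <= K by rewrite lerDl opnorm_ge0.
have K0' : 0 < K by apply: lt_le_trans K0.
pose eta := Num.min 1 (Num.min eps (eps / K)).
have eta0 : 0 < eta by rewrite !lt_min ltr01 e0 divr_gt0.
have eta1 : eta <= 1 by rewrite ge_min lexx.
have eta_eps : eta <= eps by rewrite !ge_min lexx orbT.
have etaK : eta * K <= eps by rewrite -ler_pdivlMr// !ge_min lexx !orbT.
have hbs' b : b \in [:: Y1, Y2 & bs] -> adj b = b.
  rewrite 2!in_cons => /orP[/eqP ->//|/orP[/eqP ->//|/hbs//]].
have [g exc] := pure_excision normE he pu hbs' (exprn_gt0 2 eta0).
exists g; split.
  apply: excises_mono (ltW eta0) eta_eps exc.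
  by move=> b bbs; rewrite in_cons; apply/orP; right; rewrite in_cons; apply/orP; right.
have s1g := excises_compl normE he su (ltW eta0) exc.
have [ig _ hb] := exc.
have g1 := unit_interval_opnorm normE he ig.
have gYg : opnorm (g * Y * g) <= 2 * eta.
  have h1 := hb Y1 (mem_head _ _).
  have h2 : opnorm (g * Y2 * g - (re_fun (vector_fun dot phi u) Y2)%:C *: (g * g)) <= eta ^+ 2.
    by apply: hb; rewrite in_cons; apply/orP; right; exact: mem_head.
  move: h1 h2; rewrite Y10 Y20 !scale0r !subr0 => h1 h2.
  have -> : g * Y * g = g * Y1 * g + 'i *: (g * Y2 * g).
    rewrite YE mulrDr mulrDl.
    by rewrite -bop_scaleAr -bop_scaleAl.
  apply: le_trans (opnormD _ _) _; rewrite opnormZ normc_def /= expr0n expr1n add0r sqrtr1 mul1r.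
  have : eta ^+ 2 <= eta by rewrite expr2 ler_piMr// ltW.
  lra.
rewrite (state_norm_vector_fun normE he).
have -> : g * v = (g * Y * g * u + g * Y * ((1 - g) * u)) - g * (Y * u - v).
  rewrite -mulrA -mulrDr -mulrDl subrKC mul1r mulrBr mulrA opprB subrKC.
  by [].
apply: le_trans (state_normB normE he p _ _) _.
have h0 : snorm phi (g * (Y * u - v)) <= 0.
  by apply: le_trans (state_normM normE he p _ _) _; rewrite hY mulr0.
have h1 : snorm phi (g * Y * g * u) <= 2 * eta.
  by apply: le_trans (state_normM normE he p _ _) _; rewrite u1 mulr1.
have h2 : snorm phi (g * Y * ((1 - g) * u)) <= opnorm Y * eta.
  apply: le_trans (state_normM normE he p _ _) _.
  apply: ler_pM; rewrite ?opnorm_ge0 ?state_norm_ge0//; last first.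
    by rewrite -(state_norm_vector_fun normE he).
  by apply: le_trans (opnormM _ _) _; rewrite ler_piMl ?opnorm_ge0.
have := state_normD normE he p (g * Y * g * u) (g * Y * ((1 - g) * u)).
by move: etaK; rewrite /K; lra.
Qed.

End Orthogonality.

(** * Pure states that are not almost orthogonal are equivalent *)

Section NonOrthogonal.
Context {R : realType} {H : completeNormedModType R[i]}.
Variable dot : {dot H for Num.conj}.
Hypothesis normE : forall x : H, `|x| ^+ 2 = dot x x.
Variable e : nat -> H.
Hypothesis he : orthonormal_basis dot e.
Implicit Types S T U X Y a b c g h u v w : 'B(H).
Implicit Types (bs : seq 'B(H)).

Local Notation pos := (positive_op dot).
Local Notation adj := (adj dot).
Local Notation snorm := (state_norm dot).

Definition all_sa bs := forall b, b \in bs -> adj b = b.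

Lemma all_sa_cat bs bs' : all_sa bs -> all_sa bs' -> all_sa (bs ++ bs').
Proof. by move=> h h' b; rewrite mem_cat => /orP[/h|/h']. Qed.

Lemma all_sa1 b : adj b = b -> all_sa [:: b].
Proof. by move=> sb b'; rewrite inE => /eqP ->. Qed.

(** Excising [(1 - g) * (1 - g)] by [g'] makes [(1 - g) * g'] small in norm, so [g'] lies almost
    under [g]. Then the squared distance is at most [snorm psi g ^+ 2 - snorm psi g' ^+ 2] up to a
    small error, and near a common value [l] this is small. *)
Lemma excised_close (phi psi : dual 'B(H)) bs bs' (eta eta' l tau : R) g g' :
  is_state dot phi -> is_state dot psi ->
  0 <= eta -> 0 <= eta' -> 0 <= tau ->
  excises dot phi bs (eta ^+ 2) g -> excises dot phi bs' (eta' ^+ 2) g' ->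
  (1 - g) * (1 - g) \in bs' ->
  snorm psi g <= l + tau -> l - tau <= snorm psi g' ->
  snorm psi (g - g') ^+ 2 <= 4 * tau + 2 * (eta + eta').
Proof.
have sqr_num (x y r r1 z : R) : 0 <= x -> 0 <= y -> x <= 1 -> y <= 1 -> 0 <= tau ->
    x - y <= 2 * tau -> y ^+ 2 <= r -> r1 <= z ->
    x ^+ 2 + y ^+ 2 - 2 * (r - r1) <= 4 * tau + 2 * z.
  move=> x0 y0 x1 y1 t0 xy yr rz; suff : x ^+ 2 - y ^+ 2 <= 4 * tau by lra.
  rewrite subr_sqr; have [le0|gt0] := lerP (x - y) 0.
    by apply: (@le_trans _ _ 0); [rewrite mulr_le0_ge0// addr_ge0|rewrite mulr_ge0].
  apply: (@le_trans _ _ (2 * tau * 2)); last by lra.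
  by apply: ler_pM; [exact: ltW|exact: addr_ge0|lra|lra].
move=> sphi spsi eta0 eta0' tau0 exc exc' hin hg hg'.
have p := state_pos spsi.
have [ig _ _] := exc; have [ig' _ _] := exc'.
have sg := unit_interval_adj normE he ig; have sg' := unit_interval_adj normE he ig'.
have sg1 : adj (1 - g) = 1 - g := unit_interval_adj normE he (unit_intervalC ig).
have d : opnorm ((1 - g) * g') <= eta + eta'.
  have := excises_opnorm normE he sphi eta0' exc' (a := 1 - g); rewrite sg1 => /(_ hin).
  move=> /le_trans; apply; rewrite lerD2r; exact: (excises_compl normE he sphi eta0 exc).
have rd : re_fun psi ((1 - g) * g') <= eta + eta'.
  exact: le_trans (re_fun_le_opnorm normE he spsi _) d.
have e1 : re_fun psi (g * g') = re_fun psi g' - re_fun psi ((1 - g) * g').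
  by rewrite -re_funB mulrBl mul1r subKr.
have e2 : re_fun psi (g' * g) = re_fun psi (g * g').
  by rewrite -(re_fun_adj normE he p) (adjM normE he) sg sg'.
have e3 : snorm psi g' ^+ 2 <= re_fun psi g'.
  rewrite (state_norm_sqr normE he p) sg'; apply: (re_fun_le p).
  have := pos_mul_compl normE he ig'; by rewrite mulrBr mulr1.
have e4 : snorm psi (g - g') ^+ 2 = snorm psi g ^+ 2 + snorm psi g' ^+ 2
    - 2 * re_fun psi (g * g').
  rewrite !(state_norm_sqr normE he p) (adjB normE he) sg sg' mulrBl !mulrBr !re_funB e2.
  by clear; lra.
have n1 (k : 'B(H)) : unit_interval dot k -> snorm psi k <= 1.
  move=> ik; apply: le_trans (state_norm_le_opnorm normE he spsi k) _.
  exact: (unit_interval_opnorm normE he ik).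
have h1 := n1 _ ig; have h2 := n1 _ ig'.
have h3 : snorm psi g - snorm psi g' <= 2 * tau.
  by move: hg hg'; clear; move: (snorm _ _) (snorm _ _) => x y; lra.
rewrite e4 e1; apply: sqr_num => //; exact: state_norm_ge0.
Qed.

(** Elements excising [phi] that nearly minimize [snorm psi] form a Cauchy sequence; its limit [a]
    plays the part of the support of [phi] applied to the GNS vector of [psi]. Excision gives
    [psi (adj a * T * a) = c ^+ 2 * phi T], failure of orthogonality gives [c != 0], and
    transitivity inverts [a]. *)
Theorem not_orthogonal_vector_state (phi psi : dual 'B(H)) :
  pure_state dot phi -> pure_state dot psi -> ~ orthogonal_states dot phi psi ->
  exists v, psi = vector_fun dot phi v.
Proof.
have num22 : 2 ^+ 2 = 4 :> R by rewrite expr2; lra.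
have num_tau (d t r : R) : d <= t -> r <= t -> 0 < t ->
    4 * t + 2 * (r + d) <= 16 * t by lra.
have num_fin (x y z t r c2 A B E : R) : `|x - y| <= A -> `|y - r * z| <= E ->
    `|z - c2| <= B -> `|x - r * c2| <= A + E + `|r| * B.
  move=> h1 h2 h3; have -> : x - r * c2 = (x - y) + (y - r * z) + r * (z - c2) by ring.
  apply: le_trans (ler_normD _ _) _; apply: lerD.
    by apply: le_trans (ler_normD _ _) _; apply: lerD.
  by rewrite normrM ler_wpM2l.
have num_c (k t r d x y z : R) : 0 < k / 2 -> k - t <= r -> r <= d + x -> t <= y ->
  d <= z -> z + y <= k / 2 -> 0 < x by lra.
move=> pphi ppsi northo.
have [sphi _] := pphi; have [spsi _] := ppsi.
have p := state_pos sphi; have q := state_pos spsi.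
have [bs0 [eps0 [hbs0 e00 h0]]] : exists bs0 (eps0 : R), [/\ all_sa bs0, 0 < eps0 &
    forall g, excises dot phi bs0 (eps0 ^+ 2) g -> eps0 < snorm psi g].
  apply: contrapT => hn; apply: northo => bs eps hbs e0; apply: contrapT => hn'.
  apply: hn; exists bs, eps; split=> // g exc; rewrite ltNge; apply/negP => hg.
  by apply: hn'; exists g.
(* [L] collects the values that remain attainable for every list and every tolerance; its infimum
   [l] is the limiting minimum of [snorm psi] under ever finer excision. *)
pose L := [set l : R | 0 <= l /\ forall bs (eps : R), all_sa bs -> 0 < eps ->
  exists g, excises dot phi bs (eps ^+ 2) g /\ snorm psi g <= l].
have L1 : L 1.
  split=> // bs eps hbs eps_gt0.
  have [g exc] := pure_excision normE he pphi hbs (exprn_gt0 2 eps_gt0).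
  exists g; split=> //; apply: le_trans (state_norm_le_opnorm normE he spsi g) _.
  by case: exc => ig _ _; exact: (unit_interval_opnorm normE he ig).
have L_inf : has_inf L by split; [exists 1|exists 0 => l []].
pose l := inf L.
have l_ge : eps0 <= l.
  apply: lb_le_inf => [|x [x0 /(_ _ _ hbs0 e00)[g [/h0 h1 h2]]]]; first by exists 1.
  exact: ltW (lt_le_trans h1 h2).
have l_le : l <= 1 by apply: (ge_inf L_inf.2).
have near (tau : R) bs (eps : R) : 0 < tau -> all_sa bs -> 0 < eps ->
    exists g, excises dot phi bs (eps ^+ 2) g /\ snorm psi g <= l + tau.
  move=> tau0 hbs eps_gt0; have [x [_ hx] xl] := inf_adherent tau0 L_inf.
  have [g [exc hg]] := hx _ _ hbs eps_gt0; exists g; split=> //.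
  exact: le_trans hg (ltW xl).
(* Chosen so that [16 * tau n] is the square of [(2 ^+ n)^-1], which leaves room for
   [4 * tau n + 2 * (eta + dl n)] in [excised_close]. *)
pose tau n : R := (16 * 4 ^+ n)^-1.
have tau_gt0 n : 0 < tau n by rewrite invr_gt0 mulr_gt0// exprn_gt0.
(* Otherwise [l - tau n] would lie in [L]. The list and tolerance [D n] thus force every excising
   element to be nearly minimal from below. *)
have far n : exists z : seq 'B(H) * R, [/\ all_sa z.1, 0 < z.2 &
    forall g, excises dot phi z.1 (z.2 ^+ 2) g -> l - tau n <= snorm psi g].
  apply: contrapT => hn.
  have hL : forall bs (eps : R), all_sa bs -> 0 < eps ->
      exists g, excises dot phi bs (eps ^+ 2) g /\ snorm psi g <= l - tau n.
    move=> bs eps hbs eps_gt0; apply: contrapT => hn'; apply: hn; exists (bs, eps).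
    split=> //= g exc; rewrite leNgt; apply/negP => hg; apply: hn'.
    by exists g; split=> //; exact: ltW.
  have [g [_ hg]] := hL _ _ hbs0 e00.
  have : L (l - tau n) by split=> //; exact: le_trans (state_norm_ge0 dot psi g) hg.
  by move=> /(ge_inf L_inf.2); rewrite -/l lerBrDl gerDr leNgt tau_gt0.
have [D hD] := choice far.
pose dl n : R := Num.min (D n).2 (tau n).
have dl0 n : 0 < dl n by rewrite lt_min tau_gt0 andbT; case: (hD n).
have dlD n : dl n <= (D n).2 by rewrite ge_min lexx.
have dltau n : dl n <= tau n by rewrite ge_min lexx orbT.
have tau_dec n : tau n.+1 <= tau n.
  rewrite lef_pV2 ?posrE ?mulr_gt0 ?exprn_gt0// ler_wpM2l// exprS ler_peMl//.
  by rewrite ler1n.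
have close n g g' (eta : R) bs bs' : eta <= tau n -> 0 <= eta ->
    excises dot phi bs (eta ^+ 2) g -> snorm psi g <= l + tau n ->
    excises dot phi ((D n).1 ++ (1 - g) * (1 - g) :: bs') (dl n ^+ 2) g' ->
    snorm psi (g' - g) <= (2 ^+ n)^-1.
  move=> etatau eta0 exc hg exc'.
  have hg' : l - tau n <= snorm psi g'.
    have [_ _ h] := hD n; apply: h; apply: excises_mono (ltW (dl0 n)) (dlD n) exc'.
    by move=> b hb; rewrite mem_cat hb.
  have hin : (1 - g) * (1 - g) \in (D n).1 ++ (1 - g) * (1 - g) :: bs'.
    by rewrite mem_cat mem_head orbT.
  have := excised_close sphi spsi eta0 (ltW (dl0 n)) (ltW (tau_gt0 n)) exc exc' hin hg hg'.
  rewrite (state_normC normE he) => h.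
  rewrite -(@ler_pXn2r _ 2)// ?nnegrE ?state_norm_ge0 ?invr_ge0 ?exprn_ge0//.
  apply: le_trans h _; rewrite exprVn -exprM mulnC exprM.
  rewrite num22; have -> : (4 ^+ n)^-1 = 16 * tau n by rewrite /tau invfM mulrA divff// mul1r.
  exact: num_tau (dltau n) etatau (tau_gt0 n).
pose P n g := exists2 bs, excises dot phi bs (dl n ^+ 2) g & snorm psi g <= l + tau n.
pose Q n g g' := snorm psi (g' - g) <= (2 ^+ n)^-1.
have [g0 [exc0 hg0]] := near (tau 0%N) [::] (dl 0%N) (tau_gt0 _) (fun b => ltac:(by [])) (dl0 _).
have P0 : P 0%N g0 by exists [::].
have [n g [bs exc hg]|gs [_ hP hQ]] := @dependent_choice_nat _ P Q g0 P0.
  have [ig _ _] := exc.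
  have sg1 : adj (1 - g) = 1 - g := unit_interval_adj normE he (unit_intervalC ig).
  have sgg : adj ((1 - g) * (1 - g)) = (1 - g) * (1 - g) by rewrite (adjM normE he) sg1.
  pose bs' := (D n).1 ++ (1 - g) * (1 - g) :: [::].
  have hbs' : all_sa bs'.
    by apply: all_sa_cat; [case: (hD n)|exact: all_sa1].
  (* The tolerance at [n] gives closeness to the previous element, the one at [n.+1] restores the
     invariant. *)
  have m0 : 0 < Num.min (dl n) (dl n.+1) by rewrite lt_min !dl0.
  have [g' [exc' hg']] := near _ _ _ (tau_gt0 n.+1) hbs' m0.
  exists g'; split.
    exists bs' => //; apply: excises_mono exc'; rewrite ?(ltW m0)//.
    by rewrite ge_min lexx orbT.
  apply: (close n g g' (dl n) bs [::] (dltau n) (ltW (dl0 n)) exc hg).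
  by apply: excises_mono exc'; rewrite ?(ltW m0)// ge_min lexx.
have s1 : 0 < snorm psi 1 by rewrite (state_norm1 normE he spsi).
have [a [M hM]] := irreducible_limit normE he ppsi s1 hQ.
have {}hM n : snorm psi (gs n - a) <= M / 2 ^+ n by have := hM n; rewrite mulr1.
have M0 : 0 <= M.
  by have := le_trans (state_norm_ge0 dot psi _) (hM 0%N); rewrite expr0 divr1.
(* An arbitrary further list can be excised without leaving the neighbourhood of [a]; this makes [a]
   independent of the operator [T] tested in [key]. *)
have refine n bs' : all_sa bs' -> exists g, 
    excises dot phi bs' (dl n ^+ 2) g /\ snorm psi (g - a) <= (M + 1) / 2 ^+ n.
  move=> hbs'; have [bs exc hg] := hP n; have [ig _ _] := exc.
  have sg1 : adj (1 - gs n) = 1 - gs n := unit_interval_adj normE he (unit_intervalC ig).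
  have sgg : adj ((1 - gs n) * (1 - gs n)) = (1 - gs n) * (1 - gs n).
    by rewrite (adjM normE he) sg1.
  have hb : all_sa ((D n).1 ++ [:: (1 - gs n) * (1 - gs n)] ++ bs').
    apply: all_sa_cat; [by case: (hD n)|].
    by apply: all_sa_cat => //; exact: all_sa1.
  have [g [exc' _]] := near _ _ _ (tau_gt0 n) hb (dl0 n).
  exists g; split.
    apply: excises_mono exc'; rewrite ?(ltW (dl0 n))//.
    by move=> b hb'; rewrite mem_cat; apply/orP; right; rewrite in_cons hb' orbT.
  have h1 := close n (gs n) g (dl n) bs bs' (dltau n) (ltW (dl0 n)) exc hg exc'.
  apply: le_trans (state_norm_triangle normE he q (gs n) _ _) _.
  by rewrite mulrDl mul1r addrC lerD.
have tau_pow n : tau n <= (2 ^+ n)^-1.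
  rewrite lef_pV2 ?posrE ?mulr_gt0 ?exprn_gt0//.
  apply: (@le_trans _ _ (4 ^+ n)); first by rewrite lerXn2r ?nnegrE ?ler_nat.
  by rewrite ler_peMl ?exprn_ge0// ler1n.
have pow_le1 n : (2 ^+ n)^-1 <= 1 :> R.
  by rewrite invf_le1 ?exprn_gt0// exprn_ege1// ler1n.
pose c := snorm psi a.
have c0 : 0 < c.
  have l2 : 0 < l / 2 by rewrite divr_gt0//; exact: lt_le_trans l_ge.
  have [n hn] := small_pow2 (M + 2) l2.
  have [hDn _ hDg] := hD n; have [g [exc hga]] := refine n _ hDn.
  have h1 : l - tau n <= snorm psi g.
    by apply: hDg; apply: excises_mono (ltW (dl0 n)) (dlD n) exc.
  have h2 : snorm psi g <= snorm psi (g - a) + c.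
    by rewrite -{1}[g](subrK a); exact: (state_normD normE he q).
  apply: (num_c _ _ _ _ _ _ _ l2 h1 h2 (tau_pow n) hga).
  by apply: le_trans hn; rewrite -[X in _ + X]mul1r -mulrDl -addrA.
have key T : adj T = T -> re_fun psi (adj a * T * a) = c ^+ 2 * re_fun phi T.
  move=> sT; apply/eqP; rewrite -subr_eq0 -normr_le0.
  pose K := opnorm T * (1 + c) * (M + 1) + 1 + `|re_fun phi T| * ((1 + c) * (M + 1)).
  apply/ler_addgt0Pr => eps /(small_pow2 K)[n hn]; rewrite add0r.
  apply: le_trans hn; have [g [exc hga]] := refine n _ (all_sa1 sT).
  have [ig _ hb] := exc; have sg := unit_interval_adj normE he ig.
  have sg1 : snorm psi g <= 1.
    apply: le_trans (state_norm_le_opnorm normE he spsi g) _.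
    exact: (unit_interval_opnorm normE he ig).
  have dist X : `|re_fun psi (adj a * X * a) - re_fun psi (g * X * g)| <=
      opnorm X * (1 + c) * (M + 1) / 2 ^+ n.
    have aux (x y z : R) : x <= opnorm X * y * z -> y <= 1 + c -> 0 <= y ->
        z <= (M + 1) / 2 ^+ n -> 0 <= z -> x <= opnorm X * (1 + c) * (M + 1) / 2 ^+ n.
      move=> h hy y0 hz z0; apply: le_trans h _; rewrite -[leRHS]mulrA.
      by apply: ler_pM; rewrite ?mulr_ge0 ?opnorm_ge0// ler_wpM2l ?opnorm_ge0.
    have yle : c + snorm psi g <= 1 + c by rewrite addrC lerD2r.
    have y0 : 0 <= c + snorm psi g by rewrite addr_ge0 ?state_norm_ge0.
    have hag : snorm psi (a - g) <= (M + 1) / 2 ^+ n by rewrite (state_normC normE he).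
    rewrite -[X in re_fun _ (X * _ * _) - _]/(adj a) -{1}sg ler_norml lerNl opprB.
    apply/andP; split.
      have := vector_fun_dist normE he X g a q => /aux; apply=> //.
        by rewrite addrC.
      by rewrite addrC.
      exact: state_norm_ge0.
    have := vector_fun_dist normE he X a g q => /aux; apply=> //.
    exact: state_norm_ge0.
  have h2 : `|re_fun psi (g * T * g) - re_fun phi T * re_fun psi (g * g)| <= (2 ^+ n)^-1.
    rewrite -re_funZ -re_funB; apply: le_trans (abs_re_fun normE he spsi _) _.
    apply: le_trans (state_norm_le_opnorm normE he spsi _) _.
    apply: le_trans (hb T (mem_head _ _)) _.
    apply: (@le_trans _ _ (dl n)).
      rewrite expr2 ler_piMr ?(ltW (dl0 n))//.
      exact: le_trans (dltau n) (le_trans (tau_pow n) (pow_le1 n)).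
    exact: le_trans (dltau n) (tau_pow n).
  have h3 : `|re_fun psi (g * g) - c ^+ 2| <= (1 + c) * (M + 1) / 2 ^+ n.
    rewrite distrC /c (state_norm_sqr normE he q).
    have := dist (1 : 'B(H)); rewrite !mulr1 => /le_trans; apply.
    rewrite -!mulrA ler_piMl ?opnorm1_le// !mulr_ge0 ?invr_ge0 ?exprn_ge0 ?addr_ge0//.
    exact: ltW.
  have := num_fin _ _ _ 0 _ _ _ _ _ (dist T) h2 h3.
  rewrite [_ ^+ 2 * _]mulrC; move/le_trans; apply; rewrite /K le_eqVlt.
  by apply/orP; left; apply/eqP; clear; move: (2 ^+ n)^-1 => w; ring.
(* So far the normalized vector functional of [a] over [psi] is [phi]; a left inverse of [a] modulo
   null vectors exchanges the roles of the two states. *)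
have [v hv] : exists v, snorm psi (v * a - 1) = 0.
  exact: (pure_irreducible normE he 1 ppsi c0).
exists (c%:C *: v); apply: (state_fun_eq_sa normE he q).
  exact: (positive_vector_fun normE he).
move=> T sT; rewrite re_vector_fun (adjZr normE he) -!bop_scaleAl -bop_scaleAr scalerA.
rewrite -rmorphM -expr2 re_funZ -key; last first.
  by rewrite !(adjM normE he) (adjK normE he) sT mulrA.
have := vector_fun_eq normE he T q hv; rewrite (adj1 normE he) mul1r mulr1 => <-.
by rewrite (adjM normE he) !mulrA.
Qed.

End NonOrthogonal.

(** * The finite-dimensional case *)

Section UniformDecrease.
Context {R : realType} {H : completeNormedModType R[i]}.
Variable dot : {dot H for Num.conj}.
Hypothesis normE : forall x : H, `|x| ^+ 2 = dot x x.
Variable e : nat -> H.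
Hypothesis he : orthonormal_basis dot e.
Implicit Types S T U X Y a b c g h k u v w : 'B(H).

Local Notation adj := (adj dot).
Local Notation snorm := (state_norm dot).

Fixpoint iterated_product (k : nat -> 'B(H)) n : 'B(H) :=
  if n is m.+1 then k m * iterated_product k m else 1.

Variable F : set (dual 'B(H)).
Hypothesis stF : forall phi, F phi -> is_state dot phi.

(** For a single state the numbers [snorm phi (iterated_product k n) ^+ 2] decrease within the unit
    interval, so some [n] always works; the content is that one [n] serves all of [F]. *)
Definition uniformly_decreasing := forall k : nat -> 'B(H),
  (forall n, opnorm (k n) <= 1) -> forall eps : R, 0 < eps -> exists n, forall phi, F phi ->
  snorm phi (iterated_product k n) ^+ 2 < snorm phi (iterated_product k n.+1) ^+ 2 + eps.

(** The form used for contradictions: an invariant that can always be continued with a drop of [eps]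
    at some state would, by dependent choice, produce a forbidden sequence of contractions. *)
Lemma uniformly_decreasing_step (P : 'B(H) -> Prop) (eps : R) : uniformly_decreasing ->
  0 < eps -> P 1 -> ~ (forall c, P c -> exists k, [/\ opnorm k <= 1, P (k * c) &
    exists psi, F psi /\ snorm psi (k * c) ^+ 2 + eps <= snorm psi c ^+ 2]).
Proof.
move=> dec e0 P1 h.
pose Q (n : nat) c c' := exists k, [/\ opnorm k <= 1, c' = k * c &
    exists psi, F psi /\ snorm psi c' ^+ 2 + eps <= snorm psi c ^+ 2].
have [n c /h[k [k1 Pkc hpsi]]|f [f0 _ hQ]] := @dependent_choice_nat _ (fun=> P) Q 1 P1.
  by exists (k * c); split=> //; exists k.
have [k hk] := choice hQ.
have k1 n : opnorm (k n) <= 1 by case: (hk n).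
have fE n : f n = iterated_product k n.
  by elim: n => [|n IH] //=; have [_ -> _] := hk n; rewrite IH.
have [n hn] := dec k k1 _ e0; have [_ _ [psi [Fpsi hpsi]]] := hk n.
have := hn _ Fpsi; rewrite -!fE => /lt_le_trans/(_ hpsi).
by rewrite ltxx.
Qed.

(** If no single [g] works, there is always a next state [psi] on which the current product is still
    large. Orthogonality yields an excising [g] that is small on this [psi], and multiplying by it
    causes a definite drop while the product stays close to 1 for [phi]. *)
Lemma uniform_separation (phi : dual 'B(H)) (eta : R) : uniformly_decreasing ->
  pure_state dot phi -> 0 < eta -> exists g, [/\ unit_interval dot g,
    snorm phi (1 - g) <= eta &
    forall psi, F psi -> orthogonal_states dot phi psi -> snorm psi g <= eta].
Proof.
move=> dec pphi eta0; apply: contrapT => hn0.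
have [sphi _] := pphi; have p := state_pos sphi.
have hn g : unit_interval dot g -> snorm phi (1 - g) <= eta -> exists psi,
    [/\ F psi, orthogonal_states dot phi psi & eta < snorm psi g].
  move=> ig hg; apply: contrapT => h; apply: hn0; exists g; split=> // psi Fpsi opsi.
  by rewrite leNgt; apply/negP => hlt; apply: h; exists psi.
(* The defect and [dl] are at most [sg' = sg / 2] each, so [g * (1 - c)] has norm at most [sg]. The
   seminorm at [psi] falls from at least [7 * sg] to at most [2 * sg]. *)
pose sg := eta / 8; pose sg' := eta / 16.
have s0 : 0 < sg by rewrite divr_gt0.
have s0' : 0 < sg' by rewrite divr_gt0.
(* The invariant controls [1 - adj c], not [1 - c]: the norm of [g * (1 - c)] equals that of its
   adjoint, to which [excises_opnorm] applies with [a = adj (1 - c)]. *)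
pose P c := [/\ opnorm c <= 1, snorm phi (1 - adj c) < sg' & exists psi,
  [/\ F psi, orthogonal_states dot phi psi & eta - sg <= snorm psi c]].
have sq_le (x y : R) : 0 <= x -> x <= y -> x ^+ 2 <= y ^+ 2.
  by move=> x0 xy; rewrite lerXn2r ?nnegrE// (le_trans x0).
have num (x y : R) : eta - sg <= x -> 0 <= y -> y <= 2 * sg -> y ^+ 2 + sg ^+ 2 <= x ^+ 2.
  move=> hx y0 hy; have hx' : 7 * sg <= x by move: hx; rewrite /sg; lra.
  have h1 := sq_le _ _ y0 hy.
  have h2 := sq_le _ _ (mulr_ge0 (ler0n _ 7) (ltW s0)) hx'.
  have e1 : (2 * sg) ^+ 2 = 4 * sg ^+ 2 by ring.
  have e2 : (7 * sg) ^+ 2 = 49 * sg ^+ 2 by ring.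
  move: h1 h2; rewrite e1 e2; have := sqr_ge0 sg; clear.
  by move: (sg ^+ 2) (x ^+ 2) (y ^+ 2) => a b c; lra.
have num2 (d dl : R) : d < sg' -> dl <= sg' -> d + dl <= sg by rewrite /sg /sg'; lra.
have num3 (x y z : R) : eta < x -> x <= y + z -> z <= sg -> eta - sg <= y by lra.
have num4 (dl : R) : dl <= sg' -> dl + sg <= 2 * sg by rewrite /sg /sg' => ?; lra.
apply: (@uniformly_decreasing_step P (sg ^+ 2) dec (exprn_gt0 2 s0)).
  split; first exact: opnorm1_le.
    by rewrite (adj1 normE he) subrr state_norm0.
  have i1 : unit_interval dot 1.
    by split; [exact: (pos1 normE)|rewrite subrr; exact: pos0].
  have [psi [Fpsi opsi hpsi]] : exists psi,
      [/\ F psi, orthogonal_states dot phi psi & eta < snorm psi 1].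
    by apply: hn => //; rewrite subrr state_norm0 ltW.
  exists psi; split=> //; apply: le_trans (ltW hpsi).
  by rewrite lerBlDr lerDl ltW.
move=> c [c1 hc [psi [Fpsi opsi hpsi]]].
pose d := snorm phi (1 - adj c).
(* Half of the remaining margin [sg' - d] keeps the new defect strictly below [sg']. *)
pose dl := Num.min ((sg' - d) / 2) (Num.min sg' eta).
have dl0 : 0 < dl by rewrite !lt_min divr_gt0 ?subr_gt0//= s0' eta0.
have dl1 : dl <= (sg' - d) / 2 by rewrite ge_min lexx.
have dl2 : dl <= sg' by rewrite !ge_min lexx orbT.
have dl3 : dl <= eta by rewrite !ge_min lexx !orbT.
pose b := (1 - c) * adj (1 - c).
have sb : adj b = b by rewrite /b (adjM normE he) (adjK normE he).
have hb : forall b', b' \in [:: b] -> adj b' = b' by move=> b'; rewrite inE => /eqP ->.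
have [g [exc hg]] := opsi _ _ hb dl0.
have [ig _ _] := exc; have g1 := unit_interval_opnorm normE he ig.
have sag := unit_interval_adj normE he ig.
have s1g := excises_compl normE he sphi (ltW dl0) exc.
have hgc : opnorm (g * (1 - c)) <= sg.
  rewrite -[g * _](adjK normE he); apply: le_trans (opnorm_adj normE he _) _.
  rewrite (adjM normE he) sag.
  have := excises_opnorm normE he sphi (ltW dl0) exc (a := adj (1 - c)).
  rewrite (adjK normE he) => /(_ (mem_head _ _))/le_trans; apply.
  by rewrite (adjB normE he) (adj1 normE he); exact: num2.
have hpsi' psi' : F psi' -> snorm psi' (g * (1 - c)) <= sg.
  by move=> /stF st; apply: le_trans (state_norm_le_opnorm normE he st _) hgc.
exists g; split=> //.
  split; first by rewrite (le_trans (opnormM _ _))// mulr_ile1 ?opnorm_ge0.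
    rewrite (adjM normE he) sag.
    apply: le_lt_trans (state_norm_triangle normE he p (adj c) _ _) _.
    have : snorm phi (adj c - adj c * g) <= dl.
      have -> : adj c - adj c * g = adj c * (1 - g) by rewrite mulrBr mulr1.
      apply: le_trans (state_normM normE he p _ _) _; apply: le_trans s1g.
      rewrite ler_piMl ?state_norm_ge0//; exact: le_trans (opnorm_adj normE he c) c1.
    move: dl1 hc; rewrite -/d; clear; move: d dl (snorm _ _) => d dl x; lra.
  have [psi' [Fpsi' opsi' hpsi1]] := hn _ ig (le_trans s1g dl3).
  exists psi'; split=> //; apply: num3 hpsi1 _ (hpsi' _ Fpsi').
  have := state_normD normE he (state_pos (stF Fpsi')) (g * c) (g * (1 - c)).
  by rewrite -mulrDr addrC subrK mulr1.
exists psi; split=> //; apply: num => //; first exact: state_norm_ge0.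
have := state_normB normE he (state_pos (stF Fpsi)) g (g * (1 - c)).
rewrite {1}mulrBr mulr1 subKr => /le_trans; apply.
by apply: le_trans (num4 _ dl2); rewrite lerD// hpsi'.
Qed.

(** The operator [g] from [uniform_separation] is small on all later states simultaneously. Left
    multiplication by [1 - g] therefore nearly annihilates [phi n] and leaves the product close to 1
    on the rest of the sequence. *)
Theorem no_orthogonal_sequence (phi : nat -> dual 'B(H)) : uniformly_decreasing ->
  (forall n, F (phi n)) -> (forall n, pure_state dot (phi n)) ->
  ~ (forall i j, (i < j)%N -> orthogonal_states dot (phi i) (phi j)).
Proof.
move=> dec Fphi pphi ophi.
(* The seminorm drops from at least 7/8 to at most 1/8, and the difference of squares 48/64 exceeds
   1/2. *)
pose th : R := 8^-1.
(* Strictness of [d < th] always leaves a margin; the next error [eta] takes half of it. *)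
pose P c := opnorm c <= 1 /\ exists (n : nat) (d : R), [/\ 0 <= d, d < th &
  forall m, (n <= m)%N -> snorm (phi m) (1 - c) <= d].
have half0 : 0 < 2^-1 :> R by rewrite invr_gt0.
apply: (@uniformly_decreasing_step P 2^-1 dec half0).
  split; first exact: opnorm1_le.
  exists 0%N, 0; split=> //; first by rewrite invr_gt0.
  by move=> m _; rewrite subrr state_norm0.
move=> c [c1 [n [d [d0 dth hd]]]].
pose eta := (th - d) / 2.
have eta0 : 0 < eta by rewrite divr_gt0 ?subr_gt0.
have num1 : eta + d < th by rewrite /eta; lra.
have sq_le (x y : R) : 0 <= x -> x <= y -> x ^+ 2 <= y ^+ 2.
  by move=> x0 xy; rewrite lerXn2r ?nnegrE// (le_trans x0).
have num2 (x y : R) : 1 <= x + d -> 0 <= y -> y <= eta + d -> y ^+ 2 + 2^-1 <= x ^+ 2.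
  move=> hx y0 hy; have y1 : y <= th by apply: le_trans hy (ltW num1).
  have x1 : 7 / 8 <= x by move: hx dth; rewrite /th; lra.
  have h1 := sq_le _ _ y0 y1.
  have h2 := sq_le _ _ (divr_ge0 (ler0n R 7) (ler0n R 8)) x1.
  have e1 : th ^+ 2 = 1 / 64 :> R by rewrite /th; field.
  have e2 : (7 / 8) ^+ 2 = 49 / 64 :> R by field.
  by move: h1 h2; rewrite e1 e2; move: (x ^+ 2) (y ^+ 2) => a b; lra.
have [g [ig hg1 hg2]] := uniform_separation dec (pphi n) eta0.
have kc1 : opnorm (1 - g) <= 1 := unit_interval_opnorm normE he (unit_intervalC ig).
have bound m x : snorm (phi m) x <= eta -> (n <= m)%N ->
    snorm (phi m) (x + (1 - g) * (1 - c)) <= eta + d.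
  move=> hx nm; have pm := state_pos (stF (Fphi m)).
  apply: le_trans (state_normD normE he pm _ _) _; apply: lerD => //.
  apply: le_trans (state_normM normE he pm _ _) _.
  by apply: le_trans (hd _ nm); rewrite ler_piMl ?state_norm_ge0.
exists (1 - g); split=> //.
  split; first by rewrite (le_trans (opnormM _ _))// mulr_ile1 ?opnorm_ge0.
  exists n.+1, (eta + d); split=> //; first by rewrite addr_ge0 ?(ltW eta0).
  move=> m nm; have -> : 1 - (1 - g) * c = g + (1 - g) * (1 - c).
    by rewrite [in RHS]mulrBr mulr1 addrA subrKC.
  apply: bound; last exact: ltnW.
  by apply: hg2; [exact: Fphi|exact: ophi].
exists (phi n); split=> //.
have pn := state_pos (stF (Fphi n)).
apply: num2; rewrite ?state_norm_ge0//.
  rewrite -(state_norm1 normE he (stF (Fphi n))) -{1}[1](subrKC c).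
  apply: le_trans (state_normD normE he pn _ _) _.
  by rewrite lerD2l; exact: hd.
have -> : (1 - g) * c = (1 - g) - (1 - g) * (1 - c).
  by rewrite [(1 - g) * (1 - c)]mulrBr mulr1 subKr.
apply: le_trans (state_normB normE he pn _ _) _; apply: lerD => //.
apply: le_trans (state_normM normE he pn _ _) _.
by apply: le_trans (hd _ (leqnn n)); rewrite ler_piMl ?state_norm_ge0.
Qed.

End UniformDecrease.

(** Greedy extension: if every finite family could be prolonged, dependent choice would give an
    infinite one. Only pairs in increasing order are related, so no symmetry of [rel] is assumed. It
    serves both for states and for GNS vectors. *)
Lemma maximal_related_family (X : Type) (rel : X -> X -> Prop) :
  (forall f : nat -> X, ~ (forall i j, (i < j)%N -> rel (f i) (f j))) ->
  exists n (f : 'I_n -> X), (forall i j : 'I_n, (i < j)%N -> rel (f i) (f j)) /\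
    forall x, exists i, ~ rel (f i) x.
Proof.
move=> hf; have [[x0]|nX] := pselect (inhabited X); last first.
  have f0 (i : 'I_0) : X by case: i.
  by exists 0%N, f0; split=> [[]//|x]; case: nX.
apply: contrapT => hn.
pose good (s : seq X) := forall i j, (i < j < size s)%N -> rel (nth x0 s i) (nth x0 s j).
have ext s : good s -> exists x, good (rcons s x).
  move=> gs; apply: contrapT => hx; apply: hn.
  exists (size s), (fun i => nth x0 s i); split=> [i j ij|x].
    by apply: gs; rewrite ij ltn_ord.
  apply: contrapT => hi; apply: hx; exists x => i j; rewrite size_rcons ltnS.
  move=> /andP[ij js]; rewrite !nth_rcons (leq_trans ij js).
  move: js; rewrite leq_eqVlt => /orP[/eqP jE|js]; last by rewrite js; apply: gs; rewrite ij js.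
  rewrite jE ltnn eqxx; apply: contrapT => nr; apply: hi.
  by exists (Ordinal (leq_trans ij (eq_leq jE))).
pose P (n : nat) s := good s /\ size s = n.
pose Q (n : nat) s s' := exists x : X, s' = rcons s x.
have P0 : P 0%N [::] by split=> // i j; rewrite ltn0 andbF.
have [n s [/ext[x gx] ss]|f [_ hP hQ]] := @dependent_choice_nat _ P Q [::] P0.
  by exists (rcons s x); split; [split=> //; rewrite size_rcons ss|exists x].
have nthf m i : (i < m)%N -> nth x0 (f m) i = nth x0 (f i.+1) i.
  elim: m => // m IH; rewrite ltnS leq_eqVlt => /orP[/eqP -> //|im].
  have [x ->] := hQ m; rewrite nth_rcons; have [_ ->] := hP m.
  by rewrite im IH.
apply: (hf (fun n => nth x0 (f n.+1) n)) => i j ij.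
have [gj sj] := hP j.+1; have := gj i j; rewrite sj ij ltnSn => /(_ isT).
by rewrite (nthf j.+1 i)// ltnS ltnW.
Qed.

Section FiniteDimension.
Context {R : realType} {V : lmodType R[i]}.
Implicit Types A B : set V.

Lemma finite_dim_sub A B : A `<=` B -> in_finite_dim_subspace B -> in_finite_dim_subspace A.
Proof. by move=> AB [n [v Bv]]; exists n, v; apply: subset_trans Bv. Qed.

Lemma finite_dim0 : in_finite_dim_subspace (set0 : set V).
Proof. by exists 0%N, (fun=> 0). Qed.

Lemma finite_dimU A B : in_finite_dim_subspace A -> in_finite_dim_subspace B ->
  in_finite_dim_subspace (A `|` B).
Proof.
move=> [m [v Av]] [n [w Bw]].
exists (m + n)%N, (fun i => match fintype.split i with inl j => v j | inr k => w k end).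
move=> x [/Av[c ->]|/Bw[c ->]].
  exists (fun i => match fintype.split i with inl j => c j | inr _ => 0 end).
  rewrite big_split_ord /= [X in _ + X]big1 ?addr0 => [|i _].
    by apply: eq_bigr => i _; rewrite -[lshift _ _]/(unsplit (inl i)) unsplitK.
  by rewrite -[rshift _ _]/(unsplit (inr i)) unsplitK scale0r.
exists (fun i => match fintype.split i with inl _ => 0 | inr k => c k end).
rewrite big_split_ord /= [X in X + _]big1 ?add0r => [|i _].
  by apply: eq_bigr => i _; rewrite -[rshift _ _]/(unsplit (inr i)) unsplitK.
by rewrite -[lshift _ _]/(unsplit (inl i)) unsplitK scale0r.
Qed.

Lemma finite_dim_bigcup (n : nat) (A : 'I_n -> set V) :
  (forall i, in_finite_dim_subspace (A i)) -> in_finite_dim_subspace [set x | exists i, A i x].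
Proof.
elim: n A => [|n IH] A hA.
  by apply: finite_dim_sub finite_dim0 => x [[]].
apply: finite_dim_sub (finite_dimU (hA ord0) (IH (fun i => A (lift ord0 i)) _)) => //.
by move=> x [k]; case: (unliftP ord0 k) => [j ->|->] Ax; [right; exists j|left].
Qed.

Lemma finite_dim_finType (I : finType) (v : I -> V) :
  in_finite_dim_subspace [set x | exists c : I -> R[i], x = \sum_i c i *: v i].
Proof.
exists (#|{: I}|), (v \o enum_val); move=> x [c ->]; exists (c \o enum_val).
by rewrite (reindex _ (onW_bij _ (@enum_val_bij I))).
Qed.

End FiniteDimension.

(** * Finite dimension of the span of the pure states *)

Section PureFiniteDimension.
Context {R : realType} {H : completeNormedModType R[i]}.
Variable dot : {dot H for Num.conj}.
Hypothesis normE : forall x : H, `|x| ^+ 2 = dot x x.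
Variable e : nat -> H.
Hypothesis he : orthonormal_basis dot e.
Implicit Types S T U X Y a b c g h k u v w : 'B(H).

Local Notation adj := (adj dot).
Local Notation snorm := (state_norm dot).

Definition null_states (J : set 'B(H)) : set (dual 'B(H)) :=
  [set phi | is_state dot phi /\ forall a, J a -> snorm phi a = 0].

Lemma fun_adj (phi : dual 'B(H)) T : positive_fun dot phi -> phi (adj T) = (phi T)^*.
Proof.
move=> p; have h1 := re_fun_adj normE he p T.
have h2 := re_fun_adj normE he p ('i *: T); move: h1 h2.
rewrite (adjZ normE he) /re_fun !funZ.
have -> : ('i^* : R[i]) = - 'i by simpc.
rewrite mulNr ReN !Re_iM opprK.
case: (phi (adj T)) (phi T) => u1 v1 [u2 v2] /= -> ->.
by [].
Qed.

(** Sesquilinearity in the vector: all vector functionals from the span of [n] vectors lie in the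
    span of [n ^ 2] fixed functionals. *)
Lemma vector_fun_sum (phi : dual 'B(H)) n (c : 'I_n -> R[i]) (u : 'I_n -> 'B(H)) :
  vector_fun dot phi (\sum_i c i *: u i) =
  \sum_(p : 'I_n * 'I_n) ((c p.1)^* * c p.2) *: sandwich_fun phi (adj (u p.1)) (u p.2).
Proof.
apply/val_inj/funext => T; change (vector_fun dot phi (\sum_i c i *: u i) T =
 (\sum_(p : 'I_n * 'I_n) ((c p.1)^* * c p.2) *: sandwich_fun phi (adj (u p.1)) (u p.2)) T).
have dsum I (r : seq I) (G : I -> dual 'B(H)) :
    (\sum_(i <- r) G i) T = \sum_(i <- r) (G i T : R[i]).
  by elim: r => [|i r IH]; rewrite ?big_nil// !big_cons -IH.
have fsum I (r : seq I) (G : I -> 'B(H)) :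
    phi (\sum_(i <- r) G i) = \sum_(i <- r) (phi (G i) : R[i]).
  apply: (big_morph (fun f : 'B(H) => phi f : R[i])); first exact: funD.
  exact: (linear0 (phi : {linear 'B(H) -> R[i]^o})).
have asum : adj (\sum_i c i *: u i) = \sum_i (c i)^* *: adj (u i).
  rewrite (big_morph adj (adjD normE he) (adj0 normE he)).
  by apply: eq_bigr => i _; rewrite (adjZ normE he).
rewrite vector_funE asum dsum -(pair_bigA _ (fun i j =>
  (((c i)^* * c j) *: sandwich_fun phi (adj (u i)) (u j)) T)) /=.
rewrite !mulr_suml fsum; apply: eq_bigr => i _.
rewrite mulr_sumr fsum; apply: eq_bigr => j _.
rewrite -bop_scaleAr -!bop_scaleAl scalerA funZ.
by rewrite [c j * _]mulrC -sandwich_funE.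
Qed.

Variable J : set 'B(H).
Local Notation F := (null_states J).

Let stF phi : F phi -> is_state dot phi. Proof. by case. Qed.

Lemma null_vector_fun phi u : positive_fun dot phi -> snorm phi u = 1 ->
  (forall a, J a -> snorm phi (a * u) = 0) -> F (vector_fun dot phi u).
Proof.
move=> p u1 h; split; first exact: (vector_fun_state normE he p u1).
by move=> a Ja; rewrite (state_norm_vector_fun normE he) h.
Qed.

(** Unit vectors killed by [J] whose classes are orthogonal give almost orthogonal pure states of
    [F], so an orthogonal family of them that cannot be extended is finite. It spans all such
    vectors up to null vectors, and [vector_fun_sum] applies. *)
Lemma vector_states_finite_dim phi : uniformly_decreasing dot F -> pure_state dot phi ->
  in_finite_dim_subspace [set psi | F psi /\ exists v, psi = vector_fun dot phi v].
Proof.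
move=> dec pphi; have [sphi _] := pphi; have p := state_pos sphi.
pose X := {u : 'B(H) | snorm phi u = 1 /\ forall a, J a -> snorm phi (a * u) = 0}.
pose rel (u v : X) := phi (adj (sval v) * sval u) = 0.
have [f hf|n [f [hrel hmax]]] := @maximal_related_family X rel.
  apply: (no_orthogonal_sequence normE he stF dec
    (phi := fun n => vector_fun dot phi (sval (f n)))).
  - by move=> n; have [u1 uJ] := svalP (f n); exact: (null_vector_fun p u1 uJ).
  - by move=> n; have [u1 uJ] := svalP (f n); exact: (pure_vector_fun normE he pphi u1).
  - move=> i j ij; have [u1 _] := svalP (f i); have [v1 _] := svalP (f j).
    exact: (orthogonal_vector_states normE he pphi u1 v1 (hf _ _ ij)).
pose u i := sval (f i).
have uu i j : phi (adj (u i) * u j) = (i == j)%:R.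
  have [ij|ji|/val_inj ->] := ltngtP i j.
  - have -> : adj (u i) * u j = adj (adj (u j) * u i) by rewrite (adjM normE he) (adjK normE he).
    rewrite fun_adj// (hrel _ _ ij) conjC0.
    by case: eqP ij => // ->; rewrite ltnn.
  - by rewrite (hrel _ _ ji); case: eqP ji => // ->; rewrite ltnn.
  - rewrite eqxx; have := ge0_ReE (p _ (pos_sqr normE he (u j))) => ->.
    have [u1 _] := svalP (f j).
    by rewrite -/(re_fun phi _) -(state_norm_sqr normE he p) u1 expr1n.
apply: finite_dim_sub (finite_dim_finType
  (fun q : 'I_n * 'I_n => sandwich_fun phi (adj (u q.1)) (u q.2))) => psi [Fpsi [w psiE]].
have wJ a : J a -> snorm phi (a * w) = 0.
  by move=> Ja; rewrite -(state_norm_vector_fun normE he) -psiE; case: Fpsi => _; exact.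
pose c i := phi (adj (u i) * w); pose W := \sum_i c i *: u i.
have uW j : phi (adj (u j) * (w - W)) = 0.
  rewrite mulrBr funB /W mulr_sumr.
  have fsum (G : 'I_n -> 'B(H)) : phi (\sum_i G i) = \sum_i (phi (G i) : R[i]).
    apply: (big_morph (fun f : 'B(H) => phi f : R[i])); first exact: funD.
    exact: (linear0 (phi : {linear 'B(H) -> R[i]^o})).
  rewrite fsum (bigD1 j)//= big1 => [|i ij].
    by rewrite -bop_scaleAr funZ uu eqxx mulr1 addr0 subrr.
  by rewrite -bop_scaleAr funZ uu eq_sym (negPf ij) mulr0.
(* Otherwise the normalized Gram-Schmidt remainder is again a unit vector killed by [J] and
   orthogonal to the whole family, against maximality. *)
have w0 : snorm phi (w - W) = 0.
  apply/eqP; apply: contrapT => /negP nz.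
  have r0 : 0 < snorm phi (w - W) by rewrite lt_neqAle eq_sym nz state_norm_ge0.
  pose r := (snorm phi (w - W))^-1.
  have rC : complex.Re `|r%:C| = r by rewrite ger0_norm// ler0c invr_ge0 ltW.
  have x1 : snorm phi (r%:C *: (w - W)) = 1.
    by rewrite (state_normZ normE he) rC mulVf// gt_eqF.
  have xJ a : J a -> snorm phi (a * (r%:C *: (w - W))) = 0.
    move=> Ja; rewrite -bop_scaleAr (state_normZ normE he) mulrBr.
    suff -> : snorm phi (a * w - a * W) = 0 by rewrite mulr0.
    apply/eqP; rewrite eq_le state_norm_ge0 andbT.
    apply: le_trans (state_normB normE he p _ _) _; rewrite wJ// add0r.
    rewrite /W mulr_sumr; apply: (big_ind (fun y => snorm phi y <= 0)).
    - by rewrite state_norm0.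
    - move=> y z hy hz; apply: le_trans (state_normD normE he p _ _) _.
      by rewrite -[0]addr0 lerD.
    - move=> i _; rewrite -bop_scaleAr (state_normZ normE he).
      by have [_ uJ] := svalP (f i); rewrite /u uJ// mulr0.
  have [k] := hmax (exist _ (r%:C *: (w - W)) (conj x1 xJ)); apply; rewrite /rel /=.
  have -> : adj (r%:C *: (w - W)) * sval (f k) = adj (adj (u k) * (r%:C *: (w - W))).
    by rewrite (adjM normE he) (adjK normE he).
  by rewrite fun_adj// -bop_scaleAr funZ uW mulr0 conjC0.
exists (fun q => (c q.1)^* * c q.2); rewrite -vector_fun_sum psiE.
apply: (@state_fun_eq R H) => T; rewrite !re_vector_fun.
exact: (vector_fun_eq normE he).
Qed.

Theorem pure_states_finite_dim : uniformly_decreasing dot F ->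
  in_finite_dim_subspace [set psi | F psi /\ pure_state dot psi].
Proof.
move=> dec; pose X := {phi : dual 'B(H) | F phi /\ pure_state dot phi}.
pose rel (phi psi : X) := orthogonal_states dot (sval phi) (sval psi).
have [f hf|n [f [_ hmax]]] := @maximal_related_family X rel.
  apply: (no_orthogonal_sequence normE he stF dec (phi := fun n => sval (f n))).
  - by move=> n; case: (svalP (f n)).
  - by move=> n; case: (svalP (f n)).
  - by move=> i j; exact: hf.
have hfd i := vector_states_finite_dim dec (svalP (f i)).2.
apply: finite_dim_sub (finite_dim_bigcup hfd) => psi [Fpsi ppsi].
have [i hi] := hmax (exist _ psi (conj Fpsi ppsi)).
by exists i; split=> //; exact: (not_orthogonal_vector_state normE he (svalP (f i)).2 ppsi hi).
Qed.

End PureFiniteDimension.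

(** * Limits along ultrafilters, closed faces and extreme points *)

Section UltraLimits.
Context {R : realType}.

Lemma ultra_bounded_lim (I : Type) (U : set_system I) (f : I -> R) (M : R) :
  UltraFilter U -> (forall i, `|f i| <= M) ->
  exists l : R, forall eps, 0 < eps -> U [set i | `|f i - l| < eps].
Proof.
move=> UU fM; have fM1 i : f i <= M := le_trans (ler_norm _) (fM i).
have fM2 i : - M <= f i by have := fM i; rewrite ler_norml => /andP[].
pose S := [set r : R | U [set i | r <= f i]].
have UT A : (forall i, A i) -> U A.
  by move=> h; have -> : A = setT; [apply/seteqP; split|exact: filterT].
have S_sup : has_sup S.
  split; first by exists (- M); apply: UT.
  exists M => r Sr; rewrite leNgt; apply/negP => Mr.
  have : U set0 by apply: filterS Sr => i /= /(lt_le_trans Mr); rewrite ltNge fM1.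
  exact: filter_not_empty.
exists (sup S) => eps e0.
have [r Sr hr] := sup_adherent e0 S_sup.
have nS : ~ S (sup S + eps).
  by move=> /(sup_upper_bound S_sup); rewrite gerDl leNgt e0.
have h2 : U (~` [set i | sup S + eps <= f i]).
  by case: (in_ultra_setVsetC [set i | sup S + eps <= f i] UU).
apply: filterS (filterI Sr h2) => i [/= h3 /negP]; rewrite -ltNge => h4.
by rewrite ltr_norml; apply/andP; split; lra.
Qed.

Lemma ultra_lim_unique (I : Type) (U : set_system I) (f : I -> R) (l l' : R) :
  ProperFilter U -> (forall eps, 0 < eps -> U [set i | `|f i - l| < eps]) ->
  (forall eps, 0 < eps -> U [set i | `|f i - l'| < eps]) -> l = l'.
Proof.
move=> PU h h'; apply/eqP; apply: contrapT => /negP ne.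
have d0 : 0 < `|l - l'| / 2 by rewrite divr_gt0// normr_gt0 subr_eq0.
have [i [/= h1 h2]] := filter_ex (filterI (h _ d0) (h' _ d0)).
have := ler_distD (f i) l l'; rewrite (distrC l (f i)) => h3.
have : `|l - l'| < `|l - l'| / 2 + `|l - l'| / 2.
  by apply: le_lt_trans h3 _; rewrite ltrD.
by rewrite -splitr ltxx.
Qed.

End UltraLimits.

Section KreinMilman.
Context {R : realType} {H : completeNormedModType R[i]}.
Variable dot : {dot H for Num.conj}.
Hypothesis normE : forall x : H, `|x| ^+ 2 = dot x x.
Variable e : nat -> H.
Hypothesis he : orthonormal_basis dot e.
Implicit Types S T a : 'B(H).

Local Notation pos := (positive_op dot).
Local Notation adj := (adj dot).
Local Notation snorm := (state_norm dot).

Definition state_limit (I : Type) (U : set_system I) (phi : I -> dual 'B(H)) (psi : dual 'B(H)) :=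
  forall T (eps : R), 0 < eps -> U [set i | `|re_fun (phi i) T - re_fun psi T| < eps].

(** Weak-star compactness of the state space: the real parts converge along the ultrafilter at each
    operator, and the limits form a bounded real-linear functional to be complexified. *)
Lemma ultra_state_limit (I : Type) (U : set_system I) (phi : I -> dual 'B(H)) :
  UltraFilter U -> (forall i, is_state dot (phi i)) ->
  exists psi, is_state dot psi /\ state_limit U phi psi.
Proof.
move=> UU sphi.
have bd T i : `|re_fun (phi i) T| <= opnorm T.
  apply: le_trans (abs_re_fun normE he (sphi i) T) _.
  exact: (state_norm_le_opnorm normE he (sphi i)).
have [f hf] := choice (fun T => ultra_bounded_lim UU (bd T)).
have uniq T l : (forall eps, 0 < eps -> U [set i | `|re_fun (phi i) T - l| < eps]) -> f T = l.
  exact: ultra_lim_unique (hf T).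
have fD S T : f (S + T) = f S + f T.
  apply: uniq => eps e0; have e2 : 0 < eps / 2 by rewrite divr_gt0.
  apply: filterS (filterI (hf S _ e2) (hf T _ e2)) => i [/= h1 h2].
  rewrite re_funD opprD addrACA; apply: le_lt_trans (ler_normD _ _) _.
  by rewrite [eps]splitr ltrD.
have fZ (r : R) T : f (r%:C *: T) = r * f T.
  apply: uniq => eps e0; have e2 : 0 < eps / (`|r| + 1) by rewrite divr_gt0// ltr_wpDl.
  apply: filterS (hf T _ e2) => i /= h1.
  rewrite re_funZ -mulrBr normrM; apply: le_lt_trans (_ : `|r| * (eps / (`|r| + 1)) < _).
    by rewrite ler_wpM2l// ltW.
  by rewrite mulrCA gtr_pMr// ltr_pdivrMr ?ltr_wpDl// mul1r ltrDl.
have fM T : `|f T| <= 1 * opnorm T.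
  rewrite mul1r; apply/ler_addgt0Pr => eps e0.
  have [i /= h] := filter_ex (hf T _ e0).
  have -> : f T = re_fun (phi i) T - (re_fun (phi i) T - f T) by rewrite subKr.
  by apply: le_trans (ler_normB _ _) _; rewrite lerD// ltW.
have [psi hpsi] := dual_of_real_functional ler01 fD fZ fM.
have rE T : re_fun psi T = f T by rewrite /re_fun hpsi.
have im0 T : pos T -> f ('i *: T) = 0.
  move=> pT; apply: uniq => eps e0.
  have -> : [set i | `|re_fun (phi i) ('i *: T) - 0| < eps] = setT; last exact: filterT.
  apply/seteqP; split=> // i _ /=; rewrite subr0 /re_fun funZ Re_iM.
  by rewrite (ge0_ReE (state_pos (sphi i) pT)) /= oppr0 normr0.
exists psi; split; last by move=> T eps e0; rewrite rE; exact: hf.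
split=> [T pT|].
  rewrite hpsi lecE /= im0// oppr0 eqxx /=.
  apply/ler_addgt0Pr => eps e0; have [i /= h] := filter_ex (hf T _ e0).
  have := re_fun_ge0 (state_pos (sphi i)) pT; move: h; rewrite ltr_norml => /andP[_ h].
  by move: h; lra.
rewrite hpsi; have f1 : f 1 = 1.
  apply: uniq => eps e0.
  have -> : [set i | `|re_fun (phi i) 1 - 1| < eps] = setT; last exact: filterT.
  by apply/seteqP; split=> // i _ /=; rewrite (re_fun1 (sphi i)) subrr normr0.
by rewrite -[idop]/(1 : 'B(H)) f1 (im0 _ (pos1 normE)) oppr0.
Qed.

Definition closed_states (C : set (dual 'B(H))) := forall (U : set_system (dual 'B(H))) psi,
  UltraFilter U -> U C -> state_limit U id psi -> is_state dot psi -> C psi.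

(** The face condition in order form: if [phi] is a convex combination in which the state [rho] has
    weight [r], then [r] times [rho] is below [phi]. *)
Definition hereditary_states (C : set (dual 'B(H))) := forall phi rho (r : R),
  C phi -> is_state dot rho -> 0 < r ->
  (forall T, pos T -> r * re_fun rho T <= re_fun phi T) -> C rho.

Definition closed_face (C : set (dual 'B(H))) := [/\ C !=set0, C `<=` [set phi | is_state dot phi],
  closed_states C & hereditary_states C].

Lemma ultra_states_limit (C : set (dual 'B(H))) (U : set_system (dual 'B(H))) :
  C `<=` [set phi | is_state dot phi] -> UltraFilter U -> U C ->
  exists psi, is_state dot psi /\ state_limit U id psi.
Proof.
move=> Cst UU UC; have [phi0 C0] := filter_ex UC.
(* Non-states are replaced by a fixed state of [C], since [ultra_state_limit] takes a family made of
   states only. *)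
pose phi (x : dual 'B(H)) := if `[< is_state dot x >] then x else phi0.
have sphi x : is_state dot (phi x).
  by rewrite /phi; case: asboolP => // _; exact: Cst.
have [psi [spsi lim]] := ultra_state_limit UU sphi.
exists psi; split=> // T eps e0; apply: filterS (filterI UC (lim T _ e0)) => x [Cx /=].
by rewrite /phi; case: asboolP => // nx; case: nx; exact: Cst.
Qed.

Lemma max_face C S : closed_face C -> exists M : R,
  (forall phi, C phi -> re_fun phi S <= M) /\
  closed_face [set phi | C phi /\ re_fun phi S = M].
Proof.
move=> [[phi0 C0] Cst Ccl Cher].
pose V := [set re_fun phi S | phi in C].
have V_sup : has_sup V.
  split; first by exists (re_fun phi0 S), phi0.
  by exists (opnorm S) => _ [phi /Cst st <-]; exact: (re_fun_le_opnorm normE he).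
pose M := sup V; have leM phi : C phi -> re_fun phi S <= M.
  by move=> Cphi; apply: (sup_upper_bound V_sup); exists phi.
exists M; split=> //; split.
(* An ultrafilter finer than the filter of near-maximizers has a limit in [C], where the supremum is
   attained. *)
- pose G := [set X : set (dual 'B(H)) | exists2 eps : R, 0 < eps &
    C `&` [set phi | M - eps < re_fun phi S] `<=` X].
  have PG : ProperFilter G.
    split.
      move=> [eps e0 h]; have [_ [phi Cphi <-] hphi] := sup_adherent e0 V_sup.
      by apply: (h phi).
    split; first by exists 1.
      move=> X Y [e1 e10 h1] [e2 e20 h2]; exists (Num.min e1 e2); first by rewrite lt_min e10.
      move=> phi [Cphi /= hphi]; split; [apply: h1|apply: h2]; split=> //=;
        apply: le_lt_trans hphi; rewrite lerD2l lerN2 ge_min lexx ?orbT//.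
    by move=> X Y XY [eps e0 h]; exists eps => // phi /h /XY.
  have [U [UU GU]] := ultraFilterLemma PG.
  have UC : U C by apply: GU; exists 1 => // phi [].
  have [psi [spsi lim]] := ultra_states_limit Cst UU UC.
  exists psi; have Cpsi : C psi by apply: Ccl UC lim spsi.
  split=> //; apply/eqP; rewrite eq_le leM//=; apply/ler_addgt0Pr => eps e0.
  have e2 : 0 < eps / 2 by rewrite divr_gt0.
  have h1 : U [set phi | M - eps / 2 < re_fun phi S] by apply: GU; exists (eps / 2) => // phi [].
  have [phi [/= h2 h3]] := filter_ex (filterI h1 (lim S _ e2)).
  by move: h2 h3; rewrite ltr_norml => h2 /andP[_ h3]; lra.
- by move=> phi [/Cst].
- move=> U psi UU UCM lim spsi; have UC : U C by apply: filterS UCM => phi [].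
  split; first exact: Ccl UC lim spsi.
  apply/esym; apply: (ultra_lim_unique (f := fun phi => re_fun phi S) (U := U)); last exact: lim.
  by move=> eps e0; apply: filterS UCM => phi [_ /= ->]; rewrite subrr normr0.
- move=> phi rho r [Cphi phiM] srho r0 hr.
  have Crho := Cher _ _ _ Cphi srho r0 hr; split=> //.
  (* Lowering the weight below 1 makes the complement [rho'] well defined, with [phi] equal to [l]
     times [rho] plus [1 - l] times [rho']. Both values are at most [M] and their average is [M], so
     both equal [M]. *)
  pose l := Num.min r 2^-1.
  have l0 : 0 < l by rewrite lt_min r0 /= invr_gt0 ltr0n.
  have lr : l <= r by rewrite ge_min lexx.
  have l2 : l <= 2^-1 by rewrite ge_min lexx orbT.
  have l1 : 0 < 1 - l by lra.
  have sphi := Cst _ Cphi.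
  pose rho' : dual 'B(H) := ((1 - l)^-1)%:C *: (phi - l%:C *: rho).
  have rE T : rho' T = ((1 - l)^-1)%:C * (phi T - l%:C * rho T) by [].
  have reE T : re_fun rho' T = (1 - l)^-1 * (re_fun phi T - l * re_fun rho T).
    by rewrite /re_fun rE ReZ ReB ReZ.
  have srho' : is_state dot rho'.
    split=> [T pT|].
      rewrite rE mulr_ge0 ?ler0c ?invr_ge0 ?(ltW l1)// subr_ge0.
      rewrite (ge0_ReE (state_pos srho pT)) (ge0_ReE (state_pos sphi pT)) -rmorphM lecR.
      apply: le_trans (hr _ pT); rewrite ler_wpM2r//; exact: (re_fun_ge0 (state_pos srho)).
    rewrite rE sphi.2 srho.2 mulr1 -(rmorph1 (real_complex R)) -rmorphB -rmorphM.
    by rewrite mulVf// gt_eqF.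
  have Crho' : C rho'.
    apply: (Cher _ _ _ Cphi srho' l1) => T pT; rewrite reE mulrA divff ?gt_eqF// mul1r.
    by rewrite gerDl oppr_le0 mulr_ge0 ?(ltW l0)//; exact: (re_fun_ge0 (state_pos srho)).
  have h1 := leM _ Crho; have h2 := leM _ Crho'.
  move: h2; rewrite reE phiM ler_pdivrMl// => h2.
  apply/eqP; rewrite eq_le h1 /= -(ler_pM2l l0).
  by move: h2; rewrite mulrBl mul1r; lra.
Qed.

Lemma minimal_closed_face C0 : closed_face C0 -> exists C, [/\ closed_face C, C `<=` C0 &
  forall C', closed_face C' -> C' `<=` C -> C `<=` C'].
Proof.
move=> fC0; pose X := {C | closed_face C /\ C `<=` C0}.
pose x0 : X := exist _ C0 (conj fC0 (fun _ h => h)).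
pose Rl (a b : X) : bool := `[< sval b `<=` sval a >].
have [||A totA|[C [fC CC0]] hC] := @ZL_preorder X x0 Rl.
- by move=> t; apply/asboolP.
- by move=> r s t /asboolP rs /asboolP st; apply/asboolP; exact: subset_trans rs.
- have [A0|/set0P[a0 Aa0]] := eqVneq A set0; first by exists x0 => s; rewrite A0.
  pose C := [set phi | forall b : X, A b -> sval b phi].
  have CC (b : X) : A b -> C `<=` sval b by move=> Ab phi; apply.
  have [[_ a0st _ _] a0C0] := svalP a0.
  have fC : closed_face C.
    split.
    + pose G := [set Y : set (dual 'B(H)) | exists2 b : X, A b & sval b `<=` Y].
      have PG : ProperFilter G.
        split.
          by move=> [a Aa h]; have [[[phi aphi] _ _ _] _] := svalP a; exact: (h phi).
        split; first by exists a0.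
          move=> Y Z [a Aa aY] [b Ab bZ].
          have [/asboolP h|/asboolP h] := totA _ _ Aa Ab.
            by exists b => // phi bphi; split; [exact/aY/h|exact: bZ].
          by exists a => // phi aphi; split; [exact: aY|exact/bZ/h].
        by move=> Y Z YZ [a Aa aY]; exists a => //; exact: subset_trans YZ.
      have [U [UU GU]] := ultraFilterLemma PG.
      have Ua (b : X) : A b -> U (sval b) by move=> Ab; apply: GU; exists b.
      have [psi [spsi lim]] := ultra_states_limit a0st UU (Ua _ Aa0).
      exists psi => a Aa; have [[_ _ acl _] _] := svalP a.
      exact: acl (Ua _ Aa) lim spsi.
    + by apply: subset_trans a0st; exact: CC.
    + move=> U psi UU UC lim spsi a Aa; have [[_ _ acl _] _] := svalP a.
      by apply: acl lim spsi; apply: filterS UC; exact: CC.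
    + move=> phi rho r Cphi srho r0 hr a Aa; have [[_ _ _ aher] _] := svalP a.
      exact: aher (Cphi _ Aa) srho r0 hr.
  have CC0 : C `<=` C0 by apply: subset_trans a0C0; exact: CC.
  by exists (exist _ C (conj fC CC0)) => a Aa; apply/asboolP; exact: CC.
- exists C; split=> // C' fC' C'C.
  have C'C0 : C' `<=` C0 := subset_trans C'C CC0.
  by have := hC (exist _ C' (conj fC' C'C0)) (asboolT C'C) => /asboolP.
Qed.

(** On a minimal closed face every real part is constant, because [max_face] cuts out a closed
    subface; so the face is one state. A functional below it, once normalized, lies in the face by
    heredity and is that state, which is purity. *)
Theorem pure_state_in_face C : closed_face C -> exists2 phi, C phi & pure_state dot phi.
Proof.
move=> /minimal_closed_face[D [fD DC Dmin]]; have [[phi Dphi] Dst _ Dher] := fD.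
exists phi; first exact: DC.
have single rho : D rho -> forall T, re_fun rho T = re_fun phi T.
  move=> Drho T; have [M [_ fM]] := max_face T fD.
  have h := Dmin _ fM (fun _ h => h.1).
  by have [_ ->] := h _ Drho; have [_ ->] := h _ Dphi.
have sphi := Dst _ Dphi; split=> // rho prho hr T.
pose r := re_fun rho 1.
have r0 : 0 <= r by apply: (re_fun_ge0 prho); exact: (pos1 normE).
(* A positive functional vanishing at 1 is zero by Cauchy-Schwarz; it cannot be normalized and is
   treated apart. *)
have [rz|rnz] := eqVneq r 0.
  rewrite -/r rz mul0r.
  have s1 : snorm rho 1 = 0 by rewrite /state_norm mulr1 (adj1 normE he) -/r rz sqrtr0.
  have h1 := state_CS normE he prho T 1; have h2 := state_CS normE he prho (- T) 1.
  by move: h1 h2; rewrite s1 !mul0r (adj1 normE he) !mul1r re_funN; lra.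
have rp : 0 < r by rewrite lt_neqAle eq_sym rnz.
pose rho1 : dual 'B(H) := (r^-1)%:C *: rho.
have rE S : rho1 S = (r^-1)%:C * rho S by [].
have reE S : re_fun rho1 S = r^-1 * re_fun rho S by rewrite /re_fun rE ReZ.
have srho1 : is_state dot rho1.
  split=> [S pS|]; rewrite rE; first by rewrite mulr_ge0 ?ler0c ?invr_ge0//; exact: prho.
  rewrite (ge0_ReE (prho _ (pos1 normE : pos idop))) -/(re_fun rho idop) -[idop]/(1 : 'B(H)) -/r.
  by rewrite -rmorphM mulVf.
have D1 : D rho1.
  apply: (Dher _ _ _ Dphi srho1 rp) => S pS; rewrite reE mulrA divff// mul1r; exact: hr.
by rewrite -(single _ D1) reE mulrA divff// mul1r.
Qed.

(** Induction on [n]: if [v ord0] is not already zero on the common kernel of the others, a vector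
    [T0] of that kernel with [v ord0 T0 != 0] determines its coefficient. *)
Lemma fun_span n (v : 'I_n -> dual 'B(H)) (phi : dual 'B(H)) :
  (forall T, (forall i, v i T = 0) -> phi T = 0) -> lin_span v phi.
Proof.
elim: n v phi => [|n IH] v phi h.
  exists (fun=> 0); rewrite big_ord0; apply/val_inj/funext => T.
  by apply: h; case.
pose v' i := v (lift ord0 i).
have [hv|] := pselect (forall T, (forall i, v' i T = 0) -> v ord0 T = 0).
  have [c cE] : lin_span v' phi.
    apply: IH => T hT; apply: h => i; case: (unliftP ord0 i) => [j ->|->]; first exact: hT.
    exact: hv.
  exists (fun i => match unlift ord0 i with Some j => c j | None => 0 end).
  rewrite big_ord_recl unlift_none scale0r add0r cE; apply: eq_bigr => i _.
  by rewrite liftK.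
move=> /existsNP[T0 /not_implyP[hT0 /eqP nz]].
pose a := phi T0 / v ord0 T0.
pose phi' : dual 'B(H) := phi - a *: v ord0.
have phi'E T : phi' T = phi T - a * v ord0 T by [].
have [c cE] : lin_span v' phi'.
  apply: IH => T hT; rewrite phi'E.
  have /eqP : phi (T - (v ord0 T / v ord0 T0) *: T0) = 0.
    apply: h => i; rewrite funB funZ.
    case: (unliftP ord0 i) => [j ->|->].
      by rewrite -/(v' j) hT hT0 mulr0 subrr.
    by rewrite divfK// subrr.
  rewrite funB funZ subr_eq0 => /eqP ->; rewrite /a.
  apply/eqP; rewrite subr_eq0; apply/eqP.
  by rewrite [RHS]mulrAC [v ord0 T / _ * _]mulrAC [v ord0 T * _]mulrC.
exists (fun i => match unlift ord0 i with Some j => c j | None => a end).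
rewrite big_ord_recl unlift_none; under eq_bigr => i _ do rewrite liftK.
by rewrite -cE /phi' addrC subrK.
Qed.

Lemma null_states_face (J : set 'B(H)) : null_states dot J !=set0 ->
  closed_face (null_states dot J).
Proof.
move=> ne; split=> // [phi [] //|U psi UU UC lim spsi|phi rho r [sphi hphi] srho r0 hr].
  split=> // a Ja; have p := state_pos spsi.
  suff h : re_fun psi (adj a * a) = 0 by rewrite /state_norm h sqrtr0.
  apply/esym; apply: (ultra_lim_unique (f := fun phi => re_fun phi (adj a * a)) (U := U));
    last exact: lim.
  move=> eps e0; apply: filterS UC => phi [sphi hphi] /=.
  by rewrite -(state_norm_sqr normE he (state_pos sphi)) hphi// expr0n subrr normr0.
split=> // a Ja; have p := state_pos srho.
apply/eqP; rewrite eq_le state_norm_ge0 andbT -sqrtr0 ler_wsqrtr//.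
have := hr _ (pos_sqr normE he a).
rewrite -(state_norm_sqr normE he (state_pos sphi)) hphi// expr0n /=.
by rewrite pmulr_rle0.
Qed.

(** Convex hulls are avoided: where all [v i] vanish at [S], the maximum of [re_fun phi S] over the
    face is attained at a pure state in their span, so it is 0. Applied to [T], ['i *: T] and their
    negatives, this puts [phi] in the span by [fun_span]. *)
Theorem null_states_finite_dim (J : set 'B(H)) :
  uniformly_decreasing dot (null_states dot J) ->
  in_finite_dim_subspace (null_states dot J).
Proof.
move=> dec; have [n [v hv]] := pure_states_finite_dim normE he dec.
exists n, v => phi Fphi; apply: fun_span => T hT.
have face := null_states_face (ex_intro _ phi Fphi).
have le0 S : (forall i, v i S = 0) -> re_fun phi S <= 0.
  move=> hS; have [M [hM fM]] := max_face S face.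
  have [psi [Fpsi psiM] ppsi] := pure_state_in_face fM.
  have [c cE] := hv _ (conj Fpsi ppsi).
  suff -> : 0 = M by exact: hM.
  rewrite -psiM /re_fun cE.
  have -> : (\sum_(i < n) c i *: v i) S = \sum_(i < n) c i * v i S :> R[i].
    by elim/big_rec2: _ => // i y f _ <-.
  by rewrite big1// => i _; rewrite hS mulr0.
have eq0 S : (forall i, v i S = 0) -> re_fun phi S = 0.
  move=> hS; apply/eqP; rewrite eq_le le0//= -oppr_le0 -re_funN le0// => i.
  by rewrite funN hS oppr0.
have h1 := eq0 T hT.
have h2 : re_fun phi ('i *: T) = 0 by apply: eq0 => i; rewrite funZ hT mulr0.
move: h2; rewrite /re_fun funZ Re_iM => /eqP; rewrite oppr_eq0 => /eqP h2.
by move: h1; rewrite /re_fun; case: (phi T) h2 => a b /= -> ->.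
Qed.

End KreinMilman.

(** * The case containing a copy of betaN *)

(* Rosenthal's disjointification: split an infinite set into infinitely many
   infinite columns; if each column contains a bad index, the bad indices form a
   set whose total mass has dropped by delta. *)
Lemma disjoint_selection (R : realType) (mu : nat -> set nat -> R) (delta : R) :
  0 < delta -> (forall n M, 0 <= mu n M) -> (forall n M, mu n M <= 1) ->
  (forall n M M1 M2, M1 `<=` M -> M2 `<=` M -> M1 `&` M2 = set0 ->
    mu n M1 + mu n M2 <= mu n M) ->
  exists m : nat -> nat, injective m /\
    forall k, mu (m k) (range m `\ m k) < delta.
Proof.
move=> d0 mu0 mu1 muD; apply: contrapT => noM.
have bad (m : nat -> nat) : injective m -> exists k, delta <= mu (m k) (range m `\ m k).
  move=> im; apply: contrapT => nk; apply: noM; exists m; split=> // k.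
  by rewrite ltNge; apply/negP => h; apply: nk; exists k.
have num (j x y : R) : x <= 1 - j * delta -> y + delta <= x -> y <= 1 - (j + 1) * delta.
  by move=> h1 h2; lra.
have step j : exists m : nat -> nat, injective m /\
    forall k, mu (m k) (range m) <= 1 - j%:R * delta.
  elim: j => [|j [m [im hm]]].
    by exists id; split=> // k; rewrite mul0r subr0.
  (* [pickle] codes pairs of naturals, so [c p] enumerates the [p]-th column of [range m]. *)
  pose c (p k : nat) := m (pickle (p, k)).
  have ic p k p' k' : c p k = c p' k' -> p = p' /\ k = k'.
    by move=> /im/(pcan_inj pickleK)[].
  have [k hk] := choice (fun p => bad (c p) (fun x y h => (ic _ _ _ _ h).2)).
  exists (fun p => c p (k p)); split=> [p p' /ic[]//|p].
  rewrite -natr1; apply: num (hm (pickle (p, k p))) _.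
  apply: le_trans (muD _ (range m) (range (fun p => c p (k p))) (range (c p) `\ c p (k p)) _ _ _).
  - by rewrite lerD2l; exact: hk.
  - by move=> _ [q _ <-]; exists (pickle (q, k q)).
  - by move=> _ [[q _ <-] _]; exists (pickle (p, q)).
  - apply/seteqP; split=> // x [[q _ <-] [[q' _ /ic[-> <-]]]].
    by apply.
(* More than [delta^-1] rounds push the bound on the mass below 0. *)
have [m [_ hm]] := step (Num.truncn delta^-1).+1.
have := hm 0%N; rewrite leNgt => /negP; apply; apply: lt_le_trans (mu0 _ _).
rewrite subr_lt0 -ltr_pdivrMr// div1r.
exact: truncnS_gt.
Qed.

(** * Strong sums over sets of indices *)

Section SubSeries.
Context {R : realType} {H : completeNormedModType R[i]}.
Variable dot : {dot H for Num.conj}.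
Hypothesis normE : forall x : H, `|x| ^+ 2 = dot x x.

Local Notation pos := (positive_op dot).

Lemma pos_strong_lim (X : nat -> 'B(H)) (Y : 'B(H)) N :
  (forall x, X n x @[n --> \oo] --> Y x) -> (forall n, (N <= n)%N -> pos (X n)) -> pos Y.
Proof.
move=> XY pX.
move=> x; pose d n := hnorm (X n x - Y x) * hnorm x.
have small (a : R) : (forall n, (N <= n)%N -> a <= d n) -> a <= 0.
  move=> h; apply/ler_addgt0Pl => eps e0; rewrite addr0.
  have e1 : 0 < eps / (hnorm x + 1) by rewrite divr_gt0// ltr_wpDl// hnorm_ge0.
  have [n1 h1] := (cvg_hnormP _ _).1 (XY x) _ e1.
  apply: le_trans (h _ (leq_maxl N n1)) _.
  apply: le_trans (ler_wpM2r (hnorm_ge0 x) (ltW (h1 _ (leq_maxr N n1)))) _.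
  rewrite mulrAC ler_pdivrMr ?ltr_wpDl ?hnorm_ge0// ler_wpM2l ?(ltW e0)// lerDl.
  exact: ler01.
have dXY n (z : R[i]) : `|z| = 1 -> rdot dot (z *: (X n x - Y x)) x <= d n.
  move=> z1; apply: le_trans (rdot_le normE _ _) _.
  by rewrite hnormZ z1 mul1r.
have E n (z : R[i]) : rdot dot (z *: (X n x - Y x)) x =
    complex.Re (z * (dot (X n x) x - dot (Y x) x)).
  by rewrite /rdot dotZl dotBl.
have ni : `|'i : R[i]| = 1 by rewrite normc_def /= expr0n expr1n add0r sqrtr1.
rewrite lecE; apply/andP; split.
  rewrite eq_le; apply/andP; split.
    apply: small => n Nn.
    have := dXY n 'i ni; rewrite E Re_iM.
    have := pX n Nn x; case: (dot (X n x) x) (dot (Y x) x) => a b [u v].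
    by move=> /andP[/eqP /= -> _]; rewrite add0r opprK.
  rewrite -oppr_le0; apply: small => n Nn.
  have := dXY n (- 'i); rewrite normrN => /(_ ni); rewrite E mulNr ReN Re_iM.
  have := pX n Nn x; case: (dot (X n x) x) (dot (Y x) x) => a b [u v].
  by move=> /andP[/eqP /= -> _]; rewrite add0r opprK.
rewrite -oppr_le0; apply: small => n Nn.
have := dXY n 1 (normr1 _); rewrite E mul1r.
have := ge0_Re (pX n Nn x); case: (dot (X n x) x) (dot (Y x) x) => a b [u v] /= h1 h2.
by rewrite (le_trans _ h2)// lerDr.
Qed.

End SubSeries.

Section SubSums.
Context {R : realType} {H : completeNormedModType R[i]}.
Variable dot : {dot H for Num.conj}.
Hypothesis normE : forall x : H, `|x| ^+ 2 = dot x x.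
Variable e : nat -> H.
Hypothesis he : orthonormal_basis dot e.

Local Notation pos := (positive_op dot).

Variable b : nat -> 'B(H).
Hypothesis pb : forall n, pos (b n).
Hypothesis b1 : forall n, pos (1 - \sum_(0 <= i < n) b i).

Let term (M : set nat) i : 'B(H) := if `[< M i >] then b i else 0.
Let S (M : set nat) n : 'B(H) := \sum_(0 <= i < n) term M i.

Let pterm M i : pos (term M i).
Proof. by rewrite /term; case: ifP => _; [exact: pb|exact: pos0]. Qed.

Let pS1 M n : pos (1 - S M n).
Proof.
have -> : 1 - S M n = (1 - \sum_(0 <= i < n) b i) + \sum_(0 <= i < n) (b i - term M i).
  by rewrite sumrB addrA subrK.
apply: posD => //; apply: pos_sum => i _; rewrite /term; case: ifP => _.
  by rewrite subrr; exact: pos0.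
by rewrite subr0.
Qed.

Let S_diff M m n : (m <= n)%N -> S M n - S M m = \sum_(m <= i < n) term M i.
Proof. by move=> mn; rewrite /S (big_cat_nat (leq0n m) mn) /= addrAC subrr add0r. Qed.

Let S_diff_unit M m n : (m <= n)%N -> unit_interval dot (S M n - S M m).
Proof.
move=> mn; split; first by rewrite S_diff//; apply: pos_sum.
have -> : 1 - (S M n - S M m) = (1 - S M n) + S M m by rewrite opprB addrA addrAC.
by apply: posD => //; apply: pos_sum.
Qed.

(** An increment [X] of the partial sums lies in the unit interval, so [X * X] is below [X] and
    [hnorm (X x) ^+ 2] is at most the increment of the bounded sequence [rdot dot (S M n x) x]. *)
Let S_cvg M : exists T : 'B(H), forall x, S M n x @[n --> \oo] --> T x.
Proof.
have S_unit n : unit_interval dot (S M n).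
  by have := S_diff_unit M (leq0n n); rewrite {2}/S big_nil subr0.
apply: (@bop_strong_lim _ _ _ 1) => [n|x]; first exact: (unit_interval_opnorm normE he (S_unit n)).
apply: (@cvg_of_increments _ _ _ (fun n => rdot dot (S M n x) x) (hnorm x * hnorm x)) => [n|m n mn].
  apply: le_trans (rdot_le normE _ _) _.
  rewrite ler_wpM2r ?hnorm_ge0//; apply: le_trans (opnorm_bound _ _) _.
  by rewrite ler_piMl ?hnorm_ge0// (unit_interval_opnorm normE he (S_unit n)).
have iX := S_diff_unit M mn; rewrite -rdotBl -bop_subE.
move: (_ - _) iX => X iX; rewrite -(rd_sqr normE he) (unit_interval_adj normE he iX).
have := pos_rd x (pos_mul_compl normE he iX).
by rewrite mulrBr mulr1 bop_subE rdotBl subr_ge0.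
Qed.

(* T M is the strong sum of the b n with M n. *)
Lemma sub_sum : exists T : set nat -> 'B(H),
  [/\ forall M, pos (T M), forall M, pos (1 - T M),
      forall M n, M n -> pos (T M - b n) &
      forall M M1 M2, M1 `<=` M -> M2 `<=` M -> M1 `&` M2 = set0 ->
        pos (T M - (T M1 + T M2))].
Proof.
have [T hT] := choice S_cvg; exists T; split.
- move=> M; apply: (pos_strong_lim normE (N := 0) (hT M)) => n _.
  by apply: pos_sum.
- move=> M; apply: (@pos_strong_lim _ _ _ normE (fun n => 1 - S M n) _ 0%N) => // x.
  rewrite bop_subE; under eq_fun do rewrite bop_subE.
  by apply: cvgB; [exact: cvg_cst|exact: hT].
- move=> M n Mn; apply: (@pos_strong_lim _ _ _ normE (fun m => S M m - b n) _ n.+1).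
    move=> x; rewrite bop_subE; under eq_fun do rewrite bop_subE.
    by apply: cvgB; [exact: hT|exact: cvg_cst].
  move=> m nm; rewrite /S (bigD1_seq n) ?mem_index_iota ?iota_uniq//=.
  rewrite {1}/term asboolT// addrAC subrr add0r.
  by apply: pos_sum.
- move=> M M1 M2 s1 s2 d12.
  apply: (@pos_strong_lim _ _ _ normE (fun m => S M m - (S M1 m + S M2 m)) _ 0%N).
    move=> x; rewrite bop_subE bop_addE; under eq_fun do rewrite bop_subE bop_addE.
    by apply: cvgB; [exact: hT|apply: cvgD; exact: hT].
  move=> n _; rewrite /S -big_split -sumrB /=; apply: pos_sum => i _; rewrite /term.
  have [m1|m1] := pselect (M1 i).
    have nm2 : ~ M2 i by move=> m2; suff : set0 i by []; rewrite -d12; split.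
    rewrite (asboolT m1) (asboolF nm2) (asboolT (s1 _ m1)) addr0 subrr; exact: pos0.
  rewrite (asboolF m1) add0r; have [m2|m2] := pselect (M2 i).
    rewrite (asboolT m2) (asboolT (s2 _ m2)) subrr; exact: pos0.
  by rewrite (asboolF m2) subr0; case: ifP => _; [exact: pb|exact: pos0].
Qed.

End SubSums.

Section Separation.
Context {R : realType} {H : completeNormedModType R[i]}.
Variable dot : {dot H for Num.conj}.
Hypothesis normE : forall x : H, `|x| ^+ 2 = dot x x.
Variable e : nat -> H.
Hypothesis he : orthonormal_basis dot e.

Local Notation pos := (positive_op dot).
Local Notation adj := (adj dot).
Variable F : set (dual 'B(H)).
Hypothesis stF : forall phi, F phi -> is_state dot phi.

Lemma separating_operators : ~ uniformly_decreasing dot F ->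
  exists (psi : nat -> dual 'B(H)) (T : set nat -> 'B(H)) (eps : R),
    [/\ 0 < eps, forall n, F (psi n),
        forall A n, A n -> eps <= re_fun (psi n) (T A) &
        forall A n, ~ A n -> re_fun (psi n) (T A) <= eps / 2].
Proof.
move=> ndec.
have [k [eps [k1 e0 hk]]] : exists (k : nat -> 'B(H)) (eps : R),
    [/\ forall n, opnorm (k n) <= 1, 0 < eps &
    forall n, exists phi, F phi /\ state_norm dot phi (iterated_product k n.+1) ^+ 2 + eps
      <= state_norm dot phi (iterated_product k n) ^+ 2].
  apply: contrapT => h; apply: ndec => k k1 eps e0; apply: contrapT => h1; apply: h.
  exists k, eps; split=> // n; apply: contrapT => h2; apply: h1; exists n => phi Fphi.
  by rewrite ltNge; apply/negP => h3; apply: h2; exists phi.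
have [psi hpsi] := choice hk.
pose c := iterated_product k.
pose b n := adj (c n) * c n - adj (c n.+1) * c n.+1.
have pb n : pos (b n).
  have -> : b n = adj (c n) * (1 - adj (k n) * k n) * c n.
    by rewrite /b /= (adjM normE he) mulrBr mulr1 mulrBl !mulrA.
  apply: (pos_conj normE he).
  have -> : 1 - adj (k n) * k n = (1 - (opnorm (k n) ^+ 2)%:C *: (1 : 'B(H))) +
      ((opnorm (k n) ^+ 2)%:C *: (1 : 'B(H)) - adj (k n) * k n) by rewrite addrA subrK.
  apply: posD; last exact: (pos_opnorm_sqr normE he).
  have -> : 1 - (opnorm (k n) ^+ 2)%:C *: (1 : 'B(H)) = (1 - opnorm (k n) ^+ 2)%:C *: (1 : 'B(H)).
    by rewrite rmorphB scalerBl scale1r.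
  apply: posZ; last exact: (pos1 normE).
  by rewrite subr_ge0 exprn_ile1// opnorm_ge0.
have b1 n : pos (1 - \sum_(0 <= i < n) b i).
  have -> : 1 - \sum_(0 <= i < n) b i = adj (c n) * c n.
    rewrite -sumrN (eq_bigr (fun i => adj (c i.+1) * c i.+1 - adj (c i) * c i)); last first.
      by move=> i _; rewrite opprB.
    by rewrite telescope_sumr// /= (adj1 normE he) mulr1 addrCA subrr addr0.
  exact: (pos_sqr normE he).
have [T [pT pT1 Tb TD]] := sub_sum normE he pb b1.
have sp n : is_state dot (psi n) := stF (hpsi n).1.
have pp n := state_pos (sp n).
have bE n : eps <= re_fun (psi n) (b n).
  rewrite re_funB -!(state_norm_sqr normE he (pp n)) lerBrDl.
  exact: (hpsi n).2.
have le1 n M : re_fun (psi n) (T M) <= 1.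
  by rewrite -(re_fun1 (sp n)); exact: (re_fun_le (pp n) (pT1 M)).
have leD n M M1 M2 : M1 `<=` M -> M2 `<=` M -> M1 `&` M2 = set0 ->
    re_fun (psi n) (T M1) + re_fun (psi n) (T M2) <= re_fun (psi n) (T M).
  by move=> s1 s2 d12; rewrite -re_funD; apply: (re_fun_le (pp n)); exact: TD.
have [m [im hm]] := disjoint_selection (divr_gt0 e0 (ltr0n _ 2))
  (fun n M => re_fun_ge0 (pp n) (pT M)) le1 leD.
(* Indices are transported along [m]. By injectivity, if [n] is not in [A] then the image of [A]
   avoids [m n], and the selection bounds the value by [eps / 2]. *)
exists (psi \o m), (fun A => T (m @` A)), eps; split=> //.
- by move=> n; exact: (hpsi _).1.
- move=> A n An /=; apply: le_trans (bE (m n)) _; apply: (re_fun_le (pp _)).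
  by apply: Tb; exists n.
- move=> A n nA /=; apply: le_trans (ltW (hm n)); apply: (re_fun_le (pp _)).
  (* Monotonicity of [T] is obtained from its superadditivity with the empty set as second piece. *)
  have -> : T (range m `\ m n) - T (m @` A) =
      (T (range m `\ m n) - (T (m @` A) + T set0)) + T set0.
    by rewrite opprD addrA subrK.
  apply: posD (pT _); apply: TD; rewrite ?setI0//.
  move=> _ [i Ai <-]; split; first by exists i.
  by move=> /im ni; apply: nA; rewrite -ni.
Qed.

End Separation.

(** * The embedding of the Stone-Cech compactification *)

Lemma betaN_nbhsP (s : betaN) (U : set betaN) :
  nbhs s U <-> exists A, ultra s A /\ [set u | ultra u A] `<=` U.
Proof.
split=> [|[A [sA AU]]].
  rewrite nbhsE => -[B [[D _ <-] [A DA sA]] BU].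
  by exists A; split=> // u uA; apply: BU; exists A.
rewrite nbhsE; exists [set u | ultra u A] => //; split=> //.
exists [set A] => //; by rewrite bigcup_set1.
Qed.

Lemma betaN_eq (s s' : betaN) : (forall A, ultra s A -> ultra s' A) -> s = s'.
Proof.
move=> h; have E : ultra s = ultra s'.
  apply/seteqP; split=> // A s'A.
  have [//|/h nA] := in_ultra_setVsetC A (ultraP s).
  by have := filterI s'A nA; rewrite setICr => h1; case: (@filter_not_empty _ (ultra s') _ (h1 _)).
by case: s s' h E => U UU [U' UU'] _ /= E; subst U'; congr BetaN; exact: Prop_irrelevance.
Qed.

Section Embedding.
Context {R : realType} {H : completeNormedModType R[i]}.
Variable dot : {dot H for Num.conj}.
Hypothesis normE : forall x : H, `|x| ^+ 2 = dot x x.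
Variable e : nat -> H.
Hypothesis he : orthonormal_basis dot e.

Lemma fun_diff_le (phi psi : dual 'B(H)) T : complex.Re `|phi T - psi T| <=
  `|re_fun phi T - re_fun psi T| + `|re_fun phi ('i *: T) - re_fun psi ('i *: T)|.
Proof.
rewrite /re_fun !funZ !Re_iM -opprD normrN -ReB.
have -> : complex.Im (phi T) + - complex.Im (psi T) = complex.Im (phi T - psi T).
  by case: (phi T) (psi T) => [a b] [c d].
by have := normC_sum (phi T - psi T); rewrite lecE => /andP[].
Qed.

Lemma fun_diff_ge (phi psi : dual 'B(H)) T :
  `|re_fun phi T - re_fun psi T| <= complex.Re `|phi T - psi T|.
Proof. by rewrite /re_fun -ReB; exact: abs_Re_le. Qed.

(** The real parts at [T] and at ['i *: T] control both coordinates of [phi T], which reduces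
    weak-star continuity to estimates on [re_fun]. *)
Lemma weak_star_continuous (f : betaN -> weak_star 'B(H)) :
  (forall s0 T (eps : R), 0 < eps -> exists A, ultra s0 A /\
    forall s, ultra s A -> `|re_fun (f s : dual 'B(H)) T - re_fun (f s0 : dual 'B(H)) T| < eps) ->
  continuous f.
Proof.
move=> h; apply: continuous_comp_initial => s0; apply/pointwise_cvgP => [|T].
  by apply: (@fmap_filter _ _ _ (nbhs s0) (nbhs_filter s0)).
suff : ((f s : dual 'B(H)) T : R[i]^o) @[s --> s0] --> ((f s0 : dual 'B(H)) T : R[i]^o) by [].
apply/(@cvgrPdist_lt _ _ _ (nbhs s0) (nbhs_filter s0)) => eps' eps0.
have [eps e0 ->] : exists2 eps : R, 0 < eps & eps' = eps%:C.
  by exists (complex.Re eps'); [move: eps0; rewrite ltcE => /andP[]|exact: (ge0_ReE (ltW eps0))].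
have e2 : 0 < eps / 2 by rewrite divr_gt0.
have [A [sA hA]] := h s0 T _ e2; have [A' [sA' hA']] := h s0 ('i *: T) _ e2.
apply/betaN_nbhsP; exists (A `&` A'); split; first exact: filterI.
move=> s sAA' /=; rewrite distrC [X in X < _](ge0_ReE (normr_ge0 _)) ltcR.
apply: le_lt_trans (fun_diff_le _ _ _) _.
rewrite [eps]splitr ltrD//; [apply: hA|apply: hA']; by apply: filterS sAA' => x [].
Qed.

(** Send [s] to a limit of [psi] along [s]. The gap between [eps] and [eps / 2] survives the limit,
    so the value at [T A] decides whether [A] belongs to [s]. This gives injectivity and, evaluation
    at [T A] being weak-star continuous, continuity of the inverse. *)
Lemma copy_of_separation (F : set (dual 'B(H))) (psi : nat -> dual 'B(H))
    (T : set nat -> 'B(H)) (eps : R) : 0 < eps ->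
  (forall n, is_state dot (psi n)) ->
  (forall (s : betaN) phi, is_state dot phi -> state_limit (ultra s) psi phi -> F phi) ->
  (forall A n, A n -> eps <= re_fun (psi n) (T A)) ->
  (forall A n, ~ A n -> re_fun (psi n) (T A) <= eps / 2) ->
  contains_homeomorphic_copy betaN (F : set (weak_star 'B(H))).
Proof.
have num (d x y : R) : d <= x -> y <= d / 2 -> d / 2 <= x - y by move=> h1 h2; lra.
move=> e0 spsi Fpsi hA hnA.
have [f hf] := choice (fun s : betaN => ultra_state_limit normE he (ultraP s) spsi).
have fA s A : ultra s A -> eps <= re_fun (f s) (T A).
  move=> sA; apply/ler_addgt0Pl => d d0.
  have [n [/= h1 An]] := filter_ex (filterI ((hf s).2 (T A) d d0) sA).
  apply: le_trans (hA A n An) _; move: h1; rewrite ltr_distl => /andP[_ /ltW].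
  by rewrite addrC.
have fnA s A : ~ ultra s A -> re_fun (f s) (T A) <= eps / 2.
  move=> nsA; have sA : ultra s (~` A) by case: (in_ultra_setVsetC A (ultraP s)).
  apply/ler_addgt0Pl => d d0.
  have [n [/= h1 An]] := filter_ex (filterI ((hf s).2 (T A) d d0) sA).
  rewrite addrC -lerBlDr; apply: le_trans (hnA A n An); move: h1.
  by rewrite ltr_distl => /andP[/ltW].
have fi : injective f.
  move=> s s' E; apply: betaN_eq => A sA; apply: contrapT => /fnA.
  by rewrite -E => /(le_trans (fA _ _ sA)); rewrite leNgt ltr_pdivrMr// ltr_pMr// ltr1n.
pose B : set (weak_star 'B(H)) := range (f : betaN -> weak_star 'B(H)).
have fB s : (f s : weak_star 'B(H)) \in B by rewrite inE; exists s.
pose F' (s : betaN) : B := SigSub (fB s).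
have gex (y : B) : exists s, F' s = y.
  by have := set_valP y; rewrite /= => -[s _ E]; exists s; apply/val_inj.
have [g hg] := choice gex.
exists B, F', g; split=> //.
- by move=> _ [s _ <-]; exact: (Fpsi s _ (hf s).1 (hf s).2).
- by move=> s; apply: fi; have := congr1 val (hg (F' s)).
- apply: continuous_comp_initial; apply: (@weak_star_continuous f) => s0 S d d0.
  have d2 : 0 < d / 2 by rewrite divr_gt0.
  (* This set belongs to [s0]; for any [s] containing it the limit along [s] differs from [f s0] at
     [S] by less than two halves of [d]. *)
  exists [set n | `|re_fun (psi n) S - re_fun (f s0) S| < d / 2]; split; first exact: (hf s0).2.
  move=> s hs.
  have [n [/= h1 h2]] := filter_ex (filterI hs ((hf s).2 S _ d2)).
  apply: le_lt_trans (ler_distD (re_fun (psi n) S) _ _) _.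
  by rewrite [d]splitr ltrD// distrC.
- move=> y0 U /betaN_nbhsP[A [sA AU]].
  have d0 : 0 < eps / 2 by rewrite divr_gt0.
  have cT : continuous (fun y : B => (val y : dual 'B(H)) (T A)).
    move=> y; apply: (@continuous_comp _ _ _ (val : B -> weak_star 'B(H))
      (fun phi : weak_star 'B(H) => (phi : dual 'B(H)) (T A))).
      exact: initial_continuous.
    apply: (@continuous_comp _ _ _ (fun phi : weak_star 'B(H) =>
      ((phi : dual 'B(H)) : 'B(H) -> R[i]^o) : {ptws 'B(H) -> R[i]^o})
      (fun h : {ptws 'B(H) -> R[i]^o} => h (T A))).
      exact: initial_continuous.
    exact: proj_continuous.
  have d0C : (0 : R[i]) < (eps / 2)%:C by rewrite ltcR.
  move/cvgrPdist_lt : (cT y0) => /(_ _ d0C).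
  apply: filterS => y /= hy; apply: AU => /=; apply: contrapT => nA.
  have := fun_diff_ge (val y0) (val y) (T A).
  have Ey : val y = f (g y) by rewrite -[in LHS](hg y).
  have Ey0 : val y0 = f (g y0) by rewrite -[in LHS](hg y0).
  move: hy; rewrite [X in X < _](ge0_ReE (normr_ge0 _)) ltcR => hy h1.
  have := le_lt_trans h1 hy; rewrite Ey Ey0 ltNge => /negP; apply.
  by apply: le_trans (ler_norm _); exact: (num _ _ _ (fA _ _ sA) (fnA _ _ nA)).
Qed.

End Embedding.

(** * Extensions of a Dirac measure *)

Section DiagonalStates.
Context {R : realType} {H : completeNormedModType R[i]}.
Variable dot : {dot H for Num.conj}.
Hypothesis normE : forall x : H, `|x| ^+ 2 = dot x x.
Variable e : nat -> H.
Hypothesis he : orthonormal_basis dot e.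
Implicit Types (lambda : nat -> R[i]^o) (T a : 'B(H)).

Local Notation adj := (adj dot).

Lemma diagonal_adj lambda T : is_diagonal_op e lambda T ->
  is_diagonal_op e (fun n => (lambda n)^* : R[i]^o) (adj T).
Proof.
move=> dT n; set y := _ *: e n; pose z := adj T (e n) - y.
suff zE x : rdot dot x z = 0.
  apply/eqP; rewrite -subr_eq0 -/z; apply/eqP/hnorm_eq0/eqP.
  by rewrite -sqrf_eq0 -(rdotxx normE) zE.
apply: (dense_eq0 he (f := fun x => rdot dot x z) (hnorm_ge0 z) _ _ _ x) => [u v|u|a m].
- by rewrite rdotDl.
- by rewrite mulrC; exact: (rdot_le normE).
- rewrite /rdot dotBr -(adjE normE he) linearZ /= dT /y dotZr !dotZl !he.1 conjCK.
  by have [->|_] := eqVneq m n; rewrite ?mulr0 ?mulr1 ?subrr// mulrC subrr.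
Qed.

Lemma diagonal_mul lambda mu S T : is_diagonal_op e lambda S -> is_diagonal_op e mu T ->
  is_diagonal_op e (fun n => lambda n * mu n : R[i]^o) (S * T).
Proof. by move=> dS dT n; rewrite bop_mulE dT linearZ /= dS scalerA mulrC. Qed.

Lemma diagonal_sub_scalar lambda T (l : R[i]) : is_diagonal_op e lambda T ->
  is_diagonal_op e (fun n => lambda n - l : R[i]^o) (T - l *: (1 : 'B(H))).
Proof. by move=> dT n; rewrite bop_subE dT bop_scaleE bop_oneE scalerBl. Qed.

Lemma ultra_bounded_cvg (t : betaN) lambda : bounded_fun lambda ->
  exists l : R[i]^o, lambda n @[n --> ultra t] --> l.
Proof.
move=> /pinfty_ex_gt0[M M0 hM].
have hM' n : complex.Re `|lambda n| <= complex.Re M.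
  by have : (`|lambda n| : R[i]) <= (M : R[i]) := hM n I; rewrite lecE => /andP[].
have [x hx] := ultra_bounded_lim (ultraP t) (fun n => le_trans (abs_Re_le (lambda n)) (hM' n)).
have [y hy] := ultra_bounded_lim (ultraP t) (fun n => le_trans (abs_Im_le (lambda n)) (hM' n)).
exists (Complex x y); apply/cvgrPdist_lt => eps' eps0.
have [eps e0 ->] : exists2 eps : R, 0 < eps & eps' = eps%:C.
  by exists (complex.Re eps'); [move: eps0; rewrite ltcE => /andP[]|exact: (ge0_ReE (ltW eps0))].
have e2 : 0 < eps / 2 by rewrite divr_gt0.
apply: filterS (filterI (hx _ e2) (hy _ e2)) => n [/= h1 h2].
rewrite distrC; apply: le_lt_trans (normC_sum _) _; rewrite ltcR [eps]splitr.
by move: h1 h2; case: (lambda n) => u v /= h1 h2; rewrite ltrD.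
Qed.

Definition ultra_null_ops (t : betaN) : set 'B(H) := [set a | exists lambda T (l : R[i]^o),
  [/\ bounded_fun lambda, is_diagonal_op e lambda T, lambda n @[n --> ultra t] --> l &
      a = T - l *: (1 : 'B(H))]].

Lemma state_norm0_fun (phi : dual 'B(H)) a : is_state dot phi ->
  state_norm dot phi a = 0 -> phi a = 0.
Proof.
move=> sphi a0; have h (S : 'B(H)) : state_norm dot phi S = 0 -> re_fun phi S = 0.
  move=> S0; apply/normr0_eq0/eqP; rewrite eq_le normr_ge0 -S0 andbT.
  exact: (abs_re_fun normE he sphi).
have := h _ a0; have := h ('i *: a).
rewrite (state_normZ normE he) a0 mulr0 => /(_ erefl).
rewrite /re_fun funZ Re_iM => /eqP; rewrite oppr_eq0.
by case: (phi a) => x y /= /eqP -> ->.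
Qed.

(** For [a] equal to [T] minus its limit [l], the operator [adj a * a] is itself diagonal with
    entries [|lambda n - l|^2] tending to 0 along [t], so an extension of the Dirac measure vanishes
    on it. Conversely a null [a] has [phi a = 0], which says [phi T = l]. *)
Lemma delta_statesE (t : betaN) :
  delta_states dot e t = null_states dot (ultra_null_ops t).
Proof.
apply/seteqP; split=> phi [sphi hphi]; split=> //.
  move=> a [lambda [T [l [bl dT ll ->]]]].
  have da := diagonal_sub_scalar l dT; move: (_ - _) da => a' da.
  have daa := diagonal_mul (diagonal_adj da) da.
  have bg : bounded_fun (fun n => (lambda n - l)^* * (lambda n - l) : R[i]^o).
    have /pinfty_ex_gt0[M M0 hM] := bl.
    exists ((M + `|l|) ^+ 2); split; first by rewrite realX// realD// ?gtr0_real ?normr_real.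
    move=> K hK n _; apply: le_trans (ltW hK); rewrite normrM norm_conjC -expr2.
    rewrite lerXn2r ?nnegrE ?addr_ge0 ?(ltW M0)//.
    by apply: le_trans (ler_normB _ _) _; rewrite lerD2r; exact: (hM n I).
  have g0 : ((lambda n - l)^* * (lambda n - l) : R[i]^o) @[n --> ultra t] --> (0 : R[i]^o).
    move/cvgrPdist_lt : ll => ll; apply/cvgrPdist_lt => d d0.
    apply: filterS (filterI (ll _ ltr01) (ll _ d0)) => n [/= h1 h2].
    rewrite sub0r normrN normrM norm_conjC distrC; apply: le_lt_trans h2.
    by rewrite ler_piMl// ltW.
  have E : phi (adj a' * a') = 0 :> R[i]^o.
    exact: (cvg_unique (@norm_hausdorff _ _) (hphi _ _ bg daa) g0).
  by rewrite /state_norm /re_fun E sqrtr0.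
move=> lambda T bl dT; have [l ll] := ultra_bounded_cvg t bl.
have /(state_norm0_fun sphi) : state_norm dot phi (T - l *: (1 : 'B(H))) = 0.
  by apply: hphi; exists lambda, T, l.
rewrite funB funZ sphi.2 mulr1 => /eqP; rewrite subr_eq0 => /eqP ->.
exact: ll.
Qed.

Lemma null_states_limit (J : set 'B(H)) (I : Type) (U : set_system I) psi (phi : dual 'B(H)) :
  ProperFilter U -> (forall i, null_states dot J (psi i)) -> is_state dot phi ->
  state_limit U psi phi -> null_states dot J phi.
Proof.
move=> PU hpsi sphi lphi; split=> // a Ja.
rewrite /state_norm; suff -> : re_fun phi (adj a * a) = 0 by rewrite sqrtr0.
apply: (ultra_lim_unique PU (f := fun i => re_fun (psi i) (adj a * a))); first exact: lphi.
move=> eps e0; apply: (filterS (P := setT)); last exact: filterT.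
move=> i _ /=; rewrite subr0 -(state_norm_sqr normE he (state_pos (hpsi i).1)).
by rewrite ((hpsi i).2 a Ja) expr0n normr0.
Qed.

Lemma null_states_dichotomy (J : set 'B(H)) : in_finite_dim_subspace (null_states dot J) \/
  contains_homeomorphic_copy betaN (null_states dot J : set (weak_star 'B(H))).
Proof.
have [dec|ndec] := pselect (uniformly_decreasing dot (null_states dot J)).
  by left; exact: (null_states_finite_dim normE he dec).
right; have stF phi : null_states dot J phi -> is_state dot phi by case.
have [psi [T [eps [e0 Fpsi h1 h2]]]] := separating_operators normE he stF ndec.
apply: (copy_of_separation normE he e0 _ _ h1 h2) => [n|s phi sphi lphi].
  exact: (stF _ (Fpsi n)).
exact: null_states_limit lphi.
Qed.

End DiagonalStates.

Theorem theorem3p3 (R : realType) (H : completeNormedModType R[i])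
    (dot : {dot H for Num.conj})
    (normE : forall x : H, `|x| ^+ 2 = dot x x)
    (e : nat -> H) (he : orthonormal_basis dot e) (t : betaN) :
  in_finite_dim_subspace (delta_states dot e t) \/
  contains_homeomorphic_copy betaN
    (delta_states dot e t : set (weak_star 'B(H))).
Proof.
rewrite (delta_statesE normE he); exact: (null_states_dichotomy normE he).
Qed.
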